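(* Let $n\ge1$ and let $M=A\circ X+B$ be an $n\times n$ structured random matrix with standard deviation profile $A=(a_{ij})$, mean profile $B$ and $\kappa_0$-spread atom variable $\xi$, where $\kappa_0\ge1$. Assume that for some $\sigma_0,\varepsilon\in(0,1)$ we have $a_{ij}\ge\sigma_0$ for all $i,j\in[n]$ with $\min(|i-j|,\,n-|i-j|)\le\varepsilon n$. Let $K\ge1$. Then for any $t\ge0$, \[ \mathbb{P}\Big( s_n(M)\le\frac{t}{\sqrt n},\ \|M\|\le K\sqrt n\Big)\ \le\ C\Big(t+\frac1{\sqrt n}\Big), \] where $C<\infty$ depends only on $K,\sigma_0,\varepsilon,\kappa_0$.
   Context: Structured random matrix: $A=(a_{ij})$ and $B=(b_{ij})$ are deterministic $n\times n$ matrices with $a_{ij}\in[0,1]$ and $b_{ij}\in\mathbb{C}$; $X=(\xi_{ij})$ is an $n\times n$ matrix with independent entries, all distributed as a complex random variable $\xi$ (the atom variable) with $\mathbb{E}\xi=0$ and $\mathbb{E}|\xi|^2=1$; $M=A\circ X+B=(a_{ij}\xi_{ij}+b_{ij})$. A complex random variable $\xi$ is $\kappa$-spread ($\kappa\ge1$) if $\mathrm{Var}\big[\xi 1(|\xi-\mathbb{E}\xi|\le\kappa)\big]\ge1/\kappa$. $s_1(M)\ge\dots\ge s_n(M)\ge0$ are the singular values of $M$, and $\|M\|=s_1(M)$ is the $\ell_2\to\ell_2$ operator norm. *)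

(* Defs.v *)
From HB Require Import structures.
From mathcomp Require Import all_boot all_order all_algebra.
From mathcomp Require Import spectral sesquilinear.
From mathcomp Require Import complex.
From mathcomp Require Import all_classical all_reals all_analysis.

Set Implicit Arguments.
Unset Strict Implicit.
Unset Printing Implicit Defensive.

Import Order.TTheory GRing.Theory Num.Theory.
Import numFieldNormedType.Exports.

Local Open Scope classical_set_scope.
Local Open Scope ring_scope.
Local Open Scope complex_scope.
Local Open Scope sesquilinear_scope.

(* The norm `|z| of R[i] is itself an element of R[i]; [cabs z] is the modulus
   as an element of R. *)
Definition cabs (R : realType) (z : R[i]) : R := ComplexField.Normc.normc z.

(* The Borel structure on the complex plane is the one of R * R, transported
   along this bijection. *)
Definition reim (R : realType) (z : R[i]) : R * R := (complex.Re z, complex.Im z).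

Section ComplexRandomVariables.
Context {d : measure_display} {T : measurableType d} {R : realType}.
Variable P : probability T R.

Definition complex_rv (Z : T -> R[i]) : Prop :=
  measurable_fun [set: T] (fun w => reim (Z w)).

(* Meaningful for integrable Z, since [fine] sends infinite values to 0. *)
Definition cexpectation (Z : T -> R[i]) : R[i] :=
  (fine 'E_P[fun w => complex.Re (Z w)]) +i* (fine 'E_P[fun w => complex.Im (Z w)]).

Definition cvariance (Z : T -> R[i]) : \bar R :=
  'E_P[fun w => cabs (Z w - cexpectation Z) ^+ 2].

Definition truncation (kappa : R) (xi : T -> R[i]) (w : T) : R[i] :=
  if cabs (xi w - cexpectation xi) <= kappa then xi w else 0.

Definition spread (kappa : R) (xi : T -> R[i]) : Prop :=
  ((kappa^-1)%:E <= cvariance (truncation kappa xi))%E.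

Definition mutually_independent (I : finType) (Z : I -> T -> R[i]) : Prop :=
  forall (J : {set I}) (E : I -> set (R * R)),
    (forall i, measurable (E i)) ->
    P [set w | forall i, i \in J -> E i (reim (Z i w))] =
    (\prod_(i in J) P [set w | E i (reim (Z i w))])%E.

End ComplexRandomVariables.

Definition same_law (R : realType)
    (d1 : measure_display) (T1 : measurableType d1) (P1 : probability T1 R)
    (d2 : measure_display) (T2 : measurableType d2) (P2 : probability T2 R)
    (Z1 : T1 -> R[i]) (Z2 : T2 -> R[i]) : Prop :=
  forall E : set (R * R), measurable E ->
    P1 [set w | E (reim (Z1 w))] = P2 [set w | E (reim (Z2 w))].

Definition l2norm (R : realType) (n : nat) (v : 'cV[R[i]]_n) : R :=
  Num.sqrt (\sum_i cabs (v i 0) ^+ 2).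

Definition opnorm (R : realType) (n : nat) (M : 'M[R[i]]_n) : R :=
  sup [set l2norm (M *m v) | v in [set v : 'cV[R[i]]_n | l2norm v <= 1]].

(* Square roots of the eigenvalues of M^* M, with multiplicity and in
   nonincreasing order. As M^* M is Hermitian, [spectral_diag] lists its
   eigenvalues (orthomx_spectralP) and they are real
   (hermitian_spectral_diag_real). *)
Definition singular_values (R : realType) (n : nat) (M : 'M[R[i]]_n) : seq R :=
  sort >=%R [seq Num.sqrt (complex.Re (spectral_diag (M^t* *m M) 0 i))
            | i <- enum 'I_n].

(* Indexed from 1, so that [singular_value M n] is the smallest one. *)
Definition singular_value (R : realType) (n : nat) (M : 'M[R[i]]_n) (k : nat) : R :=
  nth 0 (singular_values M) k.-1.

Definition structured_matrix (R : realType) (n : nat)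
    (A : 'M[R]_n) (X B : 'M[R[i]]_n) : 'M[R[i]]_n :=
  \matrix_(i, j) ((A i j)%:C * X i j + B i j).

(* The distance between i and j on the cycle of length n. *)
Definition cyclic_dist (n : nat) (i j : 'I_n) : nat :=
  minn `|i - j|%N (n - `|i - j|%N)%N.

(* Main.v *)
Require Import Defs.
From mathcomp Require Import all_boot all_order all_algebra.
From mathcomp Require Import spectral sesquilinear.
From mathcomp Require Import complex.
From mathcomp Require Import all_classical all_reals all_analysis.
From mathcomp Require Import measurable_realfun.
From mathcomp Require Import ring lra zify.

Set Implicit Arguments.
Unset Strict Implicit.
Unset Printing Implicit Defensive.

Import Order.TTheory GRing.Theory Num.Theory.
Import numFieldNormedType.Exports.
Local Open Scope classical_set_scope.
Local Open Scope ring_scope.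
Local Open Scope sesquilinear_scope.

(** Why the bound holds.

    Everything rests on two small ball estimates for a linear form sum_j v_j
    xi_j in independent entries. A kappa-spread atom gives mass at most 1 - p
    to every disc of a fixed radius, with p and the radius depending on kappa
    only (spread_small_ball). Take two independent copies of the entries and
    exchange their coordinates by fair coins: the law does not change, and
    conditionally on the copies the form is a sum of random signs. The fourth
    moment of such a sum shows that the form leaves a disc of radius
    comparable with the norm of v with a fixed probability (small_ball_l2). If
    m coefficients have modulus at least tau, a decomposition into chains
    shows that it hits a disc of radius s with probability at most of order (s
    / tau + 1) / sqrt m (littlewood_offord).

    Cut the indices into L consecutive blocks of comparable sizes, with L > 2
    / eps. The band hypothesis bounds the standard deviation from below
    between equal or adjacent blocks (profile_of_band).

    Suppose that M u is short for a unit vector u. The key claim is that, up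
    to an exponentially small probability, u has in every block a positive
    proportion of coordinates of modulus at least of order 1 / sqrt n
    (near_kernel_spread). To prove it, fix a set H of heavy blocks, take for N
    the rows adjacent to H, and suppose that u is negligible outside a set J
    of columns smaller than N by a fixed proportion of n. Replace the part of
    u on a small piece of the heavy blocks by a point z of a net, and
    condition on the columns of J outside this piece. The orthogonal
    complement of their span in the space of rows N has large dimension, hence
    contains a long staircase of orthonormal vectors with large pivots, each
    vanishing at the previous pivots (staircase_exists). Testing M z against
    the staircase and integrating one pivot row at a time gives a probability
    exponentially small in n (distance_to_span), at a rate that does not
    depend on the mass of the heavy blocks. The piece can therefore be taken
    so small that the net is affordable (near_kernel_bound). Now the set of
    blocks of mass above a threshold, for thresholds decreasing sufficiently
    fast, either exhausts all blocks or stabilises at a proper subset; a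
    proper subset has an adjacent block, which makes N larger than J, so this
    case is excluded by the bound. When all blocks are heavy, the same bound
    with J missing most of one block excludes vectors with few large
    coordinates in that block.

    Conclusion in the finite setting (smallest_singular_value_fin). If M u is
    shorter than t / sqrt n for a unit vector u, then by the key claim a
    positive proportion of indices k satisfy |u_k| >= c / sqrt n. Let eta_k be
    a unit vector normal to the columns other than k. Then <eta_k, M u> =
    <eta_k, col_k> u_k, whence |<eta_k, col_k>| is at most of order t. But
    eta_k is annihilated by the transpose of M without row k, so that it is
    spread in the block of k by the key claim, and it is independent of column
    k: Littlewood-Offord bounds the probability of this event by a multiple of
    t + 1 / sqrt n. Markov's inequality over k finishes the proof.

    These estimates are proved for entries with finitely many values, where
    conditioning is a finite sum. Rounding the entries to a grid of mesh 1/N,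
    with N >= 2 n ^ 2, moves the singular values by at most 1/n as long
    as no entry leaves the grid, and one leaves it with probability at most
    1/n, because the second moment is 1. The same rounding shows that the
    extreme singular values are measurable: they are 1-Lipschitz, hence limits
    of functions with finitely many values. *)

(** * Finite product spaces and resampling *)

Record finpmf (R : realType) (Om : finType) := FinPmf {
  mass :> Om -> R;
  mass_ge0 : forall a, 0 <= mass a;
  mass_sum1 : \sum_a mass a = 1
}.

Definition wt (R : realType) (I Om : finType) (w : finpmf R Om)
  (x : {ffun I -> Om}) : R := \prod_i w (x i).

Definition Ex (R : realType) (I Om : finType) (w : finpmf R Om)
  (g : {ffun I -> Om} -> R) : R := \sum_x wt w x * g x.

Definition pr (R : realType) (I Om : finType) (w : finpmf R Om)
  (A : {ffun I -> Om} -> Prop) : R := Ex w (fun x => (`[< A x >])%:R).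

Definition merge (I Om : finType) (S : pred I) (x y : {ffun I -> Om}) :
  {ffun I -> Om} := [ffun i => if S i then y i else x i].

Definition upd (I Om : finType) (x : {ffun I -> Om}) (j : I) (a : Om) :
  {ffun I -> Om} := [ffun i => if i == j then a else x i].

Section FiniteProduct.
Variables (R : realType) (I Om : finType) (w : finpmf R Om).
Implicit Types (A B C : {ffun I -> Om} -> Prop) (x y : {ffun I -> Om}) (g h : {ffun I -> Om} -> R).

Lemma wt_ge0 x : 0 <= wt w x.
Proof. by apply: prodr_ge0 => i _; apply: mass_ge0. Qed.

Lemma sum_wt : \sum_(x : {ffun I -> Om}) wt w x = 1.
Proof.
rewrite /wt -(bigA_distr_bigA (fun _ => w)) big1 // => i _.
exact: mass_sum1.
Qed.

Lemma eq_Ex g h : (forall x, g x = h x) -> Ex w g = Ex w h.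
Proof. by move=> gh; apply: eq_bigr => x _; rewrite gh. Qed.

Lemma Ex_le g h : (forall x, g x <= h x) -> Ex w g <= Ex w h.
Proof. by move=> gh; apply: ler_sum => x _; rewrite ler_wpM2l ?wt_ge0. Qed.

Lemma Ex_ge0 g : (forall x, 0 <= g x) -> 0 <= Ex w g.
Proof. by move=> g0; apply: sumr_ge0 => x _; rewrite mulr_ge0// wt_ge0. Qed.

Lemma Ex_cst c : Ex w (fun _ : {ffun I -> Om} => c) = c.
Proof. by rewrite /Ex -mulr_suml sum_wt mul1r. Qed.

Lemma ExD g h : Ex w (fun x => g x + h x) = Ex w g + Ex w h.
Proof. by rewrite /Ex -big_split /=; apply: eq_bigr => x _; rewrite mulrDr. Qed.

Lemma ExZ c g : Ex w (fun x => c * g x) = c * Ex w g.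
Proof. by rewrite /Ex mulr_sumr; apply: eq_bigr => x _; rewrite mulrCA. Qed.

Lemma Ex_sum (J : Type) (s : seq J) (P : pred J) (G : J -> {ffun I -> Om} -> R) :
  Ex w (fun x => \sum_(j <- s | P j) G j x) = \sum_(j <- s | P j) Ex w (G j).
Proof.
rewrite /Ex exchange_big /=; apply: eq_bigr => x _.
by rewrite mulr_sumr.
Qed.

Lemma Ex_prod (f : I -> Om -> R) :
  Ex w (fun x => \prod_i f i (x i)) = \prod_i \sum_a w a * f i a.
Proof.
rewrite /Ex /wt bigA_distr_bigA /=.
by apply: eq_bigr => x _; rewrite -big_split.
Qed.

Lemma Ex_coord (j : I) (f : Om -> R) :
  Ex w (fun x => f (x j)) = \sum_a w a * f a.
Proof.
transitivity (Ex w (fun x => \prod_i (if i == j then f (x i) else 1))).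
  apply: eq_Ex => x; rewrite (bigD1 j)//= eqxx big1 ?mulr1// => i ij.
  by rewrite (negbTE ij).
rewrite (Ex_prod (fun i a => if i == j then f a else 1)) (bigD1 j)//= eqxx.
rewrite [X in _ * X]big1 ?mulr1// => i ij; rewrite (negbTE ij).
by under eq_bigr do rewrite mulr1; apply: mass_sum1.
Qed.

(** The pair (x, y) of independent samples has the same law as the pair
    obtained by exchanging their coordinates in S. *)
Lemma Ex_merge (S : pred I) g :
  Ex w g = Ex w (fun x => Ex w (fun y => g (merge S x y))).
Proof.
rewrite -[LHS](@Ex_cst _) /Ex.
transitivity (\sum_x \sum_y wt w x * wt w y * g (merge S x y)); last first.
  apply: eq_bigr => x _; rewrite mulr_sumr.
  by apply: eq_bigr => y _; rewrite mulrA.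
transitivity (\sum_(y : {ffun I -> Om}) \sum_x wt w x * wt w y * g x).
  apply: eq_bigr => y _; rewrite mulr_sumr.
  by apply: eq_bigr => x _; rewrite mulrCA mulrA.
rewrite exchange_big /= !pair_big /=.
pose swap (p : {ffun I -> Om} * {ffun I -> Om}) :=
  (merge S p.1 p.2, merge S p.2 p.1).
have swapK : involutive swap.
  move=> [x y]; congr pair; apply/ffunP => i; rewrite !ffunE /=;
    by case: (S i).
rewrite [RHS](reindex_inj (inv_inj swapK)) /=.
apply: eq_bigr => -[x y] _ /=; congr (_ * g _); last first.
  by apply/ffunP => i; rewrite !ffunE; case: (S i).
rewrite /wt -!big_split /=; apply: eq_bigr => i _.
by rewrite !ffunE; case: (S i) => //; rewrite mulrC.
Qed.

Lemma Ex_upd (j : I) g :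
  Ex w g = Ex w (fun x => \sum_a w a * g (upd x j a)).
Proof.
rewrite (Ex_merge (pred1 j)); apply: eq_Ex => x.
rewrite -(Ex_coord j (fun a => g (upd x j a))); apply: eq_Ex => y; congr g.
by apply/ffunP => i; rewrite !ffunE /=; case: eqP => // ->.
Qed.

Lemma Ex_reindex (s : I -> I) g : bijective s ->
  Ex w g = Ex w (fun x => g [ffun i => x (s i)]).
Proof.
move=> bs; case: (bs) => t st ts.
rewrite /Ex (reindex (fun x : {ffun I -> Om} => [ffun i => x (s i)])) /=.
  apply: eq_bigr => x _; congr (_ * _); rewrite /wt [RHS](reindex s)/=.
    by apply: eq_bigr => i _; rewrite ffunE.
  exact: onW_bij.
apply: onW_bij; exists (fun x : {ffun I -> Om} => [ffun i => x (t i)]) => x;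
  by apply/ffunP => i; rewrite !ffunE ?st ?ts.
Qed.

Lemma pr_le1 A : pr w A <= 1.
Proof.
by rewrite -(Ex_cst 1); apply: Ex_le => x; case: `[< _ >]; rewrite ?ler01 ?lexx.
Qed.

Lemma pr_le A B : (forall x, A x -> B x) -> pr w A <= pr w B.
Proof.
move=> AB; apply: Ex_le => x.
case: (asboolP (A x)) => [/AB|_]; last exact: ler0n.
by move=> /asboolT ->.
Qed.

Lemma pr_leU A B C : (forall x, A x -> B x \/ C x) -> pr w A <= pr w B + pr w C.
Proof.
move=> AB; rewrite -ExD; apply: Ex_le => x.
case: (asboolP (A x)) => [/AB|_]; last by rewrite addr_ge0// ler0n.
by move=> [/asboolT ->|/asboolT ->]; rewrite ?lerDl ?lerDr ?ler0n.
Qed.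

Lemma pr_le_sum (J : finType) (P : pred J) A (B : J -> {ffun I -> Om} -> Prop) :
  (forall x, A x -> exists2 j, P j & B j x) ->
  pr w A <= \sum_(j | P j) pr w (B j).
Proof.
move=> AB; rewrite -Ex_sum; apply: Ex_le => x.
case: (asboolP (A x)) => [/AB[j Pj Bj]|_]; last by rewrite sumr_ge0// => j _; rewrite ler0n.
rewrite (bigD1 j)//= asboolT// lerDl sumr_ge0// => *; exact: ler0n.
Qed.

Lemma markov_fin (a : R) g A : (forall x, 0 <= g x) ->
  (forall x, A x -> a <= g x) -> a * pr w A <= Ex w g.
Proof.
move=> g0 Ag; rewrite -ExZ; apply: Ex_le => x.
by case: asboolP => [/Ag|]; rewrite ?mulr1 ?mulr0.
Qed.

Lemma pr_merge (S : pred I) A :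
  pr w A = Ex w (fun x => pr w (fun y => A (merge S x y))).
Proof. exact: Ex_merge. Qed.

Lemma prC A : pr w (fun x => ~ A x) = 1 - pr w A.
Proof.
apply/eqP; rewrite eq_sym subr_eq -ExD -[X in X == _](Ex_cst 1); apply/eqP.
by apply: eq_Ex => x; rewrite asbool_neg; case: `[< _ >]; rewrite ?addr0 ?add0r.
Qed.

End FiniteProduct.

Lemma exchange_Ex (R : realType) (I J Om Om' : finType) (w : finpmf R Om)
    (w' : finpmf R Om') (g : {ffun I -> Om} -> {ffun J -> Om'} -> R) :
  Ex w (fun x => Ex w' (g x)) = Ex w' (fun y => Ex w (fun x => g x y)).
Proof.
rewrite /Ex; under eq_bigr do rewrite mulr_sumr.
rewrite exchange_big /=; apply: eq_bigr => y _; rewrite mulr_sumr.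
by apply: eq_bigr => x _; rewrite mulrCA.
Qed.

Section Signs.
Variable R : realType.

Lemma coin_ge0 (b : bool) : (0 : R) <= 2^-1.
Proof. by []. Qed.

Lemma coin_sum1 : \sum_(b : bool) (2^-1 : R) = 1.
Proof. by rewrite big_bool /=; lra. Qed.

Definition coin : finpmf R bool := FinPmf coin_ge0 coin_sum1.

(** Exchanging the coordinates of two independent samples by fair coins does
    not change the law: this replaces an arbitrary sum of independent terms by
    a sum of random signs, conditionally on both samples. *)
Lemma Ex_coins (I Om : finType) (w : finpmf R Om) (g : {ffun I -> Om} -> R) :
  Ex w g = Ex w (fun x => Ex w (fun y =>
    Ex coin (fun e : {ffun I -> bool} => g (merge (fun i => e i) x y)))).
Proof.
transitivity (Ex coin (fun _ : {ffun I -> bool} => Ex w g)); first by rewrite Ex_cst.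
under eq_Ex => e do rewrite (Ex_merge w (fun i => e i)).
rewrite exchange_Ex; apply: eq_Ex => x; exact: exchange_Ex.
Qed.

Lemma Ex_coin_upd (I : finType) (j : I) (g : {ffun I -> bool} -> R) :
  Ex coin g = Ex coin (fun e => (g (upd e j true) + g (upd e j false)) / 2).
Proof.
rewrite (Ex_upd coin j); apply: eq_Ex => e; rewrite big_bool /=; lra.
Qed.

End Signs.

(** * Complex moduli and sums of random signs *)

Section Modulus.
Variable R : realType.
Implicit Types (a b z : R[i]).

Lemma cabs2E z : cabs z ^+ 2 = complex.Re z ^+ 2 + complex.Im z ^+ 2.
Proof. by case: z => a b /=; rewrite /cabs /= sqr_sqrtr// addr_ge0// sqr_ge0. Qed.

Lemma cabs_ge0 z : 0 <= cabs z.
Proof. by case: z => a b; rewrite /cabs /= sqrtr_ge0. Qed.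

Lemma cabsM a b : cabs (a * b) = cabs a * cabs b.
Proof. exact: ComplexField.Normc.normcM. Qed.

Lemma cabsD a b : cabs (a + b) <= cabs a + cabs b.
Proof. exact: le_normcD. Qed.

Lemma cabsN a : cabs (- a) = cabs a.
Proof. exact: normcN. Qed.

Lemma cabs0 : cabs (0 : R[i]) = 0.
Proof. exact: ComplexField.Normc.normc0. Qed.

Lemma cabs_real (x : R) : cabs (x%:C)%C = `|x|.
Proof. by rewrite /cabs /= expr0n addr0 sqrtr_sqr. Qed.

Lemma cabs_eq0 z : (cabs z == 0) = (z == 0).
Proof.
by apply/eqP/eqP => [/ComplexField.Normc.eq0_normc//|->]; rewrite cabs0.
Qed.

Lemma Re_le_cabs z : `|complex.Re z| <= cabs z.
Proof.
rewrite -(ger0_norm (cabs_ge0 z)) -ler_sqr ?nnegrE// !real_normK ?num_real//.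
by rewrite cabs2E lerDl sqr_ge0.
Qed.

Lemma Im_le_cabs z : `|complex.Im z| <= cabs z.
Proof.
rewrite -(ger0_norm (cabs_ge0 z)) -ler_sqr ?nnegrE// !real_normK ?num_real//.
by rewrite cabs2E lerDr sqr_ge0.
Qed.

Lemma ReD a b : complex.Re (a + b) = complex.Re a + complex.Re b.
Proof. by case: a b => ? ? []. Qed.

Lemma ImD a b : complex.Im (a + b) = complex.Im a + complex.Im b.
Proof. by case: a b => ? ? []. Qed.

Lemma ReN a : complex.Re (- a) = - complex.Re a.
Proof. by case: a. Qed.

Lemma ImN a : complex.Im (- a) = - complex.Im a.
Proof. by case: a. Qed.

Lemma Re_sum (I : Type) (s : seq I) (P : pred I) (F : I -> R[i]) :
  complex.Re (\sum_(i <- s | P i) F i) = \sum_(i <- s | P i) complex.Re (F i).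
Proof. by elim/big_rec2: _ => // i x y _ <-; rewrite ReD. Qed.

Lemma Im_sum (I : Type) (s : seq I) (P : pred I) (F : I -> R[i]) :
  complex.Im (\sum_(i <- s | P i) F i) = \sum_(i <- s | P i) complex.Im (F i).
Proof. by elim/big_rec2: _ => // i x y _ <-; rewrite ImD. Qed.

Lemma cabs_parallelogram a b :
  cabs (a + b) ^+ 2 + cabs (a - b) ^+ 2 = 2 * (cabs a ^+ 2 + cabs b ^+ 2).
Proof. by rewrite !cabs2E; case: a b => ? ? [? ?] /=; ring. Qed.

(** Identifying complex numbers with plane vectors, the two sides differ by 8
    times the square of the determinant of a and b. *)
Lemma cabs_fourth_power a b :
  (cabs (a + b) ^+ 2) ^+ 2 + (cabs (a - b) ^+ 2) ^+ 2 <=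
  2 * ((cabs a ^+ 2) ^+ 2 + 6 * cabs a ^+ 2 * cabs b ^+ 2 + (cabs b ^+ 2) ^+ 2).
Proof.
rewrite !cabs2E; case: a b => x y [u v] /=; rewrite -subr_ge0.
have -> : 2 * ((x ^+ 2 + y ^+ 2) ^+ 2 + 6 * (x ^+ 2 + y ^+ 2) * (u ^+ 2 + v ^+ 2)
    + (u ^+ 2 + v ^+ 2) ^+ 2) - (((x + u) ^+ 2 + (y + v) ^+ 2) ^+ 2
    + ((x - u) ^+ 2 + (y - v) ^+ 2) ^+ 2) = 8 * (x * v - y * u) ^+ 2 by ring.
by rewrite mulr_ge0// sqr_ge0.
Qed.

End Modulus.

Section SignSums.
Variables (R : realType) (I : finType).

Definition signed (V : zmodType) (b : bool) (h : V) : V := if b then h else - h.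

Lemma upd_sum (V : zmodType) (s : seq I) (j : I) (h : I -> V)
    (e : {ffun I -> bool}) b : j \notin s ->
  \sum_(i <- s) signed (upd e j b i) (h i) = \sum_(i <- s) signed (e i) (h i).
Proof.
move=> js; apply: eq_big_seq => i si; rewrite ffunE.
by case: eqP => // ij; move: js; rewrite -ij si.
Qed.

Variables (z : R[i]) (h : I -> R[i]).
Let Z (s : seq I) (e : {ffun I -> bool}) : R[i] :=
  z + \sum_(j <- s) signed (e j) (h j).
Let m (s : seq I) : R := cabs z ^+ 2 + \sum_(j <- s) cabs (h j) ^+ 2.

Let Z_upd j s e b : j \notin s ->
  Z (j :: s) (upd e j b) = Z s e + signed b (h j).
Proof. by move=> js; rewrite /Z big_cons upd_sum// ffunE eqxx addrCA addrC. Qed.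

Lemma signs_second_moment s : uniq s -> Ex (coin R) (fun e => cabs (Z s e) ^+ 2) = m s.
Proof.
elim: s => [_|j s IH /= /andP[js us]].
  by rewrite /Z /m; under eq_Ex do rewrite big_nil addr0; rewrite Ex_cst big_nil addr0.
rewrite (Ex_coin_upd j); under eq_Ex do rewrite !Z_upd//.
transitivity (Ex (coin R) (fun e => cabs (Z s e) ^+ 2) + cabs (h j) ^+ 2).
  rewrite -[X in _ + X](@Ex_cst _ I _ (coin R)) -ExD; apply: eq_Ex => e.
  by rewrite /= cabs_parallelogram mulrC mulKf// pnatr_eq0.
by rewrite IH// /m big_cons [RHS]addrCA addrC.
Qed.

(** The induction step loses nothing beyond the constant: with M the previous
    second moment and B the square of the new coefficient, it reduces to
    3 M ^ 2 + 6 B M + B ^ 2 <= 3 (M + B) ^ 2. *)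
Lemma signs_fourth_moment s : uniq s ->
  Ex (coin R) (fun e => (cabs (Z s e) ^+ 2) ^+ 2) <= 3 * m s ^+ 2.
Proof.
elim: s => [_|j s IH /= /andP[js us]].
  rewrite /Z /m; under eq_Ex do rewrite big_nil addr0.
  by rewrite Ex_cst big_nil addr0 ler_peMl ?sqr_ge0// ler1n.
rewrite (Ex_coin_upd j); under eq_Ex do rewrite !Z_upd//.
set B := cabs (h j) ^+ 2.
have B0 : 0 <= B by apply: sqr_ge0.
apply: (@le_trans _ _ (Ex (coin R) (fun e => (cabs (Z s e) ^+ 2) ^+ 2 +
    (6 * B * cabs (Z s e) ^+ 2 + B ^+ 2)))).
  apply: Ex_le => e; rewrite ler_pdivrMr// mulrC.
  apply: le_trans (cabs_fourth_power _ _) _ => /=.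
  by rewrite ler_pM2l//; rewrite le_eqVlt; apply/orP; left; apply/eqP; rewrite /B; ring.
rewrite ExD ExD ExZ Ex_cst signs_second_moment//.
have -> : m (j :: s) = m s + B by rewrite /m big_cons [LHS]addrCA addrC.
have m0 : 0 <= m s.
  by rewrite addr_ge0 ?sqr_ge0// sumr_ge0// => i _; rewrite sqr_ge0.
move: (IH us); set E := Ex _ _; move: (m s) m0 => M M0 ?; nra.
Qed.

End SignSums.

Section SignSumAnticoncentration.
Variables (R : realType) (I : finType) (z : R[i]) (h : I -> R[i]).

(** Paley-Zygmund: the fourth moment of a sum of signs is comparable with the
    square of its second moment, so the sum reaches its standard deviation with
    a fixed probability. *)
Lemma signs_not_small (m : R) : m = cabs z ^+ 2 + \sum_j cabs (h j) ^+ 2 ->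
  12^-1 <= pr (coin R) (fun e : {ffun I -> bool} =>
    m / 2 <= cabs (z + \sum_j signed (e j) (h j)) ^+ 2).
Proof.
move=> mE; pose Y (e : {ffun I -> bool}) := cabs (z + \sum_j signed (e j) (h j)) ^+ 2.
have Y0 e : 0 <= Y e by apply: sqr_ge0.
have m0 : 0 <= m.
  by rewrite mE addr_ge0 ?sqr_ge0// sumr_ge0// => i _; rewrite sqr_ge0.
have EY : Ex (coin R) Y = m by rewrite mE; have := @signs_second_moment R I z h _ (index_enum_uniq I).
have EY2 : Ex (coin R) (fun e => Y e ^+ 2) <= 3 * m ^+ 2.
  by rewrite mE; have := @signs_fourth_moment R I z h _ (index_enum_uniq I).
have [m_gt0|m_le0] := ltP 0 m; last first.
  have -> : m = 0 by apply/eqP; rewrite eq_le m_le0 m0.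
  rewrite mul0r; apply: (@le_trans _ _ 1); first by rewrite invf_le1// ler1n.
  rewrite -[leLHS](@Ex_cst _ I _ (coin R)); apply: Ex_le => e.
  by rewrite asboolT// Y0.
set p := pr _ _.
(* On the good event Y is at most Y ^ 2 / (12 m) + 3 m, by the AM-GM
   inequality; elsewhere it is at most m / 2. *)
have : Ex (coin R) Y <= m / 2 + ((12 * m)^-1 * Ex (coin R) (fun e => Y e ^+ 2) + 3 * m * p).
  rewrite /p /pr -!ExZ -ExD -[X in X + _](@Ex_cst _ I _ (coin R)) -ExD.
  apply: Ex_le => e; case: asboolP => [_|/negP]; last first.
    rewrite -ltNge mulr0 addr0 => /ltW; rewrite -/(Y e) => /le_trans; apply.
    by rewrite lerDl mulr_ge0// ?sqr_ge0// invr_ge0 mulr_ge0.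
  rewrite mulr1 -subr_ge0.
  have -> : m / 2 + ((12 * m)^-1 * Y e ^+ 2 + 3 * m) - Y e =
      m / 2 + (12 * m)^-1 * (Y e - 6 * m) ^+ 2 by field; rewrite gt_eqF.
  apply: addr_ge0; first exact: divr_ge0.
  by apply: mulr_ge0; rewrite ?sqr_ge0// invr_ge0 mulr_ge0.
rewrite EY => H.
have H2 : (12 * m)^-1 * Ex (coin R) (fun e => Y e ^+ 2) <= m / 4.
  rewrite mulrC ler_pdivrMr ?mulr_gt0//; apply: le_trans EY2 _; nra.
have : m * (3 * p) >= m * 4^-1 by lra.
rewrite ler_pM2l// => ?; lra.
Qed.

End SignSumAnticoncentration.

(** Combinatorial heart of the Littlewood-Offord bound. A chain is a list of
    points with consecutive gaps at least 2 a. Adding plus or minus a number of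
    modulus at least a to each of its points yields two lists, which can be
    rearranged into one chain longer by one and one chain shorter by one. *)
Section LittlewoodOfford.
Variables (R : realType) (lo a : R).
Hypothesis a_gt0 : 0 < a.

(** Adding signs one at a time, [hits hs y] is the number of sign choices that
    take y into the window of width 2 a starting at lo. *)
Fixpoint hits (hs : seq R) (y : R) : R :=
  if hs is h :: hs' then hits hs' (y + h) + hits hs' (y - h)
  else (lo <= y < lo + 2 * a)%R%:R.

(** The number of chains obtained from one chain of length k after g steps. *)
Fixpoint chains (g k : nat) : nat :=
  if k is k'.+1 then
    if g is g'.+1 then chains g' k.+1 + chains g' k' else 1%N
  else 0%N.

Definition gap : rel R := fun u v => u + 2 * a <= v.

Lemma gap_trans : transitive gap.
Proof. move=> x y z; rewrite /gap => xy yz; have := a_gt0; lra. Qed.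

(** A window of width 2 a contains at most one point of a chain, so a chain of
    length k hits it in at most [chains g k] ways after g steps. *)
Lemma chain_hits (hs c : seq R) : {in hs, forall h, a <= `|h|} ->
  sorted gap c -> \sum_(y <- c) hits hs y <= (chains (size hs) (size c))%:R.
Proof.
elim: hs c => [|h hs IH] c ha sc.
  case: c sc => [_|y c /=]; first by rewrite big_nil.
  elim: c y => [|y' c IHc] y /=.
    by move=> _; rewrite big_seq1 lern1; case: (_ && _).
  move=> /andP[yy' pc]; rewrite big_cons.
  case: (boolP (lo <= y < lo + 2 * a)%R) => [/andP[ly yl]|_].
    rewrite [X in _ + X]big1_seq ?addr0// => u /andP[_ u_c].
    have /allP/(_ _ u_c) : all (gap y) (y' :: c).
      by apply: order_path_min; [exact: gap_trans|rewrite /= yy'].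
    by rewrite /gap => ?; case: ltP => [?|]; rewrite ?andbF//; lra.
  by rewrite add0r; apply: IHc.
case/lastP: c sc => [_|c m sc]; first by rewrite big_nil.
rewrite size_rcons.
have ha' : {in hs, forall h, a <= `|h|} by move=> u us; apply: ha; rewrite inE us orbT.
pose k := `|h|.
have ka : a <= k by apply: ha; rewrite mem_head.
have step y : hits (h :: hs) y = hits hs (y - k) + hits hs (y + k).
  rewrite /= /k; case: (ger0P h) => _; first by rewrite addrC.
  by rewrite opprK.
under eq_bigr do rewrite step.
have gap_shift s d : sorted gap s -> sorted gap [seq y + d | y <- s].
  move=> ss; rewrite sorted_map; apply: sub_sorted ss => u v.
  by rewrite /gap /=; lra.
have sc' : sorted gap c by move: sc; apply: subseq_sorted gap_trans _ _ (subseq_rcons _ _).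
(* The shifts of c by - k and by k have the lengths of c; moving the last point
   m + k of the upper one to the end of the lower one keeps the gaps, since
   2 k is at least 2 a. *)
have c1s : sorted gap (rcons [seq y + - k | y <- rcons c m] (m + k)).
  rewrite map_rcons /=; move: (gap_shift _ (- k) sc); rewrite map_rcons.
  case: [seq _ | _ <- c] => [|u l] /=; first by rewrite /gap => _; rewrite andbT; lra.
  by rewrite !rcons_path last_rcons /gap => ->/=; lra.
have := lerD (IH _ ha' c1s) (IH _ ha' (gap_shift c k sc')).
rewrite -natrD size_rcons !size_map size_rcons.
rewrite -cats1 big_cat big_seq1 /= !big_map big_split /= => H; apply: le_trans H.
by rewrite -[rcons c m]cats1 !big_cat /= !big_seq1; lra.
Qed.

Lemma single_hits (hs : seq R) y : {in hs, forall h, a <= `|h|} ->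
  hits hs y <= (chains (size hs) 1)%:R.
Proof. by move=> ha; have := @chain_hits hs [:: y] ha isT; rewrite big_seq1. Qed.

Variable I : finType.

(** The signs of the coordinates in s are integrated one at a time; the remaining
    part y of the sum does not depend on them. *)
Lemma hits_signs (h : I -> R) (s : seq I) (t : seq R) (y : {ffun I -> bool} -> R) :
  uniq s -> {in s, forall j e b, y (upd e j b) = y e} ->
  Ex (coin R) (fun e => hits t (y e + \sum_(j <- s) signed (e j) (h j))) =
  Ex (coin R) (fun e => hits (catrev [seq h j | j <- s] t) (y e)) / 2 ^+ size s.
Proof.
elim: s t => [|j s IH] t /=.
  by move=> _ _; rewrite expr0 divr1; under eq_Ex do rewrite big_nil addr0.
move=> /andP[js us] ys; rewrite (Ex_coin_upd j).
transitivity (2^-1 * Ex (coin R) (fun e =>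
   hits (h j :: t) (y e + \sum_(j <- s) signed (e j) (h j)))).
  rewrite -ExZ; apply: eq_Ex => e /=.
  rewrite !big_cons !upd_sum// !ffunE eqxx !ys ?mem_head//= mulrC.
  by congr (_ * (hits _ _ + hits _ _)); ring.
rewrite IH//; last by move=> i si; apply: ys; rewrite inE si orbT.
by rewrite exprS invfM mulrCA.
Qed.

Lemma real_littlewood_offord (h : I -> R) (y : R) (G : pred I) :
  (forall j, G j -> a <= `|h j|) ->
  pr (coin R) (fun e : {ffun I -> bool} =>
     lo <= y + \sum_j signed (e j) (h j) < lo + 2 * a)
  <= (chains #|G| 1)%:R / 2 ^+ #|G|.
Proof.
move=> hG.
pose y' (e : {ffun I -> bool}) := y + \sum_(j | ~~ G j) signed (e j) (h j).
have -> : pr (coin R) (fun e : {ffun I -> bool} =>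
     lo <= y + \sum_j signed (e j) (h j) < lo + 2 * a) =
  Ex (coin R) (fun e => hits [::] (y' e + \sum_(j <- enum G) signed (e j) (h j))).
  apply: eq_Ex => e; rewrite asboolb /= /y' -addrA.
  by rewrite [\sum_j _](bigID G) /= [X in y + X]addrC big_enum.
rewrite hits_signs ?enum_uniq//; last first.
  move=> j; rewrite mem_enum => Gj e b; congr (_ + _); apply: eq_bigr => i Gi.
  rewrite ffunE; case: eqP => // ij; move: Gi; rewrite ij.
  by rewrite [G j]Gj.
rewrite -cardE ler_wpM2r// ?invr_ge0 ?exprn_ge0//.
rewrite -[leRHS](@Ex_cst _ I _ (coin R)); apply: Ex_le => e.
apply: le_trans (single_hits _ _) _.
  move=> u; rewrite catrevE cats0 mem_rev => /mapP[j]; rewrite mem_enum => Gj ->.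
  exact: hG.
by rewrite catrevE cats0 size_rev size_map -cardE.
Qed.

End LittlewoodOfford.

Section MiddleBinomial.
Local Open Scope nat_scope.

(** Pascal's rule summed by parts: the weights move from one row to the previous
    one. *)
Lemma bin_sum_pascal (g N : nat) (c : nat -> nat) : g < N ->
  \sum_(i < N.+1) 'C(g.+1, i) * c i = \sum_(i < N) 'C(g, i) * (c i + c i.+1).
Proof.
move=> gN; rewrite big_ord_recl /= bin0.
under eq_bigr => i _ do rewrite /bump /= add1n binS mulnDl.
under [RHS]eq_bigr do rewrite mulnDr.
rewrite !big_split /= addnA; congr (_ + _).
have -> : \sum_(i < N) 'C(g, i) * c i = \sum_(i < N.+1) 'C(g, i) * c i.
  by rewrite big_ord_recr /= bin_small// mul0n addn0.
by rewrite big_ord_recl /= bin0; congr (_ + _).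
Qed.

(** The lengths of the chains form a walk with steps +1 and -1 killed at 0: the
    reflection principle expresses their number by binomial coefficients, here
    those of i steps up with final displacement 2 i - g in (- k, k]. *)
Lemma chainsE g k N : g < N ->
  chains g k = \sum_(i < N) 'C(g, i) * ((g < 2 * i + k) && (2 * i <= g + k)).
Proof.
elim: g k N => [|g IH] k [//|N] gN.
  rewrite big_ord_recl big1 ?addn0; last by move=> i _; rewrite bin_small.
  by case: k.
case: k => [|k].
  by rewrite big1// => i _; rewrite (_ : _ && _ = false) ?muln0//; apply/negbTE; lia.
rewrite [LHS]/= (IH k.+2 N)// (IH k N)// -big_split /=.
rewrite (bin_sum_pascal (fun i => (g.+1 < 2 * i + k.+1) && (2 * i <= g.+1 + k.+1)))//.
apply: eq_bigr => i _; rewrite -mulnDr; congr (_ * _).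
do 4 (case: (boolP (_ && _)) => ?); lia.
Qed.

(** The ratio of consecutive terms on the left is 4 (2 k + 1) (2 k + 3) /
    (k + 1) ^ 2, which is below 16. *)
Lemma central_bin_bound k : 'C(k.*2, k) ^ 2 * k.*2.+1 <= 16 ^ k.
Proof.
elim: k => // k IH.
have E : k.+1 * 'C(k.+1.*2, k.+1) = 2 * k.*2.+1 * 'C(k.*2, k).
  have H1 : k.+1 * 'C(k.*2.+1, k.+1) = k.*2.+1 * 'C(k.*2, k) by rewrite mul_bin_diag.
  have H2 : 'C(k.*2.+1, k) = 'C(k.*2.+1, k.+1).
    by rewrite -[RHS]bin_sub; [congr 'C(_, _)|]; lia.
  by rewrite doubleS binS H2; lia.
rewrite -(@leq_pmul2l (k.+1 ^ 2)) ?expn_gt0// mulnA -expnMn E [16 ^ _]expnS.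
have -> : (2 * k.*2.+1 * 'C(k.*2, k)) ^ 2 * k.+1.*2.+1 =
  ('C(k.*2, k) ^ 2 * k.*2.+1) * (4 * k.*2.+1 * k.+1.*2.+1).
  by rewrite -!mulnn; ring.
have -> : k.+1 ^ 2 * (16 * 16 ^ k) = 16 ^ k * (16 * k.+1 ^ 2) by ring.
by apply: leq_mul => //; rewrite -mulnn; nia.
Qed.

(** A single point gives the middle binomial coefficient, whose square is at most
    4 ^ g / (g + 1). *)
Lemma chains_bound g : chains g 1 ^ 2 * g.+1 <= 4 ^ g.
Proof.
have -> : chains g 1 = 'C(g, uphalf g).
  have gh : uphalf g < g.+1 by rewrite uphalf_half; lia.
  rewrite (@chainsE _ _ g.+1)// (bigD1 (Ordinal gh))//= big1 ?addn0.
    by rewrite (_ : _ && _ = true) ?muln1//; apply/andP; rewrite uphalf_half; lia.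
  move=> i; rewrite -val_eqE /= => ig; rewrite (_ : _ && _ = false) ?muln0//.
  by move: ig; rewrite uphalf_half; apply: contraNF; lia.
have odd_case k : 'C(k.*2.+1, k.+1) ^ 2 * k.*2.+2 <= 4 ^ k.*2.+1.
  rewrite -(@leq_pmul2l (2 ^ 2))// mulnA -expnMn.
  have -> : 2 * 'C(k.*2.+1, k.+1) = 'C(k.+1.*2, k.+1).
    rewrite doubleS [RHS]binS (_ : 'C(k.*2.+1, k) = 'C(k.*2.+1, k.+1)); first by lia.
    by rewrite -[RHS]bin_sub; [congr 'C(_, _)|]; lia.
  apply: (@leq_trans ('C(k.+1.*2, k.+1) ^ 2 * k.+1.*2.+1)).
    by rewrite leq_mul2l doubleS leqnSn orbT.
  apply: leq_trans (central_bin_bound _) _.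
  by rewrite -[16]/(4 ^ 2) -[2 ^ 2]/4 -expnM -expnS leq_exp2l//; lia.
rewrite uphalf_half; move: (odd_double_half g).
move: (g./2) (odd g) => k [] /= <-; first by rewrite !add1n; apply: odd_case.
rewrite !add0n; apply: leq_trans (central_bin_bound _) _.
by rewrite -[16]/(4 ^ 2) -expnM leq_exp2l//; lia.
Qed.

End MiddleBinomial.

(** * Small ball probabilities of linear forms *)

Section SignSmallBall.
Variables (R : realType) (I : finType).

Lemma chains_ratio (g : nat) :
  (chains g 1)%:R / 2 ^+ g <= (Num.sqrt g.+1%:R)^-1 :> R.
Proof.
have sg : 0 < Num.sqrt g.+1%:R :> R by rewrite sqrtr_gt0.
rewrite -(ler_pM2r sg) mulVf ?gt_eqF//.
rewrite -ler_sqr ?nnegrE ?ler01// ?mulr_ge0 ?sqrtr_ge0 ?divr_ge0 ?ler0n//.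
rewrite expr1n !exprMn sqr_sqrtr ?ler0n// exprVn -exprM mulnC exprM.
rewrite mulrAC ler_pdivrMr ?exprn_gt0 ?exprn_gt0// mul1r.
by rewrite -natrX -natrM -!natrX ler_nat chains_bound.
Qed.

(** The interval of radius s is covered by about s / a windows of width 2 a. *)
Lemma real_signs_small_ball (h : I -> R) (y a s : R) (G : pred I) :
  0 < a -> 0 <= s -> (forall j, G j -> a <= `|h j|) ->
  pr (coin R) (fun e : {ffun I -> bool} => `|y + \sum_j signed (e j) (h j)| <= s)
  <= (s / a + 1) / Num.sqrt #|G|.+1%:R.
Proof.
move=> a0 s0 hG; pose K := (Num.truncn (s / a)).+1.
have sa0 : 0 <= s / a by rewrite divr_ge0// ltW.
pose lo (k : nat) : R := - s + 2 * a * k%:R.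
apply: (@le_trans _ _ (\sum_(k < K) pr (coin R) (fun e : {ffun I -> bool} =>
    lo k <= y + \sum_j signed (e j) (h j) < lo k + 2 * a))).
  apply: pr_le_sum => e; set u := y + _ => us.
  pose k := Num.truncn ((u + s) / (2 * a)).
  have us0 : 0 <= (u + s) / (2 * a).
    by rewrite divr_ge0 ?mulr_ge0 ?(ltW a0)//; move: us; rewrite ler_norml; lra.
  have /andP[k1 k2] := truncn_itv us0.
  move: k1 k2; rewrite -/k ler_pdivlMr ?ltr_pdivrMr ?mulr_gt0// => k1 k2.
  have kK : (k < K)%N.
    rewrite ltnS; apply: le_truncn.
    rewrite invfM mulrA ler_pM2r ?invr_gt0// ler_pdivrMr//.
    by move: us; rewrite ler_norml; lra.
  exists (Ordinal kK) => //=; rewrite /lo.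
  by apply/andP; split; [lra|move: k2; rewrite -natr1; lra].
apply: (@le_trans _ _ (\sum_(k < K) (Num.sqrt #|G|.+1%:R)^-1)).
  apply: ler_sum => k _; apply: le_trans (chains_ratio _).
  exact: real_littlewood_offord.
rewrite sumr_const card_ord -[_ *+ _]mulr_natl ler_wpM2r ?invr_ge0 ?sqrtr_ge0//.
by rewrite /K -natr1 lerD2r truncn_le.
Qed.

Lemma Re_signed b (h : R[i]) : complex.Re (signed b h) = signed b (complex.Re h).
Proof. by case: b => //=; rewrite ReN. Qed.

Lemma Im_signed b (h : R[i]) : complex.Im (signed b h) = signed b (complex.Im h).
Proof. by case: b => //=; rewrite ImN. Qed.

(** Half of the large coefficients have a large real part, or half of them have
    a large imaginary part. *)
Lemma signs_small_ball (h : I -> R[i]) (z : R[i]) (a s : R) (G : pred I) :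
  0 < a -> 0 <= s -> (0 < #|G|)%N -> (forall j, G j -> 2 * a <= cabs (h j)) ->
  pr (coin R) (fun e : {ffun I -> bool} => cabs (z + \sum_j signed (e j) (h j)) <= s)
  <= (s / a + 1) * Num.sqrt 2 / Num.sqrt #|G|%:R.
Proof.
move=> a0 s0 G0 hG.
have sa0 : 0 <= s / a by rewrite divr_ge0// ltW.
pose GR j := G j && (a <= `|complex.Re (h j)|).
pose GI j := G j && (a <= `|complex.Im (h j)|).
have card_split : (#|G| <= #|GR| + #|GI|)%N.
  rewrite -cardUI; apply: leq_trans (leq_addr _ _).
  apply: subset_leq_card; apply/fintype.subsetP => j Gj.
  have {}Gj : G j := Gj.
  rewrite !inE; rewrite /in_mem /= /GR /GI Gj /=; apply/negPn/negP; rewrite negb_or -!ltNge => /andP[hr hi].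
  have := hG j Gj; rewrite leNgt => /negP; apply.
  rewrite -ltr_sqr ?nnegrE ?cabs_ge0 ?mulr_ge0 ?(ltW a0)// cabs2E.
  have := ltr_sqr (normr_ge0 (complex.Re (h j))) (ltW a0); rewrite hr real_normK ?num_real// => ?.
  have := ltr_sqr (normr_ge0 (complex.Im (h j))) (ltW a0); rewrite hi real_normK ?num_real// => ?.
  nra.
have bound (H : pred I) : (#|G| <= 2 * #|H|)%N ->
    (s / a + 1) / Num.sqrt #|H|.+1%:R <= (s / a + 1) * Num.sqrt 2 / Num.sqrt #|G|%:R.
  move=> GH; rewrite -mulrA ler_wpM2l//; first by rewrite addr_ge0.
  rewrite ler_pdivlMr ?sqrtr_gt0 ?ltr0n// mulrC ler_pdivrMr ?sqrtr_gt0 ?ltr0n//.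
  by rewrite -sqrtrM ?ler0n// ler_wsqrtr// -natrM ler_nat; lia.
have [GRbig|GRsmall] := leqP #|G| (2 * #|GR|).
  apply: le_trans (bound _ GRbig).
  apply: le_trans (@real_signs_small_ball (fun j => complex.Re (h j))
    (complex.Re z) a s GR a0 s0 _); last by move=> j /andP[].
  apply: pr_le => e; apply: le_trans; apply: le_trans (Re_le_cabs _).
  by rewrite ReD Re_sum; under [in leRHS]eq_bigr do rewrite Re_signed.
have GIbig : (#|G| <= 2 * #|GI|)%N by lia.
apply: le_trans (bound _ GIbig).
apply: le_trans (@real_signs_small_ball (fun j => complex.Im (h j))
  (complex.Im z) a s GI a0 s0 _); last by move=> j /andP[].
apply: pr_le => e; apply: le_trans; apply: le_trans (Im_le_cabs _).
by rewrite ImD Im_sum; under [in leRHS]eq_bigr do rewrite Im_signed.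
Qed.

End SignSmallBall.

Section SmallBall.
Variables (R : realType) (Om : finType) (w : finpmf R Om) (val : Om -> R[i]) (r p : R).

(** The only information on the atom that the finite estimates use. *)
Definition anticonc := forall z : R[i], \sum_(a | cabs (val a - z) <= r) w a <= 1 - p.

Hypotheses (r_gt0 : 0 < r) (p_gt0 : 0 < p) (p_le1 : p <= 1) (AC : anticonc).

Lemma separated_mass (b : R[i]) : p <= \sum_a w a * (r < cabs (val a - b))%R%:R.
Proof.
have := AC b; have := mass_sum1 w.
rewrite (bigID (fun a => cabs (val a - b) <= r)) /= => E.
have -> : \sum_a w a * (r < cabs (val a - b))%R%:R =
    \sum_(a | ~~ (cabs (val a - b) <= r)) w a.
  rewrite [RHS]big_mkcond; apply: eq_bigr => a _.
  by rewrite -ltNge; case: ifP => _; rewrite ?mulr1 ?mulr0.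
lra.
Qed.

Variable I : finType.
Implicit Types (v : I -> R[i]) (x y : {ffun I -> Om}).

Let half : R[i] := ((2^-1 : R)%:C)%C.

Let half2 : half + half = 1.
Proof. by rewrite /half -rmorphD /= (_ : 2^-1 + 2^-1 = 1 :> R)//; lra. Qed.

Let cabs_half (a : R[i]) : cabs (half * a) = cabs a / 2.
Proof. by rewrite cabsM cabs_real ger0_norm// mulrC. Qed.

Let hd v x y j : R[i] := half * (v j * (val (y j) - val (x j))).

Let cabs_hd v x y j : cabs (hd v x y j) = cabs (v j) * cabs (val (y j) - val (x j)) / 2.
Proof. by rewrite cabs_half cabsM. Qed.

(** Exchanging x_j and y_j changes the sign of half of their difference and keeps
    half of their sum. *)
Lemma merge_linear_form (e : {ffun I -> bool}) v (z : R[i]) x y :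
  \sum_j v j * val (merge (fun i => e i) x y j) - z =
  (\sum_j half * (v j * (val (x j) + val (y j))) - z) +
  \sum_j signed (e j) (half * (v j * (val (y j) - val (x j)))).
Proof.
rewrite addrAC -big_split /=; congr (_ - _); apply: eq_bigr => j _.
rewrite ffunE -[LHS]mul1r -half2; case: (e j) => /=; ring.
Qed.

(** Conditionally on the two samples the form is a sum of signs, and a fixed
    proportion of its variance survives with probability at least p / 2. *)
Lemma small_ball_l2 v (z : R[i]) (tau : R) : 0 < tau -> tau ^+ 2 <= \sum_j cabs (v j) ^+ 2 ->
  pr w (fun x => cabs (\sum_j v j * val (x j) - z) <= r * p / 6 * tau) <= 1 - p / 24.
Proof.
move=> tau0 vtau; set V := \sum_j _ in vtau.
have V0 : 0 < V by apply: lt_le_trans vtau; rewrite exprn_gt0.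
rewrite lerBrDr -lerBrDl -prC.
rewrite /pr Ex_coins -[leLHS](@Ex_cst _ I _ w); apply: Ex_le => x.
(* Y is the part of the variance carried by the indices whose two samples are
   at distance more than r. Its mean is at least p V and it never exceeds V. *)
pose Y (y : {ffun I -> Om}) := \sum_j cabs (v j) ^+ 2 * (r < cabs (val (y j) - val (x j)))%R%:R.
have EY : p * V <= Ex w Y.
  rewrite /Y Ex_sum mulr_sumr; apply: ler_sum => j _.
  rewrite ExZ mulrC ler_wpM2l ?sqr_ge0//.
  by rewrite (Ex_coord w j (fun a => (r < cabs (val a - val (x j)))%R%:R)) separated_mass.
have YV y : Y y <= V.
  apply: ler_sum => j _; rewrite ler_piMr ?sqr_ge0//; by case: (_ < _); rewrite ?lexx ?ler01.
have Ygood : p / 2 <= pr w (fun y => p * V / 2 <= Y y).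
  have : Ex w Y <= p * V / 2 + V * pr w (fun y => p * V / 2 <= Y y).
    rewrite /pr -ExZ -[X in X + _](@Ex_cst _ I _ w) -ExD; apply: Ex_le => y.
    case: asboolP => [_|/negP]; rewrite ?mulr1 ?mulr0 ?addr0.
      apply: le_trans (YV y) _; rewrite lerDr.
      by rewrite divr_ge0 ?mulr_ge0 ?ltW.
    by rewrite -ltNge => /ltW.
  move=> /(le_trans EY) H; rewrite -(ler_pM2l V0); lra.
apply: le_trans (_ : 12^-1 * (p / 2) <= _); first lra.
apply: le_trans (ler_wpM2l _ Ygood) _; first by [].
rewrite /pr -ExZ; apply: Ex_le => y.
case: asboolP => [Yy|_]; last by rewrite mulr0 Ex_ge0.
rewrite mulr1; apply: le_trans (@signs_not_small R I (\sum_j half * (v j * (val (x j) + val (y j))) - z)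
  (hd v x y) _ (erefl _)) _.
apply: pr_le => e; rewrite -merge_linear_form.
set S := cabs (_ - z); set Z := cabs _ ^+ 2.
have Z0 : 0 <= Z by apply: sqr_ge0.
have W : r ^+ 2 / 4 * Y y <= \sum_j cabs (hd v x y j) ^+ 2.
  rewrite /Y mulr_sumr; apply: ler_sum => j _.
  rewrite cabs_hd; case: ltP => [rc|_]; last by rewrite mulr0 mulr0 sqr_ge0.
  rewrite mulr1; set A := cabs (v j); set c := cabs _.
  have -> : (A * c / 2) ^+ 2 = c ^+ 2 / 4 * A ^+ 2 by field.
  rewrite ler_wpM2r ?sqr_ge0// ler_wpM2r// ler_sqr ?nnegrE ?cabs_ge0 ?(ltW r_gt0)//.
  exact: ltW.
move=> H; apply/negP; rewrite -ltNge -ltr_sqr ?nnegrE ?cabs_ge0//; last first.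
  by rewrite !mulr_ge0 ?(ltW tau0) ?(ltW r_gt0) ?(ltW p_gt0).
apply: lt_le_trans H.
have : r ^+ 2 / 4 * (p * V / 2) <= r ^+ 2 / 4 * Y y.
  by rewrite ler_wpM2l// divr_ge0 ?sqr_ge0.
move=> /le_trans/(_ W) H.
apply: (@lt_le_trans _ _ (r ^+ 2 / 4 * (p * V / 2) / 2)); last first.
  by rewrite ler_pM2r//; apply: le_trans H _; rewrite lerDr sqr_ge0.
have r2 : 0 < r ^+ 2 by rewrite exprn_gt0.
rewrite !exprMn.
have -> : r ^+ 2 / 4 * (p * V / 2) / 2 = (r ^+ 2 * p) * (V / 16) by field.
have -> : r ^+ 2 * p ^+ 2 * 6^-1 ^+ 2 * tau ^+ 2 = (r ^+ 2 * p) * (p * tau ^+ 2 / 36) by field.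
rewrite ltr_pM2l ?mulr_gt0//.
have : p * tau ^+ 2 <= V.
  by apply: le_trans vtau; rewrite ler_piMl// sqr_ge0.
lra.
Qed.

(** Littlewood-Offord: conditionally on the two samples the form is a sum of
    signs, and with overwhelming probability a fixed proportion of the large
    coefficients remains large. *)
Lemma littlewood_offord v (z : R[i]) (tau s : R) (G : pred I) :
  0 < tau -> 0 <= s -> (0 < #|G|)%N -> (forall j, G j -> tau <= cabs (v j)) ->
  pr w (fun x => cabs (\sum_j v j * val (x j) - z) <= s) <=
  ((4 / r * (s / tau) + 1) * Num.sqrt (8 / p) + 4 / p) / Num.sqrt #|G|%:R.
Proof.
move=> tau0 s0 G0 vtau.
have m0 : 0 < #|G|%:R :> R by rewrite ltr0n.
set m : R := #|G|%:R in m0 *.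
have sm0 : 0 < Num.sqrt m by rewrite sqrtr_gt0.
have sp0 : 0 < Num.sqrt (8 / p) by rewrite sqrtr_gt0 divr_gt0.
have f0 : 0 <= 4 / r * (s / tau) + 1.
  by rewrite addr_ge0 ?mulr_ge0 ?invr_ge0 ?(ltW r_gt0) ?(ltW tau0).
rewrite [pr _ _]/pr Ex_coins -[leRHS](@Ex_cst _ I _ w); apply: Ex_le => x.
pose sep y : pred I := fun j => G j && (r < cabs (val (y j) - val (x j))).
(* Each pair of samples indexed by G is separated with probability at least p,
   independently: a Laplace transform bounds the probability that fewer than
   p m / 4 pairs are. *)
pose bad y := #|sep y|%:R < p * m / 4.
apply: (@le_trans _ _ (Ex w (fun y =>
    (4 / r * (s / tau) + 1) * Num.sqrt (8 / p) / Num.sqrt m + (`[< bad y >])%:R))).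
  apply: Ex_le => y; case: asboolP => [_|/negP]; last rewrite -leNgt addr0 => ybig.
    apply: ler_wpDl; last exact: pr_le1.
    by rewrite !mulr_ge0 ?invr_ge0 ?(ltW sm0) ?(ltW sp0).
  have sep0 : 0 < #|sep y|%:R :> R.
    by apply: lt_le_trans ybig; rewrite divr_gt0 ?mulr_gt0.
  have a0 : 0 < r * tau / 4 by rewrite divr_gt0 ?mulr_gt0.
  have := @signs_small_ball R I (hd v x y)
    (\sum_j half * (v j * (val (x j) + val (y j))) - z) _ s (sep y) a0 s0 _ _.
  rewrite ltr0n in sep0; move=> /(_ sep0) H.
  apply: le_trans (le_trans (H _) _).
  - by apply: pr_le => e; rewrite merge_linear_form.
  - move=> j /andP[Gj rj]; rewrite cabs_hd.
    have -> : 2 * (r * tau / 4) = tau * r / 2 by field.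
    by rewrite ler_pM2r// ler_pM ?(ltW tau0) ?(ltW r_gt0) ?vtau// ltW.
  - have -> : s / (r * tau / 4) = 4 / r * (s / tau).
      by field; rewrite !gt_eqF.
    rewrite -[leLHS]mulrA -[leRHS]mulrA ler_wpM2l// ler_pdivrMr ?sqrtr_gt0 ?ltr0n//.
    rewrite mulrAC ler_pdivlMr//.
    have p8 : 0 <= 8 / p by rewrite divr_ge0 ?(ltW p_gt0).
    rewrite -(@sqrtrM _ 2)// -(sqrtrM _ p8) ler_wsqrtr// mulrAC ler_pdivlMr//; lra.
rewrite ExD Ex_cst [leRHS]mulrDl lerD2l -/(pr w bad).
apply: (@le_trans _ _ (expR (- (p * m / 4)))); last first.
  have u0 : 0 < p * m / 4 by rewrite divr_gt0 ?mulr_gt0.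
  rewrite expRN; apply: (@le_trans _ _ ((p * m / 4)^-1)).
    rewrite lef_pV2 ?posrE ?expR_gt0//.
    by apply: le_trans (expR_ge1Dx _); rewrite lerDr.
  rewrite invfM invfM invrK mulrAC [p^-1 * 4]mulrC ler_wpM2l ?divr_ge0 ?(ltW p_gt0)//.
  rewrite lef_pV2 ?posrE// -{2}[m]sqr_sqrtr ?(ltW m0)// expr2 ler_pMl//.
  by rewrite -sqrtr1 ler_wsqrtr// ler1n.
pose f j b : R := if G j && (r < cabs (val b - val (x j))) then expR (- 1) else 1.
have f_ge0 j b : 0 <= f j b by rewrite /f; case: ifP => // _; rewrite ?expR_ge0 ?ler01.
have e1 : expR (- 1) <= 2^-1 :> R.
  rewrite expRN lef_pV2 ?posrE ?expR_gt0//.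
  by apply: le_trans (expR_ge1Dx _); lra.
have prodE (y : {ffun I -> Om}) : \prod_j f j (y j) = expR (- #|sep y|%:R).
  transitivity (\prod_(j | sep y j) expR (- 1 : R)); first by rewrite [RHS]big_mkcond.
  by rewrite prodr_const -expRM_natl mulrN1.
apply: (@le_trans _ _ (expR (p * m / 4) * Ex w (fun y => \prod_j f j (y j)))).
  rewrite -ExZ; apply: Ex_le => y; case: asboolP => [bady|_]; last first.
    by rewrite mulr_ge0 ?expR_ge0// prodr_ge0.
  rewrite prodE -expRD; apply: le_trans (expR_ge1Dx _); rewrite lerDl subr_ge0.
  exact: ltW.
rewrite Ex_prod.
have : \prod_j \sum_a w a * f j a <= expR (- (p * m / 2)).
  apply: (@le_trans _ _ (\prod_(j | G j) expR (- (p / 2)))); last first.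
    by rewrite prodr_const -expRM_natl ler_expR -/m; lra.
  rewrite [leRHS]big_mkcond; apply: ler_prod => j _; apply/andP; split.
    by apply: sumr_ge0 => a _; rewrite mulr_ge0// mass_ge0.
  rewrite /f; case: (G j) => /=; last by under eq_bigr do rewrite mulr1; rewrite mass_sum1.
  apply: (@le_trans _ _ (\sum_a (w a - 2^-1 * (w a * (r < cabs (val a - val (x j)))%R%:R)))).
    apply: ler_sum => a _; case: (_ < _); rewrite ?mulr1 ?mulr0 ?subr0//.
    have := mass_ge0 w a => ?; nra.
  rewrite sumrB mass_sum1 -mulr_sumr; have := separated_mass (val (x j)) => H.
  by apply: le_trans (expR_ge1Dx _); lra.
move=> /(ler_wpM2l (expR_ge0 (p * m / 4)))/le_trans; apply.
by rewrite -expRD ler_expR; lra.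
Qed.

End SmallBall.

(** * Orthonormal systems with large pivots *)

Definition sqnorm (R : realType) (n : nat) (y : 'I_n -> R[i]) : R :=
  \sum_i cabs (y i) ^+ 2.

(** The bilinear pairing, without conjugation: conjugates are carried by the
    orthogonality relation between rows. *)
Definition dotp (R : realType) (n : nat) (q : 'rV[R[i]]_n) (y : 'I_n -> R[i]) : R[i] :=
  \sum_i q 0 i * y i.

Section Orthonormal.
Variable R : realType.
Local Notation C := R[i].

Lemma mul_conj (z : C) : z * Num.conj z = ((cabs z ^+ 2)%:C)%C.
Proof. by rewrite -[Num.conj z]/(conjc z) -sqr_normc rmorphXn. Qed.

Lemma conj_mul (z : C) : Num.conj z * z = ((cabs z ^+ 2)%:C)%C.
Proof. by rewrite mulrC mul_conj. Qed.

Lemma mulmx_tC m n (A : 'M[C]_(m, n)) i :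
  (A *m A^t*) i i = ((sqnorm (A i))%:C)%C.
Proof.
rewrite mxE rmorph_sum /=; apply: eq_bigr => j _.
by rewrite !mxE mul_conj.
Qed.

(** Among the coordinate vectors, whose projections onto the row space E have
    squared norms adding up to the rank of E, take one with the longest
    projection and normalise the projection. *)
Lemma large_pivot m n (E : 'M[C]_(m, n)) (d : nat) :
  (0 < d)%N -> (d <= \rank E)%N ->
  exists q : 'rV[C]_n, exists i : 'I_n,
    [/\ (q <= E)%MS, sqnorm (q 0) = 1, d%:R / n%:R <= cabs (q 0 i) ^+ 2
      & forall v : 'rV[C]_n, (v <= E)%MS -> v 0 i = 0 -> v *m q^t* = 0].
Proof.
move=> d0 dE; have rn : (\rank E <= n)%N by apply: rank_leq_col.
have n0 : (0 < n)%N by apply: leq_trans d0 (leq_trans dE rn).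
pose U := schmidt (row_base E).
have UU : U *m U^t* = 1%:M.
  by apply/unitarymxP; apply: schmidt_unitarymx; rewrite rn.
have UE : (U :=: E)%MS.
  exact: eqmx_trans (eqmx_schmidt_free (row_base_free E)) (eq_row_base E).
pose c i := sqnorm (fun l => U l i).
have sum_c : \sum_i c i = (\rank E)%:R.
  rewrite /c /sqnorm exchange_big /=.
  transitivity (\sum_(l < \rank E) (1 : R)); last first.
    by rewrite sumr_const card_ord.
  apply: eq_bigr => l _; apply: complexI.
  by rewrite -[LHS](mulmx_tC U l) UU mxE eqxx.
have [i ci] : exists i, d%:R / n%:R <= c i.
  apply/not_existsP => /= small.
  have : \sum_i c i < \sum_(i < n) d%:R / n%:R.
    apply: ltr_sum; last by move=> i _; rewrite ltNge; apply/negP.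
    by apply/hasP; exists (Ordinal n0); rewrite ?mem_index_enum.
  rewrite sumr_const card_ord -[X in _ < X]mulr_natr mulfVK ?pnatr_eq0 -?lt0n//.
  by rewrite sum_c ltr_nat ltnNge dE.
have c_gt0 : 0 < c i by apply: lt_le_trans ci; rewrite divr_gt0 ?ltr0n.
pose s := Num.sqrt (c i).
have s_gt0 : 0 < s by rewrite sqrtr_gt0.
pose k : C := ((s^-1)%:C)%C.
pose q := k *: ((col i U)^t* *m U).
have conj_k : Num.conj k = k by rewrite -[Num.conj k]/(conjc k) conjc_real.
have colcol : (col i U)^t* *m col i U = ((c i)%:C)%C%:M.
  apply/matrixP => a b; rewrite !ord1 !mxE eqxx mulr1n rmorph_sum /=.
  by apply: eq_bigr => l _; rewrite !mxE conj_mul.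
have qUt : q^t* = k *: (U^t* *m col i U).
  apply/matrixP => a b; rewrite ord1 !mxE rmorphM; congr (_ * _); first exact: conj_k.
  rewrite rmorph_sum; apply: eq_bigr => l _.
  by rewrite !mxE rmorphM mulrC; congr (_ * _); apply: conjCK.
have ks : k ^+ 2 * ((c i)%:C)%C = 1.
  rewrite -rmorphXn -rmorphM /= exprVn sqr_sqrtr ?(ltW c_gt0)//.
  by rewrite mulVf ?gt_eqF.
exists q, i; split.
- by apply: scalemx_sub; rewrite -UE submxMl.
- apply: complexI; rewrite -[LHS](mulmx_tC q 0) qUt /q -scalemxAr -scalemxAl scalerA.
  rewrite -mulmxA (mulmxA U) UU mul1mx colcol -expr2 mxE mxE eqxx mulr1n.
  exact: ks.
- have -> : q 0 i = (s%:C)%C.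
    have -> : q 0 i = k * ((col i U)^t* *m col i U) 0 0.
      by rewrite !mxE; congr (_ * _); apply: eq_bigr => l _; rewrite !mxE.
    rewrite colcol mxE eqxx mulr1n -rmorphM /=; congr (_%:C)%C.
    by rewrite -[c i]sqr_sqrtr ?(ltW c_gt0)// -/s expr2 mulKf ?gt_eqF.
  by rewrite cabs_real real_normK ?num_real// sqr_sqrtr ?(ltW c_gt0).
- move=> v; rewrite -UE => /submxP[x ->] vi.
  rewrite qUt -scalemxAr mulmxA -(mulmxA x) UU mulmx1.
  suff -> : x *m col i U = 0 by rewrite scaler0.
  apply/matrixP => a b; rewrite !ord1 [RHS]mxE -vi !mxE.
  by apply: eq_bigr => l _; rewrite mxE.
Qed.

(** The system is triangular: the row of a pivot enters only the pairings with
    its own vector and with the previous ones. *)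
Definition staircase n (s : seq ('rV[C]_n * 'I_n)) : bool :=
  pairwise (fun a b : 'rV[C]_n * 'I_n => (b.1 0 a.2 == 0) && (b.1 *m a.1^t* == 0)) s.

(** Requiring the next vectors to vanish at the chosen pivot costs one dimension,
    and they are then orthogonal to the vector just built. *)
Lemma staircase_exists k m n (E : 'M[C]_(m, n)) (d : nat) :
  (0 < d)%N -> (k + d <= \rank E)%N ->
  exists s : seq ('rV[C]_n * 'I_n), [/\ size s = k, staircase s &
    {in s, forall a, [/\ (a.1 <= E)%MS, sqnorm (a.1 0) = 1
                       & d%:R / n%:R <= cabs (a.1 0 a.2) ^+ 2]}].
Proof.
move=> d0; elim: k m E => [|k IH] m E rE; first by exists [::].
have [q [i [qE q1 qi qv]]] := large_pivot d0 (leq_trans (leq_addl _ _) rE).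
pose B : 'M[C]_(n, 1) := delta_mx i 0.
have [|s [ss st sE]] := IH _ (E :&: kermx B)%MS.
  rewrite -ltnS -addSn; apply: leq_trans rE _.
  by rewrite -[leqLHS](mxrank_mul_ker E B) -[leqRHS]add1n leq_add2r rank_leq_col.
have vanish v : (v <= E :&: kermx B)%MS -> v 0 i = 0.
  rewrite sub_capmx => /andP[_ /sub_kermxP/matrixP/(_ 0 0)].
  rewrite !mxE (bigD1 i)//= !mxE !eqxx mulr1 big1 ?addr0// => j ji.
  by rewrite !mxE (negbTE ji) mulr0.
exists ((q, i) :: s); split; first by rewrite /= ss.
- rewrite /staircase /= -/(staircase s) st andbT; apply/allP => a /sE[aE _ _] /=.
  rewrite vanish// eqxx /=; apply/eqP/qv; last exact: vanish.
  exact: submx_trans aE (capmxSl _ _).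
- move=> a; rewrite inE => /predU1P[->//|/sE[aE a1 ai]]; split=> //.
  exact: submx_trans aE (capmxSl _ _).
Qed.

(** Subtract from y its component along the first vector and continue with the
    others, which are orthogonal to it. *)
Lemma bessel n (s : seq ('rV[C]_n * 'I_n)) (y : 'I_n -> C) :
  staircase s -> {in s, forall a : 'rV[C]_n * 'I_n, sqnorm (a.1 0) = 1} ->
  \sum_(a <- s) cabs (dotp a.1 y) ^+ 2 <= sqnorm y.
Proof.
elim: s y => [|[q i] s IH] y /=.
  by move=> _ _; rewrite big_nil; apply: sumr_ge0 => j _; rewrite sqr_ge0.
move=> /andP[/allP qs st] norm1.
pose c := dotp q y; pose y' j := y j - c * Num.conj (q 0 j).
have dot' (q' : 'rV[C]_n) : q' *m q^t* = 0 -> dotp q' y' = dotp q' y.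
  move=> /matrixP/(_ 0 0); rewrite !mxE => q'q.
  rewrite /dotp /y'; under eq_bigr do rewrite mulrBr mulrCA.
  rewrite sumrB -mulr_sumr (_ : \sum_j q' 0 j * Num.conj (q 0 j) = 0) ?mulr0 ?subr0//.
  by rewrite -[RHS]q'q; apply: eq_bigr => j _; rewrite !mxE.
have norm' : sqnorm y' = sqnorm y - cabs c ^+ 2.
  apply: complexI; rewrite rmorphB /= -mul_conj /sqnorm !rmorph_sum /=.
  have qq : \sum_j q 0 j * Num.conj (q 0 j) = 1.
    transitivity (((sqnorm (q 0))%:C)%C : C).
      by rewrite rmorph_sum; apply: eq_bigr => j _; rewrite mul_conj.
    by rewrite (norm1 (q, i)) ?mem_head.
  transitivity (\sum_j ((y j * Num.conj (y j) - Num.conj c * (q 0 j * y j))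
      - c * Num.conj (q 0 j * y j) + c * Num.conj c * (q 0 j * Num.conj (q 0 j)))).
    apply: eq_bigr => j _; rewrite -mul_conj /y' rmorphB !rmorphM /= conjCK; ring.
  rewrite big_split sumrB sumrB -!mulr_sumr qq -rmorph_sum -/(dotp q y) -/c /=.
  under eq_bigr do rewrite mul_conj; ring.
rewrite big_cons -lerBrDl -/c -norm'; apply: le_trans (IH y' st _).
  rewrite big_seq [leRHS]big_seq; apply: ler_sum => a sa; rewrite dot'//.
  by have /andP[_ /eqP] := qs a sa.
by move=> a sa; apply: norm1; rewrite inE sa orbT.
Qed.

End Orthonormal.

(** * Distance of a random combination of columns to the span of the others *)

Lemma sum_pair (V : nmodType) (I J : finType) (F : I * J -> V) :
  \sum_ij F ij = \sum_i \sum_j F (i, j).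
Proof. by rewrite pair_bigA /=; apply: eq_bigr => -[]. Qed.

Section Entries.
Variables (R : realType) (Om : finType) (val : Om -> R[i]) (n : nat).
Variables (A : 'M[R]_n) (B : 'M[R[i]]_n).
Implicit Types (x y : {ffun 'I_n * 'I_n -> Om}) (u : 'I_n -> R[i]).

Definition entry x (i j : 'I_n) : R[i] := ((A i j)%:C)%C * val (x (i, j)) + B i j.

Definition mulv (m : 'I_n -> 'I_n -> R[i]) u (i : 'I_n) : R[i] := \sum_j m i j * u j.

Lemma mulvD m u v i : mulv m (fun j => u j + v j) i = mulv m u i + mulv m v i.
Proof. by rewrite /mulv -big_split; apply: eq_bigr => j _; rewrite mulrDr. Qed.

Lemma dotp_single (q : 'rV[R[i]]_n) (z z' : 'I_n -> R[i]) (i : 'I_n) :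
  (forall i', i' != i -> z i' = z' i') ->
  dotp q z = q 0 i * z i + (dotp q z' - q 0 i * z' i).
Proof.
move=> zz'; rewrite /dotp (bigD1 i)//= [in RHS](bigD1 i)//= addrAC subrr add0r.
by congr (_ + _); apply: eq_bigr => j ji; rewrite zz'.
Qed.

End Entries.

Section Distance.
Variables (R : realType) (Om : finType) (w : finpmf R Om) (val : Om -> R[i]) (r p : R).
Hypotheses (r_gt0 : 0 < r) (p_gt0 : 0 < p) (p_le1 : p <= 1) (AC : anticonc w val r p).
Variables (n : nat) (A : 'M[R]_n) (B : 'M[R[i]]_n).
Implicit Types (x y : {ffun 'I_n * 'I_n -> Om}) (u z : 'I_n -> R[i]).
Local Notation M := (entry val A B).

(** The square sum of the coefficients with which row i of the random part enters
    the linear form given by z, apart from the atoms themselves. *)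
Definition row_mass z (i : 'I_n) : R := \sum_j (A i j * cabs (z j)) ^+ 2.

(** The square of the test coefficient q is at least c, so small_ball_l2 applies
    to the form q * (row i) at the scale sqrt c * tau. *)
Lemma row_exp_moment z (q : R[i]) (i : 'I_n) (c tau : R) (g : R[i]) :
  0 < c -> 0 < tau -> c <= cabs q ^+ 2 -> tau ^+ 2 <= row_mass z i ->
  Ex w (fun y => expR (- (cabs (q * mulv (M y) z i - g) ^+ 2 /
    ((r * p / 6) ^+ 2 * (c * tau ^+ 2))))) <= 1 - p / 48.
Proof.
move=> c0 tau0 cq tz.
pose v (ij : 'I_n * 'I_n) : R[i] :=
  if ij.1 == i then q * (((A i ij.2)%:C)%C * z ij.2) else 0.
pose g' : R[i] := g - q * \sum_j B i j * z j.
have linear y : q * mulv (M y) z i - g = \sum_ij v ij * val (y ij) - g'.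
  rewrite /g' opprB addrA; congr (_ - _).
  rewrite sum_pair /=.
  rewrite (bigD1 i)//= [X in _ + X + _]big1 ?addr0; last first.
    by move=> i' ii'; apply: big1 => j _; rewrite /v /= (negbTE ii') mul0r.
  rewrite /mulv /v /= eqxx !mulr_sumr -big_split /=.
  by apply: eq_bigr => j _; rewrite /entry; ring.
pose t := Num.sqrt c * tau.
have t0 : 0 < t by rewrite mulr_gt0// sqrtr_gt0.
have t2 : t ^+ 2 = c * tau ^+ 2 by rewrite exprMn sqr_sqrtr ?(ltW c0).
have vt : t ^+ 2 <= \sum_ij cabs (v ij) ^+ 2.
  rewrite sum_pair /=.
  rewrite (bigD1 i)//= [X in _ + X]big1 ?addr0; last first.
    move=> i' ii'; apply: big1 => j _; rewrite /v /= (negbTE ii').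
    by rewrite cabs0 expr0n.
  have -> : \sum_j cabs (v (i, j)) ^+ 2 = cabs q ^+ 2 * row_mass z i.
    rewrite /row_mass mulr_sumr; apply: eq_bigr => j _; rewrite /v /= eqxx.
    by rewrite !cabsM cabs_real !exprMn real_normK ?num_real.
  by rewrite t2; apply: ler_pM => //; rewrite ?(ltW c0)// sqr_ge0.
have ball := small_ball_l2 r_gt0 p_gt0 p_le1 AC g' t0 vt.
rewrite -t2 -exprMn; set rho := r * p / 6 * t in ball *.
have rho0 : 0 < rho by rewrite mulr_gt0// divr_gt0// mulr_gt0.
apply: (@le_trans _ _ (2^-1 + 2^-1 *
    pr w (fun y => cabs (\sum_ij v ij * val (y ij) - g') <= rho))); last by lra.
rewrite /pr -ExZ -[X in _ <= X + _](@Ex_cst _ ('I_n * 'I_n)%type _ w) -ExD.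
apply: Ex_le => y; rewrite linear; case: asboolP => [_|/negP].
  rewrite mulr1 (_ : 2^-1 + 2^-1 = expR 0 :> R); last by rewrite expR0; lra.
  by rewrite ler_expR oppr_le0 divr_ge0 ?sqr_ge0.
rewrite -ltNge mulr0 addr0 => big.
apply: (@le_trans _ _ (expR (- 1))).
  rewrite ler_expR lerN2 ler_pdivlMr ?exprn_gt0// mul1r.
  by rewrite ler_sqr ?nnegrE ?cabs_ge0 ?(ltW rho0)// ltW.
rewrite expRN lef_pV2 ?posrE ?expR_gt0//.
by apply: le_trans (expR_ge1Dx _); lra.
Qed.

(** The rows of the matrix are independent and the staircase is triangular, so
    the coordinates can be integrated one pivot row at a time. *)
Lemma staircase_exp_moment (s : seq ('rV[R[i]]_n * 'I_n)) z (c tau : R) :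
  0 < c -> 0 < tau -> staircase s ->
  {in s, forall a : 'rV[R[i]]_n * 'I_n, c <= cabs (a.1 0 a.2) ^+ 2 /\ tau ^+ 2 <= row_mass z a.2} ->
  Ex w (fun y => expR (- ((\sum_(a <- s) cabs (dotp a.1 (mulv (M y) z)) ^+ 2) /
    ((r * p / 6) ^+ 2 * (c * tau ^+ 2))))) <= (1 - p / 48) ^+ size s.
Proof.
move=> c0 tau0; set k := _ * (c * _).
elim: s => [|[q i] s IH] /=.
  by move=> _ _; under eq_Ex do rewrite big_nil mul0r oppr0 expR0; rewrite Ex_cst.
move=> /andP[/allP qs st] sc.
have [ci zi] := sc _ (mem_head _ _).
have {}IH := IH st (fun a sa => sc a (@mem_behead _ ((q, i) :: s) a sa)).
pose S (ij : 'I_n * 'I_n) := ij.1 == i.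
have other x y i' : i' != i -> mulv (M (merge S x y)) z i' = mulv (M x) z i'.
  by move=> ii'; apply: eq_bigr => j _; rewrite /entry ffunE /S /= (negbTE ii').
have same x y : mulv (M (merge S x y)) z i = mulv (M y) z i.
  by apply: eq_bigr => j _; rewrite /entry ffunE /S /= eqxx.
rewrite (Ex_merge w S).
pose F x := expR (- ((\sum_(a <- s) cabs (dotp a.1 (mulv (M x) z)) ^+ 2) / k)).
apply: (@le_trans _ _ (Ex w (fun x => (1 - p / 48) * F x))); last first.
  by rewrite ExZ exprS ler_wpM2l//; have := p_le1; lra.
apply: Ex_le => x; rewrite mulrC.
have := @row_exp_moment z (q 0 i) i c tau
  (q 0 i * mulv (M x) z i - dotp q (mulv (M x) z)) c0 tau0 ci zi.
move=> /(ler_wpM2l (expR_ge0 (- ((\sum_(a <- s) cabs (dotp a.1 (mulv (M x) z)) ^+ 2) / k)))).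
apply: le_trans; rewrite -ExZ; apply: Ex_le => y.
rewrite big_cons /= -expRD mulrDl opprD addrC ler_expR.
rewrite (dotp_single q (other x y)) same.
rewrite [in leRHS]opprB le_eqVlt; apply/orP; left; apply/eqP; congr (- _ - _).
  congr (_ / _); apply: eq_big_seq => a sa; congr (cabs _ ^+ 2).
  have /andP[/eqP ai _] := qs a sa.
  by rewrite (dotp_single a.1 (other x y)) ai !mul0r add0r subr0.
Qed.

(** Markov's inequality for the exponential of minus the sum. *)
Lemma staircase_small (s : seq ('rV[R[i]]_n * 'I_n)) z (c tau : R) :
  0 < c -> 0 < tau -> staircase s ->
  {in s, forall a : 'rV[R[i]]_n * 'I_n, c <= cabs (a.1 0 a.2) ^+ 2 /\ tau ^+ 2 <= row_mass z a.2} ->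
  pr w (fun y => \sum_(a <- s) cabs (dotp a.1 (mulv (M y) z)) ^+ 2 <=
    (r * p / 6) ^+ 2 * (c * tau ^+ 2) * (p * (size s)%:R / 96)) <=
  expR (- (p * (size s)%:R / 96)).
Proof.
move=> c0 tau0 st sc; have := staircase_exp_moment c0 tau0 st sc.
set k := _ * (c * _) => H; set m := (size s)%:R.
have k0 : 0 < k.
  by rewrite /k mulr_gt0 ?exprn_gt0 ?mulr_gt0 ?exprn_gt0 ?divr_gt0 ?mulr_gt0.
have e0 : 0 < expR (- (p * m / 96)) :> R by apply: expR_gt0.
rewrite -(ler_pM2l e0); apply: le_trans (le_trans H _).
  apply: markov_fin => [y|y small]; first exact: expR_ge0.
  by rewrite ler_expR lerN2 ler_pdivrMr// mulrC.
rewrite -expRD; apply: (@le_trans _ _ (expR (- (p / 48)) ^+ size s)).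
  apply: lerXn2r; rewrite ?nnegrE ?expR_ge0//; first by have := p_le1; lra.
  by apply: le_trans (expR_ge1Dx _); lra.
by rewrite -expRM_natl ler_expR -/m; lra.
Qed.

(** Columns in D are tested against the span of the columns in J outside D: the
    latter are fixed, and the orthogonal complement of their span contains a
    long staircase. *)
Lemma distance_to_span (N J D : pred 'I_n) z (tau : R) (k d : nat) :
  (0 < d)%N -> 0 < tau -> (forall j, ~~ D j -> z j = 0) ->
  (forall i, N i -> tau ^+ 2 <= row_mass z i) ->
  (k + d + #|[pred j | J j && ~~ D j]| <= #|N|)%N ->
  pr w (fun x => exists h : 'I_n -> R[i],
    (forall j, ~~ (J j && ~~ D j) -> h j = 0) /\
    \sum_(i | N i) cabs (mulv (M x) (fun j => z j + h j) i) ^+ 2 <=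
    (r * p / 6) ^+ 2 * (d%:R / n%:R * tau ^+ 2) * (p * k%:R / 96)) <=
  expR (- (p * k%:R / 96)).
Proof.
move=> d0 tau0 zD Nz; set J' := [pred j | _] => card.
rewrite (pr_merge w (fun ij : 'I_n * 'I_n => D ij.2)).
rewrite -[leRHS](@Ex_cst _ ('I_n * 'I_n)%type _ w); apply: Ex_le => x.
(* The left kernel of G consists of the vectors supported in N that are
   orthogonal to the columns of J'. *)
pose G : 'M[R[i]]_(n, #|J'| + #|[predC N]|) :=
  row_mx (\matrix_(i, l) M x i (enum_val l)) (\matrix_(i, l) (i == enum_val l)%:R).
have rE : (k + d <= \rank (kermx G))%N.
  have cN : (#|N| + #|[predC N]|)%N = n by rewrite cardC card_ord.
  rewrite mxrank_ker; apply: leq_trans (leq_sub2l n (rank_leq_col G)).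
  by move: card cN; lia.
have [s [sk st sE]] := staircase_exists d0 rE.
have kerG (q : 'rV[R[i]]_n) : (q <= kermx G)%MS ->
    (forall j, J' j -> \sum_i q 0 i * M x i j = 0) /\ (forall i, ~~ N i -> q 0 i = 0).
  move=> /sub_kermxP; rewrite mul_mx_row => /eqP; rewrite -row_mx0 => /eqP.
  move=> /eq_row_mx[/matrixP q1 /matrixP q2]; split=> [j Jj|i Ni].
    have := q1 0 (enum_rank_in Jj j); rewrite !mxE => q1j.
    by rewrite -[RHS]q1j; apply: eq_bigr => i _; rewrite !mxE enum_rankK_in.
  have Ni' : i \in [predC N] by rewrite inE; exact: Ni.
  have := q2 0 (enum_rank_in Ni' i); rewrite !mxE => q2i; rewrite -[RHS]q2i.
  rewrite (bigD1 i)//= !mxE enum_rankK_in// eqxx mulr1 big1 ?addr0// => i' ii'.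
  by rewrite !mxE enum_rankK_in// (negbTE ii') mulr0.
have n0 : (0 < n)%N by have := rank_leq_col (kermx G); lia.
have c0 : 0 < d%:R / n%:R :> R by rewrite divr_gt0 ?ltr0n.
have sc : {in s, forall a : 'rV[R[i]]_n * 'I_n,
    d%:R / n%:R <= cabs (a.1 0 a.2) ^+ 2 /\ tau ^+ 2 <= row_mass z a.2}.
  move=> a /sE[aE _ ai]; split=> //; apply: Nz; apply/negPn/negP => /(kerG _ aE).2 q0.
  by move: ai; rewrite q0 cabs0 expr0n leNgt c0.
have := staircase_small c0 tau0 st sc; rewrite sk; apply: le_trans.
apply: pr_le => y [h [hJ' small]].
set x' := merge _ x y in small.
pose Y i := if N i then mulv (M x') (fun j => z j + h j) i else 0.
apply: le_trans (_ : sqnorm Y <= _); last first.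
  rewrite /sqnorm (bigID N) /= [X in _ + X]big1 ?addr0.
    by apply: le_trans small; apply: ler_sum => i Ni; rewrite /Y Ni.
  by move=> i /negbTE Ni; rewrite /Y Ni cabs0 expr0n.
apply: le_trans (bessel Y st _); last by move=> a /sE[].
rewrite big_seq [leRHS]big_seq; apply: ler_sum => a sa.
have [aE _ _] := sE a sa; have [qJ qN] := kerG _ aE.
suff -> : dotp a.1 Y = dotp a.1 (mulv (M y) z) by [].
transitivity (dotp a.1 (mulv (M x') (fun j => z j + h j))).
  apply: eq_bigr => i _; rewrite /Y; case: ifPn => // Ni.
  by rewrite qN// !mul0r.
rewrite /dotp; under eq_bigr do rewrite mulvD mulrDr.
rewrite big_split /= [X in _ + X](_ : _ = 0) ?addr0.
  apply: eq_bigr => i _; congr (_ * _); apply: eq_bigr => j _.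
  have [Dj|/zD->] := boolP (D j); last by rewrite !mulr0.
  by rewrite /entry ffunE /= Dj.
under eq_bigr do rewrite mulr_sumr.
rewrite exchange_big big1 // => j _.
have [J'j|/hJ' hj] := boolP (J' j); last by rewrite big1// => i _; rewrite hj !mulr0.
under eq_bigr do rewrite mulrA.
rewrite -mulr_suml; apply/eqP; rewrite mulf_eq0; apply/orP; left; apply/eqP.
rewrite -[RHS](qJ j J'j); apply: eq_bigr => i _.
by move: J'j => /andP[_ /negbTE Dj]; rewrite /entry ffunE /= Dj.
Qed.

End Distance.

(** * Nets *)

Section EuclideanNet.
Variable R : realType.

(** An upper bound, per real coordinate, for the number of points of a net of
    radius the square root of mu2; what matters is its polynomial growth. *)
Definition net_base (mu2 : R) : R := 2 * expR 1 * (1 + mu2^-1).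

Lemma geometric_bound (lam : R) (K : nat) : 0 < lam ->
  \sum_(k < K) expR (- lam * k%:R) <= 1 + lam^-1.
Proof.
move=> lam0; pose q := expR (- lam).
have q1 : q * (1 + lam) <= 1.
  by rewrite /q expRN mulrC ler_pdivrMr ?expR_gt0// mul1r expR_ge1Dx.
have q0 : 0 < q by apply: expR_gt0.
have -> : \sum_(k < K) expR (- lam * k%:R) = \sum_(k < K) q ^+ k.
  by apply: eq_bigr => k _; rewrite mulrC expRM_natl.
have lt1 : q < 1 by nra.
have := subrX1 q K; rewrite -[X in _ = X * _]opprB mulNr -[X in X = _]opprB => /oppr_inj H.
rewrite -(ler_pM2l (_ : 0 < 1 - q)) ?subr_gt0// -H.
apply: (@le_trans _ _ 1); first by rewrite gerBl exprn_ge0// ltW.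
have -> : (1 - q) * (1 + lam^-1) = ((1 + lam) - q * (1 + lam)) / lam.
  by field; rewrite gt_eqF.
by rewrite ler_pdivlMr// mul1r; lra.
Qed.

(** Points are rounded towards 0 to a lattice of mesh mu / sqrt (m + 1), and
    the lattice points in the ball are counted by an exponential weight in their
    integer coordinates. *)
Lemma euclidean_net (J : finType) (D : pred J) (mu2 : R) : 0 < mu2 ->
  exists T : finType, exists net : T -> J -> R,
    [/\ (#|T|%:R <= net_base mu2 ^+ #|D|.+1)%R,
        forall t j, ~~ D j -> net t j = 0
      & forall y : J -> R, (forall j, ~~ D j -> y j = 0) ->
          \sum_j y j ^+ 2 <= 1 ->
          exists t, \sum_j (y j - net t j) ^+ 2 <= mu2].
Proof.
move=> mu0; set m := #|D|.
pose g := Num.sqrt (mu2 / m.+1%:R).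
have g0 : 0 < g by rewrite sqrtr_gt0 divr_gt0.
have g2 : g ^+ 2 = mu2 / m.+1%:R by rewrite sqr_sqrtr// ltW// divr_gt0.
pose K := (Num.truncn g^-1).+1.
pose code := {ffun J -> bool * 'I_K}.
pose k0 : bool * 'I_K := (true, ord0).
pose adm (f : code) := [forall j, ~~ D j ==> (f j == k0)] &&
  (\sum_j ((f j).2%:R : R) ^+ 2 <= m.+1%:R / mu2).
pose pt (f : code) j : R := (signed (f j).1 (f j).2%:R) * g.
exists {f : code | adm f}, (fun t => pt (val t)); split.
- rewrite card_sig.
  (* On admissible codes the sum of the coordinates is at most that of their
   squares, so their weights are at least exp (- (m + 1)); outside D the weight
   keeps only the code of 0. *)
pose wgt (v : bool * 'I_K) : R := expR (- mu2 * v.2%:R).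
  have wgt0 v : 0 <= wgt v by apply: expR_ge0.
  have -> : #|[pred f | adm f]|%:R = \sum_(f | adm f) (1 : R).
    by rewrite sumr_const.
  pose F j v : R := if D j then wgt v else (v == k0)%:R.
  apply: (@le_trans _ _ (expR m.+1%:R * \sum_(f : code) \prod_j F j (f j))).
    rewrite mulr_sumr big_mkcond; apply: ler_sum => f _.
    have F0 : 0 <= \prod_j F j (f j).
      by apply: prodr_ge0 => j _; rewrite /F; case: ifP => // _; apply: ler0n.
    case: ifP => [/andP[/forallP fD fs]|_]; last by rewrite mulr_ge0// expR_ge0.
    have -> : \prod_j F j (f j) = \prod_j expR (- mu2 * (f j).2%:R).
      apply: eq_bigr => j _; rewrite /F; case: ifPn => // /(implyP (fD j))/eqP ->.
      by rewrite eqxx mulr0 expR0.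
    rewrite -expR_sum -expRD -mulr_sumr mulNr.
    apply: le_trans (expR_ge1Dx _); rewrite lerDl subr_ge0.
    rewrite mulrC -ler_pdivlMr//; apply: le_trans fs; apply: ler_sum => j _.
    by rewrite -natrX ler_nat; case: (nat_of_ord _) => // k; rewrite leq_pmulr.
  have -> : \sum_(f : code) \prod_j F j (f j) = \prod_j \sum_v F j v.
    by rewrite bigA_distr_bigA.
  apply: (@le_trans _ _ (expR m.+1%:R * (2 * (1 + mu2^-1)) ^+ m)).
    rewrite ler_wpM2l ?expR_ge0//.
    have -> : (2 * (1 + mu2^-1)) ^+ m = \prod_j (if D j then 2 * (1 + mu2^-1) else 1).
      by rewrite -big_mkcond prodr_const.
    apply: ler_prod => j _; apply/andP; split.
      by apply: sumr_ge0 => v _; rewrite /F; case: ifP => // _; apply: ler0n.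
    rewrite /F; case: ifP => _; last first.
      by rewrite (bigD1 k0)// eqxx big1 => [|v /andP[_ /negbTE ->]//]; rewrite /= addr0.
    rewrite sum_pair big_bool /= mulr2n mulrDl mul1r.
    by apply: lerD; apply: geometric_bound.
  have e1 : 1 <= expR 1 :> R by apply: le_trans (expR_ge1Dx _); rewrite lerDl.
  have mu1 : 1 <= 1 + mu2^-1 by rewrite lerDl invr_ge0 ltW.
  have -> : expR m.+1%:R = expR 1 ^+ m.+1 :> R by rewrite -expRM_natl mulr1.
  rewrite /net_base [2 * expR 1]mulrC -mulrA [leRHS]exprMn ler_wpM2l ?exprn_ge0 ?expR_ge0//.
  rewrite [leRHS]exprS ler_peMl//.
    by rewrite exprn_ge0// mulr_ge0// (le_trans ler01).
  by rewrite (le_trans mu1)// ler_peMl ?ler1n// (le_trans ler01).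
- move=> [f /andP[/forallP fD _]] j Dj /=.
  by rewrite /pt (eqP (implyP (fD j) Dj)) /= mul0r.
- move=> y yD y1.
  have ysmall j : `|y j| <= 1.
    rewrite -(@expr_le1 _ 2)// real_normK ?num_real//; apply: le_trans y1.
    by rewrite (bigD1 j)//= lerDl sumr_ge0// => i _; rewrite sqr_ge0.
  have nonneg j : 0 <= `|y j| / g by rewrite divr_ge0// ltW.
  have yK j : (Num.truncn (`|y j| / g) < K)%N.
    by rewrite ltnS; apply: le_truncn; rewrite ler_pdivrMr// mulVf ?gt_eqF.
  pose f : code := [ffun j => (0 <= y j, Ordinal (yK j))].
  have fadm : adm f.
    apply/andP; split.
      apply/forallP => j; apply/implyP => Dj; rewrite ffunE; apply/eqP.
      rewrite /k0; congr pair; first by rewrite yD// lexx.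
      by apply: val_inj; rewrite /= yD// normr0 mul0r truncn0.
    rewrite -[leRHS]mulr1 (_ : m.+1%:R / mu2 = (g ^+ 2)^-1); last by rewrite g2 invf_div.
    apply: le_trans (ler_wpM2l _ y1); last by rewrite invr_ge0 sqr_ge0.
    rewrite mulr_sumr; apply: ler_sum => j _; rewrite ffunE /=.
    rewrite -[y j ^+ 2]real_normK ?num_real// -exprVn -exprMn [_^-1 * _]mulrC.
    by rewrite lerXn2r ?nnegrE ?ler0n// truncn_le nonneg.
  exists (exist _ f fadm) => /=.
  apply: (@le_trans _ _ (\sum_(j | D j) g ^+ 2)); last first.
    rewrite sumr_const -[_ *+ _]mulr_natl -/m g2 mulrCA ler_piMr ?(ltW mu0)//.
    by rewrite ler_pdivrMr ?ltr0n// mul1r ler_nat.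
  rewrite [leRHS]big_mkcond; apply: ler_sum => j _.
  case: ifPn => Dj; last first.
    rewrite yD// /pt ffunE /= yD// normr0 mul0r truncn0 lexx /= mul0r subr0.
    by rewrite expr0n.
  rewrite /pt ffunE /=; set k := Num.truncn _.
  have /andP[k1 k2] : k%:R <= `|y j| / g < k.+1%:R := truncn_itv (nonneg j).
  have -> : y j - signed (0 <= y j) k%:R * g = signed (0 <= y j) (`|y j| - k%:R * g).
    rewrite /signed; case: (ger0P (y j)) => // _; ring.
  have -> : signed (0 <= y j) (`|y j| - k%:R * g) ^+ 2 = (`|y j| - k%:R * g) ^+ 2.
    by rewrite /signed; case: ifP => // _; rewrite sqrrN.
  move: k1 k2; rewrite ler_pdivlMr// ltr_pdivrMr// -natr1 => k1 k2.
  by rewrite lerXn2r ?nnegrE ?(ltW g0)//; lra.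
Qed.

(** A complex vector is a real vector with twice as many coordinates. *)
Lemma complex_net (n : nat) (D : pred 'I_n) (mu2 : R) : 0 < mu2 ->
  exists T : finType, exists net : T -> 'I_n -> R[i],
    [/\ (#|T|%:R <= net_base mu2 ^+ (2 * #|D|).+1)%R,
        forall t j, ~~ D j -> net t j = 0
      & forall z : 'I_n -> R[i], (forall j, ~~ D j -> z j = 0) -> sqnorm z <= 1 ->
          exists t, sqnorm (fun j => z j - net t j) <= mu2].
Proof.
move=> mu0.
have [T [net [cT netD netP]]] := @euclidean_net ('I_n * bool)%type (fun jb => D jb.1) mu2 mu0.
exists T, (fun t j => (net t (j, true) +i* net t (j, false))%C); split.
- suff <- : #|fun jb : 'I_n * bool => D jb.1| = (2 * #|D|)%N by [].
  rewrite mulnC -[X in (_ * X)%N]card_bool -cardX; apply: eq_card => -[j b].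
  by rewrite !inE andbT.
- by move=> t j Dj; rewrite !netD.
- move=> z zD z1.
  have [||t ht] := netP (fun jb => if jb.2 then complex.Re (z jb.1) else complex.Im (z jb.1)).
  + by move=> [j b] /= /zD ->; case: b.
  + rewrite sum_pair; apply: le_trans z1; apply: ler_sum => j _.
    by rewrite big_bool /= cabs2E.
  exists t; apply: le_trans ht; rewrite sum_pair; apply: ler_sum => j _.
  rewrite big_bool /= cabs2E; by case: (z j).
Qed.

End EuclideanNet.

(** * Approximate kernel vectors with mass in many blocks *)

Section NearKernel.
Variables (R : realType) (Om : finType) (w : finpmf R Om) (val : Om -> R[i]) (r p : R).
Hypotheses (r_gt0 : 0 < r) (p_gt0 : 0 < p) (p_le1 : p <= 1) (AC : anticonc w val r p).
Variables (n : nat) (A : 'M[R]_n) (B : 'M[R[i]]_n).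
Hypothesis A01 : forall i j, 0 <= A i j <= 1.
Implicit Types (x y : {ffun 'I_n * 'I_n -> Om}) (u z : 'I_n -> R[i]).
Local Notation M := (entry val A B).

Definition opbound (m : 'I_n -> 'I_n -> R[i]) (k2 : R) : Prop :=
  forall u, sqnorm (mulv m u) <= k2 * sqnorm u.

Lemma sqnorm_ge0 u : 0 <= sqnorm u.
Proof. by apply: sumr_ge0 => j _; rewrite sqr_ge0. Qed.

Lemma cabs2D_le (a b : R[i]) : cabs (a + b) ^+ 2 <= 2 * cabs a ^+ 2 + 2 * cabs b ^+ 2.
Proof. by have := cabs_parallelogram a b; have := sqr_ge0 (cabs (a - b)); lra. Qed.

Lemma row_mass_le z i : row_mass A z i <= sqnorm z.
Proof.
apply: ler_sum => j _; have /andP[A0 A1] := A01 i j.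
by rewrite exprMn ler_piMl ?sqr_ge0// expr_le1.
Qed.

Lemma row_mass_approx z z' i :
  row_mass A z i <= 2 * row_mass A z' i + 2 * sqnorm (fun j => z j - z' j).
Proof.
apply: (@le_trans _ _ (2 * row_mass A z' i + 2 * row_mass A (fun j => z j - z' j) i)).
  rewrite /row_mass !mulr_sumr -big_split; apply: ler_sum => j _ /=.
  have := cabs2D_le (z' j) (z j - z' j); rewrite [z' j + _]addrC subrK.
  move=> /(ler_wpM2l (sqr_ge0 (A i j))); rewrite !exprMn.
  by move=> /le_trans; apply; rewrite le_eqVlt; apply/orP; left; apply/eqP; ring.
by rewrite lerD2l ler_pM2l// row_mass_le.
Qed.

(** The threshold in distance_to_span, for rows of mass tau2. *)
Definition small_ratio (k d : nat) (tau2 : R) : R :=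
  (r * p / 6) ^+ 2 * (d%:R / n%:R * tau2) * (p * k%:R / 96).

(** The part of u on the few columns of D is replaced by a point of a net. *)
Lemma near_kernel_on_piece (N J D : pred 'I_n) (tau K2 mu2 : R) (k d : nat) :
  (0 < d)%N -> 0 < tau -> 0 < mu2 -> mu2 <= tau ^+ 2 ->
  0 <= K2 -> 4 * K2 * mu2 <= small_ratio k d (tau ^+ 2) ->
  (k + d + #|[pred j | J j && ~~ D j]| <= #|N|)%N ->
  pr w (fun x => opbound (M x) K2 /\ exists u : 'I_n -> R[i],
    [/\ forall j, ~~ J j -> u j = 0, sqnorm u <= 1,
        forall i, N i -> 4 * tau ^+ 2 <= row_mass A (fun j => if D j then u j else 0) i
      & \sum_(i | N i) cabs (mulv (M x) u i) ^+ 2 <= small_ratio k d (tau ^+ 2) / 4])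
  <= net_base mu2 ^+ (2 * #|D|).+1 * expR (- (p * k%:R / 96)).
Proof.
move=> d0 tau0 mu0 mutau K0 Kmu card.
have [T [net [cT netD netP]]] := complex_net D mu0.
(* Only the net points that every row of N sees are useful: those close to a u
   seen by the rows are among them. *)
pose P t := [forall i, N i ==> (tau ^+ 2 <= row_mass A (net t) i)].
apply: (@le_trans _ _ (\sum_(t | P t) pr w (fun x => exists h : 'I_n -> R[i],
    (forall j, ~~ (J j && ~~ D j) -> h j = 0) /\
    \sum_(i | N i) cabs (mulv (M x) (fun j => net t j + h j) i) ^+ 2 <=
    small_ratio k d (tau ^+ 2)))); last first.
  apply: (@le_trans _ _ (\sum_(t : T) expR (- (p * k%:R / 96)))).
    rewrite big_mkcond; apply: ler_sum => t _.
    case: ifPn => [Pt|_]; last exact: expR_ge0.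
    apply: (distance_to_span r_gt0 p_gt0 p_le1 AC) => //; first exact: netD.
    by move=> i Ni; have /forallP/(_ i)/implyP/(_ Ni) := Pt.
  by rewrite sumr_const -[_ *+ _]mulr_natl ler_wpM2r ?expR_ge0.
apply: pr_le_sum => x [opx [u [uJ u1 uN usmall]]].
pose z j := if D j then u j else 0.
have z_le : sqnorm z <= sqnorm u.
  apply: ler_sum => j _; rewrite /z; case: ifP => _ //.
  by rewrite cabs0 expr0n sqr_ge0.
have [t ht] : exists t, sqnorm (fun j => z j - net t j) <= mu2.
  apply: netP; last exact: le_trans z_le u1.
  by move=> j /negbTE Dj; rewrite /z Dj.
exists t.
  apply/forallP => i; apply/implyP => Ni.
  by have := uN i Ni; have := row_mass_approx z (net t) i; rewrite -/z; lra.
exists (fun j => if J j && ~~ D j then u j else 0); split.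
  by move=> j /negbTE ->.
pose e j := - (z j - net t j).
have decomp j : net t j + (if J j && ~~ D j then u j else 0) = u j + e j.
  rewrite /e /z; have [Dj|Dj] := boolP (D j); rewrite ?andbF ?andbT /=.
    ring.
  have -> : (if J j then u j else 0) = u j by case: ifPn => // /uJ.
  ring.
have e_small : sqnorm e <= mu2.
  by apply: le_trans ht; apply: ler_sum => j _; rewrite /e cabsN.
apply: (@le_trans _ _ (\sum_(i | N i) (2 * cabs (mulv (M x) u i) ^+ 2 +
    2 * cabs (mulv (M x) e i) ^+ 2))).
  apply: ler_sum => i _; rewrite (_ : mulv _ _ i = mulv (M x) u i + mulv (M x) e i).
    exact: cabs2D_le.
  by rewrite -mulvD; apply: eq_bigr => j _; rewrite decomp.
rewrite big_split -!mulr_sumr /=.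
have H1 : \sum_(i | N i) cabs (mulv (M x) e i) ^+ 2 <= K2 * mu2.
  apply: (@le_trans _ _ (sqnorm (mulv (M x) e))).
    by rewrite /sqnorm [leRHS](bigID N) /= lerDl sumr_ge0// => i _; rewrite sqr_ge0.
  by apply: le_trans (opx e) _; rewrite ler_wpM2l.
lra.
Qed.

Variables (L g : nat) (blk : 'I_n -> 'I_L) (pc : 'I_n -> 'I_g).

Definition block_mass u (l : 'I_L) : R := \sum_(j | blk j == l) cabs (u j) ^+ 2.

(** The vector is normalised from above only, because it arises by restricting a
    unit vector to the columns of J. *)
Definition near_kernel (m : 'I_n -> 'I_n -> R[i]) (N J : pred 'I_n) (H : pred 'I_L)
    (K2 T e : R) : Prop :=
  opbound m K2 /\ exists u : 'I_n -> R[i],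
    [/\ forall j, ~~ J j -> u j = 0, sqnorm u <= 1, forall l, H l -> T <= block_mass u l
      & \sum_(i | N i) cabs (mulv m u i) ^+ 2 <= e].

Lemma net_base_ge1 (mu2 : R) : 0 < mu2 -> 1 <= net_base mu2.
Proof.
move=> mu0; have e1 : 1 <= expR 1 :> R by apply: le_trans (expR_ge1Dx _); rewrite lerDl.
have : 1 <= 1 + mu2^-1 by rewrite lerDl invr_ge0 ltW.
rewrite /net_base; nra.
Qed.

(** By pigeonhole, each heavy block has a piece carrying a proportion 1 / g of
    its mass; D is the union of one such piece per heavy block. *)
Lemma near_kernel_on_blocks (N J : pred 'I_n) (H : pred 'I_L)
    (sigma T tau K2 mu2 : R) (k d m : nat) :
  (0 < d)%N -> 0 < tau -> 0 < mu2 -> mu2 <= tau ^+ 2 ->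
  0 <= K2 -> 4 * K2 * mu2 <= small_ratio k d (tau ^+ 2) ->
  (0 < g)%N -> 0 <= sigma -> 4 * g%:R * tau ^+ 2 <= sigma ^+ 2 * T ->
  (forall a, #|[pred j | pc j == a]| <= m)%N ->
  (forall i, N i -> exists2 l, H l & forall j, blk j = l -> sigma <= A i j) ->
  (k + d + #|J| <= #|N|)%N ->
  pr w (fun x => near_kernel (M x) N J H K2 T (small_ratio k d (tau ^+ 2) / 4))
  <= (g ^ L)%:R * (net_base mu2 ^+ (2 * (L * m)).+1 * expR (- (p * k%:R / 96))).
Proof.
move=> d0 tau0 mu0 mutau K0 Kmu g0 sigma0 tauT pcm strong card.
pose D (s : {ffun 'I_L -> 'I_g}) : pred 'I_n := fun j => pc j == s (blk j).
have cD s : (#|D s| <= L * m)%N.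
  have -> : #|D s| = (\sum_(l : 'I_L) #|[pred j | (blk j == l) && D s j]|)%N.
    rewrite -sum1_card (partition_big blk predT)//=; apply: eq_bigr => l _.
    by rewrite -sum1_card; apply: eq_bigl => j; rewrite !inE andbC.
  apply: (@leq_trans (\sum_(l < L) m)); last by rewrite sum_nat_const card_ord.
  apply: leq_sum => l _; apply: leq_trans (pcm (s l)); apply: subset_leq_card.
  by apply/fintype.subsetP => j; rewrite !inE => /andP[/eqP <-].
apply: (@le_trans _ _ (\sum_(s : {ffun 'I_L -> 'I_g}) net_base mu2 ^+ (2 * #|D s|).+1 *
    expR (- (p * k%:R / 96)))); last first.
  have -> : (g ^ L)%:R = (\sum_(s : {ffun 'I_L -> 'I_g}) 1 : R).
    by rewrite sumr_const card_ffun !card_ord.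
  rewrite mulr_suml; apply: ler_sum => s _; rewrite mul1r ler_wpM2r ?expR_ge0//.
  by rewrite ler_weXn2l ?net_base_ge1// ltnS leq_mul2l cD.
apply: (@le_trans _ _ (\sum_(s : {ffun 'I_L -> 'I_g}) pr w (fun x =>
    opbound (M x) K2 /\ exists u : 'I_n -> R[i],
    [/\ forall j, ~~ J j -> u j = 0, sqnorm u <= 1,
        forall i, N i -> 4 * tau ^+ 2 <= row_mass A (fun j => if D s j then u j else 0) i
      & \sum_(i | N i) cabs (mulv (M x) u i) ^+ 2 <= small_ratio k d (tau ^+ 2) / 4]))).
  apply: pr_le_sum => x [opx [u [uJ u1 uH us]]].
  pose pm l a := \sum_(j | (blk j == l) && (pc j == a)) cabs (u j) ^+ 2.
  have pigeon l : exists a, block_mass u l <= g%:R * pm l a.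
    apply/not_existsP => small.
    have : \sum_(a : 'I_g) (g%:R * pm l a) < \sum_(a : 'I_g) block_mass u l.
      apply: ltr_sum; last by move=> a _; rewrite ltNge; apply/negP.
      by apply/hasP; exists (Ordinal g0); rewrite ?mem_index_enum.
    rewrite -mulr_sumr sumr_const card_ord -[_ *+ g in ltRHS]mulr_natl.
    by rewrite /block_mass (partition_big pc predT)//= ltxx.
  have [s hs] := choice pigeon.
  exists [ffun l => s l] => //; split=> //; exists u; split=> // i Ni.
  have [l Hl strong_l] := strong i Ni.
  have g0' : 0 < g%:R :> R by rewrite ltr0n.
  rewrite -(ler_pM2l g0') mulrCA mulrA; apply: le_trans tauT _.
  apply: (@le_trans _ _ (sigma ^+ 2 * (g%:R * pm l (s l)))).
    by rewrite ler_wpM2l ?sqr_ge0// (le_trans (uH l Hl)).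
  rewrite mulrCA ler_pM2l// /pm mulr_sumr /row_mass big_mkcond.
  apply: ler_sum => j _; case: ifP => [/andP[/eqP bl pcl]|_]; last exact: sqr_ge0.
  rewrite /D ffunE bl pcl exprMn ler_wpM2r ?sqr_ge0// lerXn2r ?nnegrE//.
    by apply: le_trans sigma0 (strong_l j bl).
  exact: strong_l.
apply: ler_sum => s _; apply: near_kernel_on_piece => //.
apply: leq_trans card; rewrite leq_add2l; apply: subset_leq_card.
by apply/fintype.subsetP => j; rewrite !inE => /andP[].
Qed.

End NearKernel.

(** * Exponential bounds uniform in the dimension *)

Section Asymptotics.
Variable R : realType.

Lemma expR_sqrt (y : R) : 0 <= y -> y <= expR (2 * Num.sqrt y).
Proof.
move=> y0; have s0 : 0 <= Num.sqrt y by rewrite sqrtr_ge0.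
have -> : 2 * Num.sqrt y = Num.sqrt y + Num.sqrt y by ring.
rewrite expRD -{1}[y]sqr_sqrtr// expr2.
have H : Num.sqrt y <= expR (Num.sqrt y) by apply: le_trans (expR_ge1Dx _); rewrite lerDr.
exact: ler_pM.
Qed.

Lemma residue_class_card (n g : nat) (g0 : (0 < g)%N) (a : 'I_g) :
  (#|[pred j : 'I_n | Ordinal (ltn_pmod j g0) == a]| <= (n %/ g).+1)%N.
Proof.
pose f (j : 'I_n) : 'I_(n %/ g).+1 := inord (j %/ g).
have fE (j : 'I_n) : f j = (j %/ g)%N :> nat.
  by rewrite /f inordK// ltnS leq_div2r// ltnW.
rewrite -[leqRHS]card_ord -(@card_in_image _ _ f); first exact: max_card.
move=> i j; rewrite !inE -!val_eqE /= => /eqP ia /eqP ja fij.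
apply: val_inj; rewrite /= (divn_eq i g) (divn_eq j g) ia ja.
by have /(congr1 (@nat_of_ord _)) := fij; rewrite !fE => ->.
Qed.

(** The rate c1 does not depend on T, because the net can be made cheap: with g
    pieces per block it lives in dimension about 2 L n / g, and the logarithm of
    its size is of order (L n / g) * log g, with a constant depending on T;
    c1 n exceeds it once g is large. *)
Lemma near_kernel_bound (K sigma r p beta : R) (L : nat) :
  0 < K -> 0 < sigma -> 0 < r -> 0 < p -> p <= 1 -> 0 < beta -> (0 < L)%N ->
  exists2 c1 : R, 0 < c1 & forall T : R, 0 < T -> exists2 c2 : R, 0 < c2 &
  exists n0 : nat, forall (n : nat), (n0 <= n)%N ->
  forall (Om : finType) (w : finpmf R Om) (val : Om -> R[i]), anticonc w val r p ->
  forall (A : 'M[R]_n) (B : 'M[R[i]]_n), (forall i j, 0 <= A i j <= 1) ->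
  forall (blk : 'I_n -> 'I_L) (N J : pred 'I_n) (H : pred 'I_L),
  (forall i, N i -> exists2 l, H l & forall j, blk j = l -> sigma <= A i j) ->
  #|J|%:R + beta * n%:R <= #|N|%:R ->
  pr w (fun x => near_kernel blk (entry val A B x) N J H (K ^+ 2 * n%:R) T (c2 * n%:R)) <= expR (- (c1 * n%:R)).
Proof.
move=> K0 sigma0 r0 p0 p1 beta0 L0.
pose c1 : R := p * beta / 96 / 6.
have c10 : 0 < c1 by rewrite !divr_gt0 ?mulr_gt0.
have c1E : c1 = p * beta / 96 / 6 by [].
clearbody c1.
exists c1 => // T T0.
have L0' : 0 < L%:R :> R by rewrite ltr0n.
pose q0 : R := (r * p / 6) ^+ 2 * (beta / 3) * (p * beta / 96 / 3).
have rp0 : 0 < (r * p / 6) ^+ 2 by rewrite exprn_gt0// divr_gt0// mulr_gt0.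
have q00 : 0 < q0 by rewrite !mulr_gt0// ?divr_gt0 ?mulr_gt0.
pose mr : R := Num.min 1 (q0 / (4 * K ^+ 2)).
have mr0 : 0 < mr by rewrite lt_min ltr01 divr_gt0// mulr_gt0// exprn_gt0.
have mrK : 4 * K ^+ 2 * mr <= q0.
  by rewrite mulrC -ler_pdivlMr ?mulr_gt0 ?exprn_gt0// ge_min lexx orbT.
pose a : R := 2 * expR 1 * (1 + 4 / (mr * sigma ^+ 2 * T)).
have a0 : 0 < a.
  rewrite mulr_gt0 ?mulr_gt0 ?expR_gt0// addr_gt0// divr_gt0//.
  by rewrite !mulr_gt0// exprn_gt0.
pose g : nat := (Num.truncn (64 * L%:R ^+ 2 * a / c1 ^+ 2)).+1.
have g0 : (0 < g)%N by [].
have gbig : 64 * L%:R ^+ 2 * a / c1 ^+ 2 <= g%:R by rewrite ltW// truncnS_gt.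
have g1 : 1 <= g%:R :> R by rewrite ler1n.
have g0' : 0 < g%:R :> R by rewrite ltr0n.
pose tau : R := Num.sqrt (sigma ^+ 2 * T / (4 * g%:R)).
have s20 : 0 < sigma ^+ 2 by rewrite exprn_gt0.
have tau20 : 0 < sigma ^+ 2 * T / (4 * g%:R) by rewrite divr_gt0 ?mulr_gt0.
have tau0 : 0 < tau by rewrite sqrtr_gt0.
have tau2 : tau ^+ 2 = sigma ^+ 2 * T / (4 * g%:R) by rewrite sqr_sqrtr// ltW.
pose mu2 := mr * tau ^+ 2.
have mu0 : 0 < mu2 by rewrite mulr_gt0// exprn_gt0.
pose y := Num.sqrt (a * g%:R).
have ag0 : 0 <= a * g%:R by rewrite mulr_ge0// ltW.
have y0 : 0 <= y by rewrite sqrtr_ge0.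
(* Here a g bounds the size of the net per dimension; its logarithm is at most
   2 sqrt (a g), which is small compared with g. *)
have base_le : net_base mu2 <= expR (2 * y).
  apply: le_trans (expR_sqrt ag0).
  rewrite /net_base /a -[leRHS]mulrA ler_pM2l ?mulr_gt0 ?expR_gt0// /mu2 tau2.
  have -> : (mr * (sigma ^+ 2 * T / (4 * g%:R)))^-1 = 4 / (mr * sigma ^+ 2 * T) * g%:R.
    by field; rewrite !gt_eqF.
  by rewrite [leRHS]mulrDl mul1r lerD2r.
have ybound : 8 * L%:R * y <= c1 * g%:R.
  have cg0 : 0 <= c1 * g%:R by rewrite mulr_ge0 ?(ltW c10) ?(ltW g0').
  have ly0 : 0 <= 8 * L%:R * y by rewrite !mulr_ge0.
  rewrite -ler_sqr//.
  have -> : (8 * L%:R * y) ^+ 2 = 64 * L%:R ^+ 2 * a * g%:R.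
    have -> : (8 * L%:R * y) ^+ 2 = 64 * L%:R ^+ 2 * y ^+ 2 by ring.
    by rewrite sqr_sqrtr// mulrA.
  have -> : (c1 * g%:R) ^+ 2 = c1 ^+ 2 * g%:R * g%:R by ring.
  rewrite ler_pM2r//.
  by move: gbig; rewrite ler_pdivrMr ?exprn_gt0// [g%:R * _]mulrC.
exists (q0 * tau ^+ 2 / 4); first by rewrite divr_gt0 ?mulr_gt0 ?exprn_gt0.
(* The part of the exponent that does not grow with n is [rest]. *)
pose rest : R := g%:R * L%:R + 2 * y * (2 * L%:R + 1).
have rest0 : 0 <= rest.
  by rewrite addr_ge0 ?mulr_ge0// ?addr_ge0 ?mulr_ge0.
exists (maxn (Num.truncn (6 / beta)).+1 (Num.truncn (2 * rest / c1)).+1) => n.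
rewrite geq_max => /andP[n1 n2] Om w val AC A B A01 blk N J H strong card.
have nbeta : 6 <= beta * n%:R.
  rewrite mulrC -ler_pdivrMr//; apply: le_trans (ltW (truncnS_gt _)) _.
  by rewrite ler_nat.
have nrest : 2 * rest <= c1 * n%:R.
  rewrite [leRHS]mulrC -ler_pdivrMr//; apply: le_trans (ltW (truncnS_gt _)) _.
  by rewrite ler_nat.
have n0 : 0 < n%:R :> R by rewrite -(pmulr_rgt0 _ beta0); lra.
pose k := Num.truncn (beta * n%:R / 2).
have bn0 : 0 <= beta * n%:R / 2 by lra.
have /andP[k1 k2] : k%:R <= beta * n%:R / 2 < k.+1%:R := truncn_itv bn0.
rewrite -(natr1 k) in k2.
have k3 : beta * n%:R / 3 <= k%:R by lra.
have k0 : (0 < k)%N by rewrite -(ltr0n R); lra.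
have ratio : q0 * tau ^+ 2 * n%:R <= small_ratio r p n k k (tau ^+ 2).
  rewrite /small_ratio /q0.
  have -> : (r * p / 6) ^+ 2 * (beta / 3) * (p * beta / 96 / 3) * tau ^+ 2 * n%:R =
    (r * p / 6) ^+ 2 * (beta / 3 * tau ^+ 2) * (p * (beta * n%:R / 3) / 96) by field.
  have t2 : 0 <= tau ^+ 2 by apply: sqr_ge0.
  have b30 : 0 <= beta / 3 by rewrite divr_ge0 ?(ltW beta0).
  have X0 := mulr_ge0 (ltW rp0) (mulr_ge0 b30 t2).
  have bn3 : 0 <= beta * n%:R / 3 by lra.
  have Y0 : 0 <= p * (beta * n%:R / 3) / 96 := divr_ge0 (mulr_ge0 (ltW p0) bn3) (ler0n _ 96).
  apply: ler_pM X0 Y0 _ _.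
    rewrite ler_pM2l// ler_wpM2r// ler_pdivlMr//; lra.
  by rewrite ler_pM2r// ler_pM2l.
pose pc (j : 'I_n) : 'I_g := Ordinal (ltn_pmod j g0).
apply: (@le_trans _ _ (pr w (fun x => near_kernel blk (entry val A B x) N J H
    (K ^+ 2 * n%:R) T (small_ratio r p n k k (tau ^+ 2) / 4)))).
  apply: pr_le => x [opx [u [uJ u1 uH us]]]; split=> //; exists u; split=> //.
  apply: le_trans us _; rewrite mulrAC ler_pM2r//.
apply: le_trans (near_kernel_on_blocks r0 p0 p1 AC B A01 (pc := pc) (tau := tau)
  (mu2 := mu2) (sigma := sigma) k0 tau0 mu0 _ _ _ g0 (ltW sigma0) _
  (residue_class_card n g0) strong _) _.
- by rewrite ler_piMl ?sqr_ge0// ge_min lexx.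
- by rewrite mulr_ge0 ?sqr_ge0// ltW.
- apply: le_trans ratio; have t2 : 0 <= tau ^+ 2 by apply: sqr_ge0.
  rewrite /mu2; have -> : 4 * (K ^+ 2 * n%:R) * (mr * tau ^+ 2) =
    4 * K ^+ 2 * mr * (tau ^+ 2 * n%:R) by ring.
  by rewrite -[leRHS]mulrA ler_wpM2r// mulr_ge0// ltW.
- by rewrite tau2 le_eqVlt; apply/orP; left; apply/eqP; field; rewrite gt_eqF.
- rewrite -(ler_nat R) !natrD; lra.
have base1 : 1 <= net_base mu2 by apply: net_base_ge1.
have gL : (g ^ L)%:R <= expR (g%:R * L%:R) :> R.
  rewrite natrX mulrC expRM_natl lerXn2r ?nnegrE ?expR_ge0 ?(ltW g0')//.
  by apply: le_trans (expR_ge1Dx _); rewrite lerDr.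
have bL : net_base mu2 ^+ (2 * (L * (n %/ g).+1)).+1 <=
    expR (2 * y * (2 * L%:R * (n%:R / g%:R + 1) + 1)).
  apply: (@le_trans _ _ (expR (2 * y) ^+ (2 * (L * (n %/ g).+1)).+1)).
    by rewrite lerXn2r ?nnegrE ?expR_ge0// (le_trans ler01).
  rewrite -expRM_natl ler_expR mulrC ler_wpM2l ?mulr_ge0// -(natr1 (2 * _)) lerD2r.
  rewrite natrM natrM -mulrA ler_pM2l// ler_pM2l// -(natr1 (n %/ g)) lerD2r.
  by rewrite ler_pdivlMr// -natrM ler_nat leq_trunc_div.
apply: le_trans (ler_pM _ _ gL (ler_wpM2r (expR_ge0 _) bL)) _; rewrite ?ler0n//.
  by rewrite mulr_ge0 ?expR_ge0// exprn_ge0// (le_trans ler01).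
rewrite -!expRD ler_expR.
have pk : 2 * (c1 * n%:R) <= p * k%:R / 96.
  have -> : 2 * (c1 * n%:R) = p * (beta * n%:R / 3) / 96 by rewrite c1E; field.
  by rewrite ler_pM2r// ler_pM2l.
have main : 4 * L%:R * y * (n%:R / g%:R) <= c1 * n%:R / 2.
  rewrite mulrA ler_pdivrMr//.
  have := ler_wpM2r (ltW n0) ybound; lra.
have -> : g%:R * L%:R + (2 * y * (2 * L%:R * (n%:R / g%:R + 1) + 1) + - (p * k%:R / 96)) =
  rest + 4 * L%:R * y * (n%:R / g%:R) - p * k%:R / 96 by rewrite /rest; ring.
lra.
Qed.

End Asymptotics.

(** * Approximate kernel vectors are spread in every block *)

Section Structure.
Variable R : realType.

(** A path of large blocks, in which equal or consecutive ones interact with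
    standard deviations bounded from below. *)
Definition profile (n L : nat) (A : 'M[R]_n) (blk : 'I_n -> 'I_L) (sigma beta : R) : Prop :=
  [/\ forall i j, 0 <= A i j <= 1,
      forall l, beta * n%:R <= #|[pred j | blk j == l]|%:R
    & forall i j, (blk i <= (blk j).+1)%N -> (blk j <= (blk i).+1)%N -> sigma <= A i j].

Definition spread_in_block (n L : nat) (blk : 'I_n -> 'I_L) (u : 'I_n -> R[i])
    (rho theta : R) (l : 'I_L) : Prop :=
  theta * n%:R <= #|[pred j | (blk j == l) && (rho <= n%:R * cabs (u j) ^+ 2)]|%:R.

Lemma restrict_small (n : nat) (m : 'I_n -> 'I_n -> R[i]) (k2 : R) (N J : pred 'I_n)
    (u : 'I_n -> R[i]) : opbound m k2 ->
  \sum_(i | N i) cabs (mulv m (fun j => if J j then u j else 0) i) ^+ 2 <=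
  2 * \sum_(i | N i) cabs (mulv m u i) ^+ 2 + 2 * (k2 * \sum_(j | ~~ J j) cabs (u j) ^+ 2).
Proof.
move=> opm; pose v j : R[i] := if J j then 0 else - u j.
have -> : \sum_(j | ~~ J j) cabs (u j) ^+ 2 = sqnorm v.
  rewrite /sqnorm big_mkcond; apply: eq_bigr => j _; rewrite /v.
  by case: (J j); [rewrite cabs0 expr0n|rewrite cabsN].
apply: (@le_trans _ _ (\sum_(i | N i) (2 * cabs (mulv m u i) ^+ 2 +
    2 * cabs (mulv m v i) ^+ 2))).
  apply: ler_sum => i _.
  rewrite (_ : mulv m (fun j => if J j then u j else 0) i = mulv m u i + mulv m v i).
    exact: cabs2D_le.
  rewrite -mulvD; apply: eq_bigr => j _; rewrite /v.
  by case: (J j); rewrite ?addr0 ?subrr.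
rewrite big_split -!mulr_sumr lerD2l ler_pM2l//; apply: le_trans (opm v).
by rewrite /sqnorm [leRHS](bigID N) /= lerDl sumr_ge0// => i _; rewrite sqr_ge0.
Qed.

Lemma positive_lower_bound (f : nat -> R) (L : nat) : (forall t, 0 < f t) ->
  exists2 c, 0 < c & forall t, (t <= L)%N -> c <= f t.
Proof.
move=> f0; elim: L => [|L [c c0 cf]].
  by exists (f 0) => // t; rewrite leqn0 => /eqP ->.
exists (Num.min c (f L.+1)); first by rewrite lt_min c0 f0.
move=> t; rewrite leq_eqVlt => /predU1P[->|/cf ct]; first by rewrite ge_min lexx orbT.
by rewrite ge_min ct.
Qed.

Lemma nat_upper_bound (f : nat -> nat) (L : nat) :
  exists c, forall t, (t <= L)%N -> (f t <= c)%N.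
Proof.
elim: L => [|L [c cf]]; first by exists (f 0) => t; rewrite leqn0 => /eqP ->.
exists (maxn c (f L.+1)) => t; rewrite leq_eqVlt => /predU1P[->|/cf ct].
  exact: leq_maxr.
exact: leq_trans ct (leq_maxl _ _).
Qed.

(** A proper nonempty set of blocks has a boundary. *)
Lemma adjacent_block (L : nat) (h : pred 'I_L) (a b : 'I_L) : h a -> ~~ h b ->
  exists l l' : 'I_L, [/\ h l, ~~ h l', (l <= l'.+1)%N & (l' <= l.+1)%N].
Proof.
move=> ha hb; apply/not_existsP => no.
have closed (l l' : 'I_L) : h l -> (l <= l'.+1)%N -> (l' <= l.+1)%N -> h l'.
  by move=> hl ll' l'l; apply/negPn/negP => hl'; apply: (no l); exists l'.
have up k (l : 'I_L) : (a + k)%N = l -> h l.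
  elim: k l => [|k IH] l akl.
    by rewrite (_ : l = a)//; apply: val_inj; rewrite /= -akl addn0.
  have kL : (a + k < L)%N by have := ltn_ord l; lia.
  by apply: (closed (Ordinal kL)); [exact: IH|rewrite /=; lia|rewrite /=; lia].
have down k (l : 'I_L) : (l + k)%N = a -> h l.
  elim: k l => [|k IH] l akl.
    by rewrite (_ : l = a)//; apply: val_inj; rewrite /= -akl addn0.
  have kL : (l.+1 < L)%N by have := ltn_ord a; lia.
  by apply: (closed (Ordinal kL)); [apply: IH => /=; lia|rewrite /=; lia|rewrite /=; lia].
move/negP: hb; apply; have [ab|ba] := leqP a b.
  by apply: (up (b - a)%N); lia.
by apply: (down (a - b)%N); lia.
Qed.

Lemma other_neighbour (L : nat) (l b : 'I_L) : (1 < L)%N ->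
  exists l' : 'I_L, [/\ l' != l, (l' <= b.+1)%N & (b <= l'.+1)%N].
Proof.
move=> L1; have [->|bl] := eqVneq b l; last by exists b.
have [l0|l0] := posnP l.
  by exists (Ordinal L1); rewrite -val_eqE /= l0.
have lL : (l.-1 < L)%N by apply: leq_ltn_trans (leq_pred l) (ltn_ord l).
by exists (Ordinal lL); rewrite -val_eqE /=; split; lia.
Qed.

(** Increasing sets of blocks stabilise before they have strictly grown L times. *)
Lemma stable_level (L : nat) (h : nat -> pred 'I_L) :
  (forall t l, h t l -> h t.+1 l) -> (exists l, h 0%N l) ->
  (exists t, [/\ (t < L)%N, exists l, ~~ h t l & h t =1 h t.+1]) \/ (forall l, h L l).
Proof.
move=> mono [l0 hl0]; apply: contrapT => /not_orP[nostable notfull].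
have grow t : (t <= L)%N -> (t < #|h t|)%N \/ (forall l, h t l).
  elim: t => [_|t IH tL].
    by left; apply/card_gt0P; exists l0.
  have [card|full] := IH (ltnW tL); last by right=> l; apply: mono.
  have [full|nf] := pselect (forall l, h t l); first by right=> l; apply: mono.
  left; apply: leq_ltn_trans card _; apply: proper_card.
  apply/fintype.properP; split; first by apply/fintype.subsetP => l; apply: mono.
  apply: contrapT => no; apply: nostable; exists t; split=> //.
    by have /existsNP[l hl] := nf; exists l; apply/negP.
  move=> l; apply/idP/idP; first exact: mono.
  by move=> hl; apply/negPn/negP => hl'; apply: no; exists l.
have [card|//] := grow L (leqnn L).
by have := max_card (h L); rewrite card_ord leqNgt card.
Qed.

(** Subsets with few elements are counted by exponential weights. *)
Lemma few_small_subsets (n : nat) (lam theta : R) : 0 <= lam ->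
  #|[pred f : {ffun 'I_n -> bool} | #|[pred j | f j]|%:R < theta * n%:R]|%:R <=
  expR ((lam * theta + expR (- lam)) * n%:R) :> R.
Proof.
move=> lam0; rewrite -sum1_card natr_sum.
pose F (b : bool) : R := if b then expR (- lam) else 1.
have F0 b : 0 <= F b by rewrite /F; case: b; rewrite ?expR_ge0 ?ler01.
apply: (@le_trans _ _ (expR (lam * theta * n%:R) *
    \sum_(f : {ffun 'I_n -> bool}) \prod_j F (f j))).
  rewrite mulr_sumr big_mkcond; apply: ler_sum => f _; rewrite inE.
  case: ifPn => [small|_]; last by rewrite mulr_ge0 ?expR_ge0// prodr_ge0.
  have -> : \prod_j F (f j) = expR (- lam * #|[pred j | f j]|%:R).
    rewrite mulrC expRM_natl -prodr_const [RHS]big_mkcond.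
    by apply: eq_bigr => j _; rewrite inE /F.
  rewrite -expRD; apply: le_trans (expR_ge1Dx _); rewrite lerDl mulNr subr_ge0.
  by rewrite -mulrA ler_wpM2l// ltW.
have -> : \sum_(f : {ffun 'I_n -> bool}) \prod_j F (f j) = (expR (- lam) + 1) ^+ n.
  rewrite -(bigA_distr_bigA (fun _ : 'I_n => F)) /=.
  by under eq_bigr do rewrite big_bool /=; rewrite prodr_const card_ord.
rewrite mulrDl expRD ler_wpM2l ?expR_ge0// mulrC expRM_natl.
rewrite lerXn2r ?nnegrE ?expR_ge0 ?addr_ge0 ?expR_ge0//.
by rewrite addrC expR_ge1Dx.
Qed.

(** Choose thresholds T_0 >= ... >= T_L as in the bound for near kernel vectors, each
    one negligible for the previous level. Either the set of blocks of mass at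
    least T_t is the same at two consecutive levels and proper, so that the
    vector is negligible outside it, or all blocks are heavy at level L. In the
    latter case, few large coordinates in a block make the vector negligible on
    most columns of this block. *)
Lemma near_kernel_spread (K sigma r p beta : R) (L : nat) :
  0 < K -> 0 < sigma -> 0 < r -> 0 < p -> p <= 1 -> 0 < beta -> (1 < L)%N ->
  exists rho theta c2 c1 Cst : R, exists n0 : nat,
  [/\ 0 < rho, 0 < theta, 0 < c2, 0 < c1 & 0 < Cst] /\
  forall n : nat, (n0 <= n)%N ->
  forall (Om : finType) (w : finpmf R Om) (val : Om -> R[i]), anticonc w val r p ->
  forall (A : 'M[R]_n) (B : 'M[R[i]]_n) (blk : 'I_n -> 'I_L), profile A blk sigma beta ->
  forall k0 : 'I_n,
  pr w (fun x => opbound (entry val A B x) (K ^+ 2 * n%:R) /\ exists u : 'I_n -> R[i],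
    [/\ sqnorm u = 1,
        \sum_(i | i != k0) cabs (mulv (entry val A B x) u i) ^+ 2 <= c2 * n%:R
      & exists l, ~ spread_in_block blk u rho theta l])
  <= Cst * expR (- (c1 * n%:R)).
Proof.
move=> K0 sigma0 r0 p0 p1 beta0 L1.
have L0 : (0 < L)%N by apply: ltnW.
have L0' : 0 < L%:R :> R by rewrite ltr0n.
have K20 : 0 < K ^+ 2 by rewrite exprn_gt0.
have beta20 : 0 < beta / 2 by rewrite divr_gt0.
have [c1 c10 bound] := near_kernel_bound K0 sigma0 r0 p0 p1 beta20 L0.
have /choice[F hF] : forall T : R, exists cn : R * nat, 0 < T -> 0 < cn.1 /\
  forall n : nat, (cn.2 <= n)%N ->
  forall (Om : finType) (w : finpmf R Om) (val : Om -> R[i]), anticonc w val r p ->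
  forall (A : 'M[R]_n) (B : 'M[R[i]]_n), (forall i j, 0 <= A i j <= 1) ->
  forall (blk : 'I_n -> 'I_L) (N J : pred 'I_n) (H : pred 'I_L),
  (forall i, N i -> exists2 l, H l & forall j, blk j = l -> sigma <= A i j) ->
  #|J|%:R + beta / 2 * n%:R <= #|N|%:R ->
  pr w (fun x => near_kernel blk (entry val A B x) N J H (K ^+ 2 * n%:R) T (cn.1 * n%:R)) <=
  expR (- (c1 * n%:R)).
  move=> T; have [T0|_] := ltP 0 T; last by exists (0, 0%N).
  by have [c2 c20 [n0 h]] := bound T T0; exists (c2, n0).
(* The successive mass thresholds: below level t + 1, a block is negligible
   compared with what level t guarantees. *)
pose Tt t := iter t (fun T => Num.min T ((F T).1 / (4 * K ^+ 2 * L%:R))) (L%:R^-1).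
have Tt0 t : 0 < Tt t.
  elim: t => [|t IH]; first by rewrite invr_gt0.
  by rewrite lt_min IH divr_gt0 ?mulr_gt0//; have [] := hF _ IH.
pose ct t := (F (Tt t)).1.
have ct0 t : 0 < ct t by have [] := hF _ (Tt0 t).
have TtS t : Tt t.+1 <= Tt t by rewrite ge_min lexx.
have TtSc t : 4 * (K ^+ 2 * (L%:R * Tt t.+1)) <= ct t.
  rewrite mulrA mulrA mulrC -ler_pdivlMr ?mulr_gt0//; by rewrite ge_min lexx orbT.
have [c c_gt0 cle] := positive_lower_bound L ct0.
have [nF nFle] := nat_upper_bound (fun t => (F (Tt t)).2) L.
pose rho := ct L / (4 * K ^+ 2).
have rho0 : 0 < rho by rewrite divr_gt0 ?mulr_gt0.
pose lam := 4 / c1.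
have lam0 : 0 < lam by rewrite divr_gt0.
pose theta := Num.min (beta / 4) (c1 / 4 / lam).
have theta0 : 0 < theta by rewrite lt_min !divr_gt0.
have theta_beta : theta <= beta / 4 by rewrite ge_min lexx.
have rate : lam * theta + expR (- lam) <= c1 / 2.
  have : lam * theta <= c1 / 4.
    by rewrite mulrC -ler_pdivlMr// ge_min lexx orbT.
  have : expR (- lam) <= c1 / 4.
    rewrite expRN -[c1 / 4]invf_div -/lam lef_pV2 ?posrE ?expR_gt0//.
    by apply: le_trans (expR_ge1Dx _); rewrite lerDr.
  lra.
exists rho, theta, (c / 4), (c1 / 2), (L%:R * (2 ^ L)%:R + L%:R).
exists (maxn nF (Num.truncn (4 / beta)).+1); split.
  by split=> //; rewrite ?divr_gt0// addr_gt0// mulr_gt0// ltr0n expn_gt0.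
move=> n; rewrite geq_max => /andP[nnF n4] Om w val AC A B blk [A01 blk_size blk_adj] k0.
have nbeta : 4 <= beta * n%:R.
  rewrite mulrC -ler_pdivrMr//; apply: le_trans (ltW (truncnS_gt _)) _.
  by rewrite ler_nat.
have n0 : 0 < n%:R :> R by rewrite -(pmulr_rgt0 _ beta0); lra.
set M := entry val A B.
pose k2 := K ^+ 2 * n%:R.
have level t (N J : pred 'I_n) (H : pred 'I_L) : (t <= L)%N ->
    (forall i, N i -> exists2 l, H l & forall j, blk j = l -> sigma <= A i j) ->
    #|J|%:R + beta / 2 * n%:R <= #|N|%:R ->
    pr w (fun x => near_kernel blk (M x) N J H k2 (Tt t) (ct t * n%:R)) <= expR (- (c1 * n%:R)).
  move=> tL; have [_ h] := hF _ (Tt0 t).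
  by apply: h => //; apply: leq_trans nnF; apply: nFle.
(* E1 concerns a stable proper set of heavy blocks at some level, with the rows
   adjacent to them. E2 concerns a block l in which only the coordinates of a
   small set f are kept, all other blocks being heavy; every row is adjacent to
   a block other than l. *)
pose N1 (h : {ffun 'I_L -> bool}) i :=
  (i != k0) && [exists l, [&& h l, (l <= (blk i).+1)%N & (blk i <= l.+1)%N]].
pose J1 (h : {ffun 'I_L -> bool}) j := h (blk j).
pose N2 i := i != k0.
pose J2 (l : 'I_L) (f : {ffun 'I_n -> bool}) j := (blk j != l) || f j.
pose ok1 (th : 'I_L * {ffun 'I_L -> bool}) := [exists l, th.2 l] && [exists l, ~~ th.2 l].
pose few (f : {ffun 'I_n -> bool}) := #|[pred j | f j]|%:R < theta * n%:R.
pose ok2 (lf : 'I_L * {ffun 'I_n -> bool}) := few lf.2.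
pose E1 x := exists2 th, ok1 th &
  near_kernel blk (M x) (N1 th.2) (J1 th.2) th.2 k2 (Tt th.1) (ct th.1 * n%:R).
pose E2 x := exists2 lf, ok2 lf &
  near_kernel blk (M x) N2 (J2 lf.1 lf.2) (predC1 lf.1) k2 (Tt L) (ct L * n%:R).
have PE1 : pr w E1 <= (L%:R * (2 ^ L)%:R) * expR (- (c1 * n%:R)).
  apply: (@le_trans _ _ (\sum_(th | ok1 th) expR (- (c1 * n%:R)))).
    apply: (le_trans (pr_le_sum w (fun x (e : E1 x) => e))).
    apply: ler_sum => -[t h] /andP[/existsP[a ha] /existsP[b hb]] /=.
    apply: level; first exact: ltnW.
      move=> i /andP[_ /existsP[l /and3P[hl li il]]]; exists l => // j bj.
      by apply: blk_adj; rewrite bj.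
    have [l [l' [hl hl' ll' l'l]]] := adjacent_block ha hb.
    have card : (#|J1 h| + #|[pred j | blk j == l']| <= (#|N1 h|).+1)%N.
      rewrite -cardUI [X in (_ + X)%N]eq_card0 ?addn0; last first.
        move=> j; rewrite !inE; apply/negbTE/negP => /andP[].
        by rewrite unfold_in /J1 => hj /eqP bj; move: hl'; rewrite -bj hj.
      rewrite -[leqRHS]add1n; apply: (@leq_trans #|[predU pred1 k0 & N1 h]|).
        apply: subset_leq_card; apply/fintype.subsetP => j; rewrite !inE => jJ.
        case: eqVneq => //= jk; rewrite unfold_in /N1 jk /=; apply/existsP.
        case/orP: jJ => [hj|/eqP bj].
          by exists (blk j); rewrite -[h (blk j)]/(J1 h j) [J1 h j]hj !leqnSn.
        by exists l; rewrite hl bj ll' l'l.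
      by rewrite -(card1 k0) -cardUI leq_addr.
    have := blk_size l'; move: card; rewrite -(ler_nat R) -natr1 natrD; lra.
  rewrite big_mkcond; apply: (@le_trans _ _ (\sum_(th : 'I_L * {ffun 'I_L -> bool}) expR (- (c1 * n%:R)))).
    by apply: ler_sum => th _; case: ifP => // _; apply: expR_ge0.
  by rewrite sumr_const card_prod card_ffun card_bool !card_ord -[_ *+ _]mulr_natl natrM.
have PE2 : pr w E2 <= L%:R * expR (- (c1 / 2 * n%:R)).
  apply: (@le_trans _ _ (\sum_(lf | ok2 lf) expR (- (c1 * n%:R)))).
    apply: (le_trans (pr_le_sum w (fun x (e : E2 x) => e))).
    apply: ler_sum => -[l f]; rewrite /ok2 /few /= => small.
    apply: level => //.
      move=> i _; have [l' [l'l l'i il']] := other_neighbour l (blk i) L1.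
      by exists l' => // j bj; apply: blk_adj; rewrite bj.
    have card : (#|J2 l f| + #|[pred j | blk j == l]| <= n + #|[pred j | f j]|)%N.
      rewrite -cardUI; apply: leq_add; first by rewrite -[leqRHS]card_ord max_card.
      apply: subset_leq_card; apply/fintype.subsetP => j; rewrite !inE => /andP[].
      by rewrite unfold_in /J2 => jJ /eqP bj; move: jJ; rewrite bj eqxx.
    have cardN : (#|N2|).+1 = n.
      transitivity (#|predC1 k0|.+1); first by [].
      by rewrite cardC1 card_ord prednK// (leq_ltn_trans _ (ltn_ord k0)).
    have cardN' : n%:R = #|N2|%:R + 1 :> R by rewrite natr1 cardN.
    have := blk_size l; move: card cardN'; rewrite -(ler_nat R) !natrD.
    have : theta * n%:R <= beta / 4 * n%:R by rewrite ler_wpM2r// ltW.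
    lra.
  have -> : \sum_(lf | ok2 lf) expR (- (c1 * n%:R)) = #|ok2|%:R * expR (- (c1 * n%:R)).
    by rewrite sumr_const -[_ *+ _]mulr_natl.
  have -> : #|ok2| = (L * #|few|)%N.
    rewrite -[X in (X * _)%N](card_ord L) -cardX; apply: eq_card => -[l f].
    by rewrite !inE.
  rewrite natrM -mulrA ler_pM2l//.
  apply: le_trans (ler_wpM2r (expR_ge0 _) (few_small_subsets n theta (ltW lam0))) _.
  rewrite -expRD ler_expR.
  have := ler_wpM2r (ltW n0) rate; lra.
apply: (@le_trans _ _ (pr w E1 + pr w E2)); last first.
  rewrite mulrDl; apply: lerD PE2; apply: le_trans PE1 _.
  rewrite ler_wpM2l ?mulr_ge0// ler_expR lerN2 ler_pM2r//; lra.
apply: pr_leU => x [opx [u [u1 us [l nspread]]]].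
have us' (N : pred 'I_n) : (forall i, N i -> i != k0) ->
    \sum_(i | N i) cabs (mulv (M x) u i) ^+ 2 <= c / 4 * n%:R.
  move=> Nk; apply: le_trans us.
  rewrite big_mkcond [leRHS]big_mkcond; apply: ler_sum => i _.
  by case: ifP => [/Nk ->//|_]; case: ifP => // _; rewrite sqr_ge0.
have restrict (N J : pred 'I_n) (H : pred 'I_L) t : (t <= L)%N ->
    (forall i, N i -> i != k0) -> (forall j, H (blk j) -> J j) ->
    (forall l, H l -> Tt t <= block_mass blk u l) ->
    4 * (K ^+ 2 * \sum_(j | ~~ J j) cabs (u j) ^+ 2) <= ct t ->
    near_kernel blk (M x) N J H k2 (Tt t) (ct t * n%:R).
  move=> tL Nk HJ HT rest; split=> //; exists (fun j => if J j then u j else 0); split.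
  - by move=> j /negbTE ->.
  - rewrite -u1; apply: ler_sum => j _; case: ifP => // _.
    by rewrite cabs0 expr0n sqr_ge0.
  - move=> l' Hl'; apply: le_trans (HT l' Hl') _; apply: ler_sum => j /eqP bj.
    by rewrite HJ ?bj.
  - apply: le_trans (restrict_small N J u opx) _.
    have := us' N Nk; have := ler_wpM2r (ltW n0) (cle t tL).
    have := ler_wpM2r (ltW n0) rest; rewrite /k2.
    set S := \sum_(j | _) _; set S' := \sum_(i | _) _; lra.
pose h t : pred 'I_L := fun l => Tt t <= block_mass blk u l.
have hmono t l' : h t l' -> h t.+1 l' by apply: le_trans.
have mass_sum : \sum_l block_mass blk u l = 1.
  by rewrite -u1 /sqnorm (partition_big blk predT).
have h0 : exists l', h 0%N l'.
  apply/not_existsP => no.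
  have : \sum_l block_mass blk u l < \sum_(l < L) L%:R^-1.
    apply: ltr_sum; last by move=> l' _; rewrite ltNge; apply/negP => /no.
    by apply/hasP; exists (Ordinal L0); rewrite ?mem_index_enum.
  by rewrite mass_sum sumr_const card_ord -[_ *+ _]mulr_natr mulVf ?gt_eqF// ltxx.
have [[t [tL [l2 hl2] same]]|full] := stable_level hmono h0.
  left; exists (Ordinal tL, [ffun l => h t l]).
    apply/andP; split; apply/existsP; last by exists l2; rewrite ffunE.
    have [l' hl'] := h0; exists l'; rewrite ffunE.
    by elim: (t) => // t' IH; apply: hmono.
  apply: restrict => /=; first exact: ltnW.
  - by move=> i /andP[].
  - by [].
  - by move=> l'; rewrite ffunE.
  - apply: le_trans (TtSc t); rewrite ler_pM2l// ler_pM2l//.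
    rewrite (partition_big blk predT)//=.
    apply: (@le_trans _ _ (\sum_(l' < L) Tt t.+1)); last first.
      by rewrite sumr_const card_ord -[_ *+ _]mulr_natl.
    apply: ler_sum => l' _; have [hl'|/negbTE hl'] := boolP (h t l').
      rewrite big1 ?(ltW (Tt0 _))// => j; rewrite /J1 ffunE => /andP[+ /eqP bj].
      by rewrite bj hl'.
    have : ~~ h t.+1 l' by rewrite -same hl'.
    rewrite /h -ltNge => /ltW; apply: le_trans.
    rewrite /block_mass big_mkcond [leRHS]big_mkcond; apply: ler_sum => j _.
    by case: (blk j == l'); rewrite ?andbT ?andbF//; case: ifP => // _; rewrite sqr_ge0.
right; pose f := [ffun j => (blk j == l) && (rho <= n%:R * cabs (u j) ^+ 2)].
exists (l, f).
  rewrite /ok2 /few /= ltNge; apply/negP => big; apply: nspread.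
  rewrite /spread_in_block; apply: le_trans big _.
  rewrite ler_nat; apply: subset_leq_card; apply/fintype.subsetP => j.
  by rewrite !inE ffunE.
apply: restrict => //=; first (by move=> j; rewrite /J2 => ->); first by move=> l' _; apply: full.
have -> : ct L = 4 * (K ^+ 2 * rho) by rewrite /rho; field; rewrite gt_eqF.
rewrite ler_pM2l// ler_pM2l//.
apply: (@le_trans _ _ (\sum_(j : 'I_n) rho / n%:R)); last first.
  by rewrite sumr_const card_ord -[_ *+ _]mulr_natr mulfVK ?gt_eqF.
rewrite big_mkcond; apply: ler_sum => j _.
case: ifPn => [|_]; last by rewrite divr_ge0 ?(ltW n0)// ltW.
rewrite /J2 ffunE negb_or negbK => /andP[/eqP bj]; rewrite bj eqxx /= -ltNge => /ltW.
by move=> small; rewrite ler_pdivlMr// mulrC.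
Qed.

End Structure.

(** * The smallest singular value over a finite probability space *)

Section FiniteCore.
Variable R : realType.

Lemma sqnorm_scale (n : nat) (c : R) (u : 'I_n -> R[i]) :
  sqnorm (fun j => (c%:C)%C * u j) = c ^+ 2 * sqnorm u.
Proof.
rewrite /sqnorm mulr_sumr; apply: eq_bigr => j _.
by rewrite cabsM cabs_real exprMn real_normK ?num_real.
Qed.

Lemma sqnorm_eq0 (n : nat) (u : 'I_n -> R[i]) : sqnorm u = 0 -> forall j, u j = 0.
Proof.
move=> u0 j; have : cabs (u j) ^+ 2 = 0.
  apply/eqP; rewrite eq_le sqr_ge0 andbT -u0 /sqnorm (bigD1 j)//= lerDl.
  by apply: sumr_ge0 => i _; rewrite sqr_ge0.
by move/eqP; rewrite expf_eq0 /= cabs_eq0 => /eqP.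
Qed.

Lemma eq_sqnorm (n : nat) (u v : 'I_n -> R[i]) : u =1 v -> sqnorm u = sqnorm v.
Proof. by move=> uv; apply: eq_bigr => j _; rewrite uv. Qed.

(** Bessel's inequality for a single vector. *)
Lemma cauchy_schwarz (n : nat) (a y : 'I_n -> R[i]) :
  cabs (\sum_i a i * y i) ^+ 2 <= sqnorm a * sqnorm y.
Proof.
case: n a y => [|n] a y; first by rewrite /sqnorm !big_ord0 cabs0 expr0n mul0r.
have [a0|a0] := eqVneq (sqnorm a) 0.
  rewrite big1 => [|i _]; first by rewrite cabs0 expr0n a0 mul0r.
  by rewrite (sqnorm_eq0 a0) mul0r.
have a_gt0 : 0 < sqnorm a by rewrite lt_def a0 sqnorm_ge0.
pose k := Num.sqrt (sqnorm a).
have k0 : 0 < k by rewrite sqrtr_gt0.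
have k2 : k ^+ 2 = sqnorm a by rewrite sqr_sqrtr// ltW.
pose q : 'rV[R[i]]_n.+1 := \row_i ((k^-1)%:C%C * a i).
have q1 : sqnorm (q 0) = 1.
  rewrite (@eq_sqnorm _ _ (fun j => (k^-1)%:C%C * a j)) => [|j]; last by rewrite mxE.
  by rewrite sqnorm_scale -k2 -exprMn mulVf ?gt_eqF// expr1n.
have := @bessel R _ [:: (q, ord0)] y isT.
rewrite big_seq1 /= => bes.
have {}bes : cabs (dotp q y) ^+ 2 <= sqnorm y.
  by apply: bes => b; rewrite inE => /eqP ->.
have -> : \sum_i a i * y i = (k%:C)%C * dotp q y.
  rewrite mulr_sumr; apply: eq_bigr => i _.
  by rewrite mxE !mulrA -rmorphM /= mulfV ?gt_eqF// mul1r.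
rewrite cabsM cabs_real exprMn real_normK ?num_real// k2.
by rewrite ler_wpM2l// ltW.
Qed.

(** Pair the transposed image with its own conjugate. *)
Lemma opbound_tr (n : nat) (m : 'I_n -> 'I_n -> R[i]) (k2 : R) :
  0 <= k2 -> opbound m k2 -> opbound (fun i j => m j i) k2.
Proof.
move=> k0 opm v; pose y := mulv (fun i j => m j i) v; rewrite -/y.
pose yc j := Num.conj (y j).
have ycE : sqnorm yc = sqnorm y.
  apply: eq_bigr => j _; rewrite !cabs2E /yc.
  by rewrite -[Num.conj (y j)]/(conjc (y j)); case: (y j) => s t /=; rewrite sqrrN.
have dual : ((sqnorm y)%:C)%C = \sum_i v i * mulv m yc i.
  transitivity (\sum_j y j * yc j).
    by rewrite rmorph_sum; apply: eq_bigr => j _; rewrite /= -mul_conj.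
  rewrite /y /mulv; under eq_bigr do rewrite mulr_suml.
  rewrite exchange_big; apply: eq_bigr => i _ /=; rewrite mulr_sumr.
  by apply: eq_bigr => j _; rewrite mulrCA mulrA.
have := cauchy_schwarz v (mulv m yc); rewrite -dual cabs_real real_normK ?num_real//.
move=> /le_trans/(_ (ler_wpM2l (sqnorm_ge0 v) (opm yc))); rewrite ycE.
have [->|y0] := eqVneq (sqnorm y) 0; first by rewrite mulr_ge0 ?sqnorm_ge0.
have y_gt0 : 0 < sqnorm y by rewrite lt_def y0 sqnorm_ge0.
by rewrite expr2 mulrA ler_pM2r// mulrC.
Qed.

(** A matrix with a zero column has a unit left null vector. *)
Lemma unit_normal (n : nat) (k : 'I_n) (m : 'I_n -> 'I_n -> R[i]) :
  exists eta : 'I_n -> R[i], sqnorm eta = 1 /\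
    forall j, j != k -> \sum_i eta i * m i j = 0.
Proof.
pose G : 'M[R[i]]_n := \matrix_(i, j) if j == k then 0 else m i j.
have /eqP/det0P[v v0 vG] : \det G = 0.
  by rewrite (expand_det_col G k) big1// => i _; rewrite mxE eqxx mul0r.
have v_gt0 : 0 < sqnorm (v 0).
  rewrite lt_def sqnorm_ge0 andbT; apply: contra v0 => /eqP/sqnorm_eq0 v0.
  by apply/eqP/rowP => j; rewrite v0 mxE.
pose s := Num.sqrt (sqnorm (v 0)).
have s0 : 0 < s by rewrite sqrtr_gt0.
exists (fun i => (s^-1)%:C%C * v 0 i); split.
  rewrite sqnorm_scale -[sqnorm (v 0)]sqr_sqrtr ?(ltW v_gt0)// -/s.
  by rewrite -exprMn mulVf ?gt_eqF// expr1n.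
move=> j jk; under eq_bigr do rewrite -mulrA.
rewrite -mulr_sumr; have /matrixP/(_ 0 j) := vG; rewrite !mxE => vGj.
rewrite (_ : \sum_i v 0 i * m i j = 0) ?mulr0// -[RHS]vGj.
by apply: eq_bigr => i _; rewrite mxE (negbTE jk).
Qed.

Section Column.
Variables (Om : finType) (w : finpmf R Om) (val : Om -> R[i]) (r p : R).
Hypotheses (r_gt0 : 0 < r) (p_gt0 : 0 < p) (p_le1 : p <= 1) (AC : anticonc w val r p).
Variables (n L : nat) (A : 'M[R]_n) (B : 'M[R[i]]_n) (blk : 'I_n -> 'I_L).
Variables (sigma beta : R).
Hypotheses (sigma_gt0 : 0 < sigma) (prof : profile A blk sigma beta).

(** For a normal vector eta with many coordinates of order n ^ (- 1/2) in the
    block of k, the inner product with the k-th column obeys Littlewood-Offord. *)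
Lemma column_small_ball (eta : 'I_n -> R[i]) (k : 'I_n) (rho theta s : R) :
  0 < rho -> 0 < theta -> 0 <= s -> spread_in_block blk eta rho theta (blk k) ->
  pr w (fun y => cabs (\sum_i eta i * entry val A B y i k) <= s) <=
  ((4 / r * (s / (sigma * Num.sqrt (rho / n%:R))) + 1) * Num.sqrt (8 / p) + 4 / p) /
  Num.sqrt (theta * n%:R).
Proof.
move=> rho0 theta0 s0 spread.
pose G := [pred j | (blk j == blk k) && (rho <= n%:R * cabs (eta j) ^+ 2)].
have n0 : 0 < n%:R :> R by rewrite ltr0n; apply: leq_ltn_trans (leq0n _) (ltn_ord k).
pose tau := sigma * Num.sqrt (rho / n%:R).
have tau0 : 0 < tau by rewrite mulr_gt0// sqrtr_gt0 divr_gt0.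
pose v (ij : 'I_n * 'I_n) : R[i] := if ij.2 == k then eta ij.1 * ((A ij.1 k)%:C)%C else 0.
pose g : R[i] := - \sum_i eta i * B i k.
pose G' : pred ('I_n * 'I_n) := fun ij => (ij.2 == k) && G ij.1.
have cG : #|G'| = #|G|.
  rewrite -[RHS]muln1 -(card1 k) -cardX; apply: eq_card => -[i j].
  by rewrite !inE /in_mem /= /G' /= andbC.
have linear y : \sum_i eta i * entry val A B y i k = \sum_ij v ij * val (y ij) - g.
  rewrite /g opprK sum_pair /= -big_split; apply: eq_bigr => i _ /=.
  rewrite (bigD1 k)//= [X in _ + X + _]big1 ?addr0 => [|j jk].
    by rewrite /v /= eqxx /entry; ring.
  by rewrite /v /= (negbTE jk) mul0r.
have tn0 : 0 < theta * n%:R by rewrite mulr_gt0.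
have G0 : (0 < #|G'|)%N by rewrite cG -(ltr0n R); apply: lt_le_trans spread.
have vG ij : G' ij -> tau <= cabs (v ij).
  move=> /andP[jk /andP[/eqP bi big]]; rewrite /v jk cabsM cabs_real.
  have [_ _ adj] := prof.
  rewrite mulrC; apply: ler_pM; rewrite ?sqrtr_ge0 ?(ltW sigma_gt0)//.
    by apply: le_trans (ler_norm _); apply: adj; rewrite bi leqnSn.
  rewrite -[leRHS]ger0_norm ?cabs_ge0// -sqrtr_sqr ler_wsqrtr//.
  by rewrite ler_pdivrMr// mulrC.
have := littlewood_offord r_gt0 p_gt0 AC g tau0 s0 G0 vG.
have num0 : 0 <= (4 / r * (s / tau) + 1) * Num.sqrt (8 / p) + 4 / p.
  rewrite addr_ge0 ?mulr_ge0 ?addr_ge0 ?mulr_ge0 ?sqrtr_ge0 ?invr_ge0//;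
  by rewrite ?(ltW r_gt0) ?(ltW tau0) ?(ltW p_gt0).
move=> LO; apply: le_trans (le_trans LO _).
  by apply: pr_le => y; rewrite linear.
rewrite ler_wpM2l// lef_pV2 ?posrE ?sqrtr_gt0 ?ltr0n//.
by rewrite ler_wsqrtr// cG.
Qed.

End Column.

(** Adding the contributions of the vectors that are not spread, of the normal
    vectors that are not spread, and of Littlewood-Offord; a stands for
    1 / sqrt n and d for 1 / theta. *)
Let collect_constants (a b c d t C1 C2 C3 : R) :
  0 <= a -> 0 <= b -> 0 <= c -> 0 <= d -> 0 <= t -> 0 <= C1 -> 0 <= C2 -> 0 <= C3 ->
  C3 * a + (C3 * a + (C1 * t + C2 * a)) * d <= (b + c + C3 + (C3 + C1 + C2) * d) * (t + a).
Proof.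
move=> a0 b0 c0 d0 t0 C10 C20 C30; rewrite -subr_ge0.
have -> : (b + c + C3 + (C3 + C1 + C2) * d) * (t + a) -
  (C3 * a + (C3 * a + (C1 * t + C2 * a)) * d) =
  (b + c) * (t + a) + C3 * t + (C3 * t + C1 * a + C2 * t) * d by ring.
by rewrite !(addr_ge0, mulr_ge0).
Qed.

Lemma smallest_singular_value_fin (K sigma r p beta : R) (L : nat) :
  0 < K -> 0 < sigma -> 0 < r -> 0 < p -> p <= 1 -> 0 < beta -> (1 < L)%N ->
  exists2 C : R, 0 < C & forall n : nat, (0 < n)%N ->
  forall (Om : finType) (w : finpmf R Om) (val : Om -> R[i]), anticonc w val r p ->
  forall (A : 'M[R]_n) (B : 'M[R[i]]_n) (blk : 'I_n -> 'I_L), profile A blk sigma beta ->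
  forall t : R, 0 <= t ->
  pr w (fun x => opbound (entry val A B x) (K ^+ 2 * n%:R) /\ exists u : 'I_n -> R[i],
    sqnorm u = 1 /\ sqnorm (mulv (entry val A B x) u) <= t ^+ 2 / n%:R)
  <= C * (t + (Num.sqrt n%:R)^-1).
Proof.
move=> K0 sigma0 r0 p0 p1 beta0 L1.
have [rho [theta [c2 [c1 [Cst [n0 [[rho0 theta0 c20 c10 Cst0] spread]]]]]]] :=
  near_kernel_spread K0 sigma0 r0 p0 p1 beta0 L1.
pose S8 := Num.sqrt (8 / p).
have S80 : 0 < S8 by rewrite sqrtr_gt0 divr_gt0.
have st0 : 0 < Num.sqrt theta by rewrite sqrtr_gt0.
pose C1 := 4 * S8 / (r * rho * sigma * Num.sqrt theta).
pose C2 := (S8 + 4 / p) / Num.sqrt theta.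
have C10 : 0 < C1 by rewrite divr_gt0 ?mulr_gt0.
have C20 : 0 < C2 by rewrite divr_gt0// addr_gt0// divr_gt0.
pose C3 := Cst / c1.
have C30 : 0 < C3 by rewrite divr_gt0.
pose C := Num.sqrt n0%:R + (Num.sqrt c2)^-1 + C3 + (C3 + C1 + C2) / theta.
have sc20 : 0 < (Num.sqrt c2)^-1 by rewrite invr_gt0 sqrtr_gt0.
have CC0 : 0 < (C3 + C1 + C2) / theta by rewrite divr_gt0// !addr_gt0.
have sn0 : 0 <= Num.sqrt n0%:R :> R by rewrite sqrtr_ge0.
have C0 : 0 < C by rewrite /C; lra.
exists C => // n n_gt0 Om w val AC A B blk prof t t0.
have nR : 0 < n%:R :> R by rewrite ltr0n.
have n1 : 1 <= n%:R :> R by rewrite ler1n.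
set sn := Num.sqrt n%:R.
have sn_gt0 : 0 < sn by rewrite sqrtr_gt0.
have sn_ge1 : 1 <= sn by rewrite -sqrtr1 ler_wsqrtr.
have snn : sn ^+ 2 = n%:R by rewrite sqr_sqrtr// ltW.
have isn0 : 0 < sn^-1 by rewrite invr_gt0.
have trivial_bound (X : {ffun 'I_n * 'I_n -> Om} -> Prop) :
    1 <= C * (t + sn^-1) -> pr w X <= C * (t + sn^-1).
  by apply: le_trans; apply: pr_le1.
have [n_small|n_big] := ltnP n n0.
  apply: trivial_bound; apply: (@le_trans _ _ (Num.sqrt n0%:R * sn^-1)).
    by rewrite ler_pdivlMr// mul1r ler_wsqrtr// ler_nat ltnW.
  by apply: ler_pM; [exact: sn0|exact: ltW|rewrite /C; lra|rewrite lerDr].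
have [t_big|t_small] := ltP (Num.sqrt c2) t.
  apply: trivial_bound; apply: (@le_trans _ _ ((Num.sqrt c2)^-1 * t)).
    by rewrite mulrC ler_pdivlMr ?sqrtr_gt0// mul1r ltW.
  by apply: ler_pM; [exact: ltW|exact: t0|rewrite /C; lra|rewrite lerDl ltW].
have t2 : t ^+ 2 / n%:R <= c2 * n%:R.
  rewrite ler_pdivrMr//; apply: (@le_trans _ _ c2).
    by rewrite -[leRHS](@sqr_sqrtr _ c2) ?(ltW c20)// lerXn2r ?nnegrE ?sqrtr_ge0.
  rewrite -mulrA ler_peMr ?(ltW c20)//; apply: (@le_trans _ _ (1 * 1)); first by rewrite mulr1.
  by apply: ler_pM.
have exp_small : Cst * expR (- (c1 * n%:R)) <= C3 * sn^-1.
  rewrite /C3 -mulrA ler_pM2l// -invfM expRN lef_pV2 ?posrE ?expR_gt0 ?mulr_gt0//.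
  apply: le_trans (expR_ge1Dx _); apply: ler_wpDl => //.
  by rewrite ler_pM2l// -snn expr2 ler_peMl// ltW.
set M := entry val A B.
have [E Eprop] := choice (fun km : 'I_n * ('I_n -> 'I_n -> R[i]) => unit_normal km.1 km.2).
(* Column k is erased before the normal vector is chosen, so that the choice
   depends on the other columns only. *)
pose eta k x : 'I_n -> R[i] := E (k, fun i j => if j == k then 0 else M x i j).
have eta1 k x : sqnorm (eta k x) = 1 by have [] := Eprop (k, fun i j => if j == k then 0 else M x i j).
have eta_orth k x j : j != k -> \sum_i eta k x i * M x i j = 0.
  move=> jk; have [_ /(_ j jk)] := Eprop (k, fun i j => if j == k then 0 else M x i j).
  by move=> H; rewrite -[RHS]H; apply: eq_bigr => i _ /=; rewrite (negbTE jk).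
pose op x := opbound (M x) (K ^+ 2 * n%:R).
have k20 : 0 <= K ^+ 2 * n%:R by rewrite mulr_ge0 ?sqr_ge0// ltW.
pose l0 : 'I_L := Ordinal (ltnW L1).
pose col k x := \sum_i eta k x i * M x i k.
pose s := t / Num.sqrt rho.
have srho : 0 < Num.sqrt rho by rewrite sqrtr_gt0.
have s0 : 0 <= s by rewrite divr_ge0// ltW.
pose Bk k x := op x /\ cabs (col k x) <= s.
pose Bad x := op x /\ exists u : 'I_n -> R[i],
    [/\ sqnorm u = 1, \sum_(i | i != Ordinal n_gt0) cabs (mulv (M x) u i) ^+ 2 <= c2 * n%:R
      & exists l, ~ spread_in_block blk u rho theta l].
have PBad : pr w Bad <= C3 * sn^-1.
  by apply: le_trans exp_small; apply: spread.
have PBk k : pr w (Bk k) <= C3 * sn^-1 + (C1 * t + C2 * sn^-1).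
  pose NS x := op x /\ ~ spread_in_block blk (eta k x) rho theta (blk k).
  pose SP x := spread_in_block blk (eta k x) rho theta (blk k) /\ cabs (col k x) <= s.
  apply: (@le_trans _ _ (pr w NS + pr w SP)).
    apply: pr_leU => x [opx cx].
    by have [|] := pselect (spread_in_block blk (eta k x) rho theta (blk k)); [right|left].
  apply: lerD.
    apply: le_trans exp_small.
    have profT : profile A^T blk sigma beta.
      have [A01 size_blk adj] := prof; split=> //; first by move=> i j; rewrite mxE.
      by move=> i j ij ji; rewrite mxE; apply: adj.
    apply: le_trans (spread n n_big Om w val AC A^T B^T blk profT k).
    pose sw (ij : 'I_n * 'I_n) := (ij.2, ij.1).
    have bsw : bijective sw by exists sw => -[].
    rewrite [leRHS](Ex_reindex w _ bsw); apply: Ex_le => x.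
    case: asboolP => [[opx nsp]|_]; last exact: ler0n.
    have trE i j : entry val A^T B^T [ffun ij => x (sw ij)] i j = M x j i.
      by rewrite /M /entry !mxE ffunE.
    rewrite asboolT//; split.
      move=> u; apply: le_trans (opbound_tr k20 opx u).
      by rewrite le_eqVlt; apply/orP; left; apply/eqP/eq_sqnorm => i;
        apply: eq_bigr => j _; rewrite trE.
    exists (eta k x); split; [exact: eta1| |by exists (blk k)].
    rewrite big1 ?mulr_ge0 ?(ltW c20) ?(ltW nR)// => j jk.
    rewrite /mulv; under eq_bigr do rewrite trE mulrC.
    by rewrite eta_orth// cabs0 expr0n.
  rewrite (pr_merge w (fun ij : 'I_n * 'I_n => ij.2 == k)).
  rewrite -[leRHS](@Ex_cst _ ('I_n * 'I_n)%type _ w); apply: Ex_le => x.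
  have etaE y : eta k (merge (fun ij : 'I_n * 'I_n => ij.2 == k) x y) = eta k x.
    rewrite /eta; congr (E (_, _)); apply/funext => i; apply/funext => j.
    by case: eqVneq => // jk; rewrite /M /entry ffunE /= (negbTE jk).
  have colE y : col k (merge (fun ij : 'I_n * 'I_n => ij.2 == k) x y) =
      \sum_i eta k x i * M y i k.
    by rewrite /col etaE; apply: eq_bigr => i _; rewrite /M /entry ffunE /= eqxx.
  have [sp|nsp] := pselect (spread_in_block blk (eta k x) rho theta (blk k)); last first.
    apply: (@le_trans _ _ 0); last first.
      exact: addr_ge0 (mulr_ge0 (ltW C10) t0) (mulr_ge0 (ltW C20) (ltW isn0)).
    rewrite -[leRHS](@Ex_cst _ ('I_n * 'I_n)%type _ w); apply: Ex_le => y.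
    by case: asboolP => //; rewrite /SP etaE => -[].
  apply: le_trans (le_trans (column_small_ball r0 p0 AC B sigma0 prof rho0 theta0 s0 sp) _).
    by apply: pr_le => y; rewrite /SP colE => -[].
  have -> : Num.sqrt (theta * n%:R) = Num.sqrt theta * sn by rewrite sqrtrM// ltW.
  have -> : Num.sqrt (rho / n%:R) = Num.sqrt rho / sn.
    by rewrite sqrtrM ?(ltW rho0)// sqrtrV// ltW.
  rewrite -/S8.
  rewrite le_eqVlt; apply/orP; left; apply/eqP; rewrite /C1 /C2 /s.
  have rhoE : rho = Num.sqrt rho ^+ 2 by rewrite sqr_sqrtr// ltW.
  rewrite [in RHS]rhoE; field.
  by rewrite !gt_eqF.
(* If u is spread, then B_k holds for at least theta n indices k. *)
apply: (@le_trans _ _ (pr w Bad + pr w (fun x => theta * n%:R <= \sum_k (`[< Bk k x >])%:R))).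
  apply: pr_leU => x [opx [u [u1 us]]].
  have [sp|nsp] := pselect (spread_in_block blk u rho theta l0); last first.
    left; split=> //; exists u; split=> //; last by exists l0.
    apply: le_trans (le_trans us t2).
    rewrite big_mkcond; apply: ler_sum => i _.
    by case: ifP => // _; rewrite sqr_ge0.
  right; apply: le_trans sp _.
  have -> (G : pred 'I_n) : #|G|%:R = \sum_k (G k)%:R :> R.
    rewrite -sum1_card natr_sum big_mkcond; apply: eq_bigr => k _.
    by rewrite unfold_in; case: (G k).
  apply: ler_sum => k _ /=; case: andP => [[_ big]|_]; last exact: ler0n.
  rewrite asboolT//; split=> //.
  have expand : col k x * u k = \sum_i eta k x i * mulv (M x) u i.
    rewrite /mulv; under [RHS]eq_bigr do rewrite mulr_sumr.
    rewrite exchange_big (bigD1 k)//= [X in _ + X]big1 ?addr0 => [|j jk].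
      by rewrite mulr_suml; apply: eq_bigr => i _; rewrite mulrA.
    by under eq_bigr do rewrite mulrA; rewrite -mulr_suml eta_orth// mul0r.
  have := cauchy_schwarz (eta k x) (mulv (M x) u).
  rewrite -expand eta1 mul1r cabsM exprMn => /le_trans/(_ us) H.
  rewrite -ler_sqr ?nnegrE ?cabs_ge0// /s expr_div_n sqr_sqrtr ?(ltW rho0)//.
  rewrite ler_pdivlMr//.
  apply: (@le_trans _ _ (cabs (col k x) ^+ 2 * (n%:R * cabs (u k) ^+ 2))).
    by rewrite ler_wpM2l// sqr_ge0.
  by rewrite mulrCA mulrC -ler_pdivlMr.
have tn0 : 0 < theta * n%:R by rewrite mulr_gt0.
have PP : pr w (fun x => theta * n%:R <= \sum_k (`[< Bk k x >])%:R) <=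
    (C3 * sn^-1 + (C1 * t + C2 * sn^-1)) / theta.
  rewrite ler_pdivlMr// -(ler_pM2r nR) -mulrA mulrC.
  apply: le_trans (markov_fin (g := fun x => \sum_k (`[< Bk k x >])%:R) _ _ _) _ => //.
    by move=> x; apply: sumr_ge0 => k _; apply: ler0n.
  rewrite Ex_sum; apply: le_trans (ler_sum _ (fun k _ => PBk k)) _.
  by rewrite sumr_const card_ord -[_ *+ _]mulr_natr.
apply: le_trans (lerD PBad PP) _.
by apply: collect_constants => //; rewrite ?invr_ge0; apply: ltW.
Qed.

End FiniteCore.

(** * Anticoncentration of a spread atom *)

Section Atom.
Context {d : measure_display} {T : measurableType d} {R : realType}.
Variable P : probability T R.
Implicit Types (f g : T -> R) (xi : T -> R[i]).

Definition rintegrable f : Prop := P.-integrable setT (EFin \o f).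

Lemma rintegrable_cst c : rintegrable (fun=> c).
Proof.
exact: (finite_measure_integrable_cst P c measurableT).
Qed.

Lemma rintegrableD f g : rintegrable f -> rintegrable g -> rintegrable (fun w => f w + g w).
Proof. by move=> fi gi; apply: (integrableD measurableT fi gi). Qed.

Lemma rintegrableZ c f : rintegrable f -> rintegrable (fun w => c * f w).
Proof. by move=> fi; apply: (integrableZl measurableT c fi). Qed.

Lemma rintegrable_le f g : measurable_fun setT f -> (forall w, `|f w| <= g w) -> rintegrable g -> rintegrable f.
Proof.
move=> mf fg gi; apply: le_integrable gi => //; first exact/measurable_EFinP.
by move=> w _ /=; rewrite lee_fin (le_trans (fg w))// ler_norm.
Qed.

Lemma rintegrable_indic (B : set T) : measurable B -> rintegrable (\1_B : T -> R).
Proof. by move=> mB; apply: integrable_indic. Qed.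

Definition mean f : R := \int[P]_w f w.

Lemma fine_expectation f : fine 'E_P[f] = mean f.
Proof. by rewrite unlock. Qed.

Lemma mean_cst c : mean (fun=> c) = c.
Proof. by rewrite -fine_expectation -[fun=> c]/(cst c) expectation_cst. Qed.

Lemma meanD f g : rintegrable f -> rintegrable g -> mean (fun w => f w + g w) = mean f + mean g.
Proof. by move=> fi gi; apply: RintegralD. Qed.

Lemma meanZ c f : rintegrable f -> mean (fun w => c * f w) = c * mean f.
Proof. by move=> fi; apply: RintegralZl. Qed.

Lemma mean_le f g : rintegrable f -> rintegrable g -> (forall w, f w <= g w) -> mean f <= mean g.
Proof. by move=> fi gi fg; apply: le_Rintegral. Qed.

Lemma mean_indic (B : set T) : measurable B -> (mean (\1_B : T -> R))%:E = P B.
Proof.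
move=> mB; rewrite /mean /Rintegral integral_indic// setIT fineK//.
by rewrite ge0_fin_numE// (le_lt_trans (probability_le1 P mB))// ltry.
Qed.

Variable xi : T -> R[i].
Hypothesis xi_rv : complex_rv xi.

Lemma measurable_Re : measurable_fun setT (fun w => complex.Re (xi w)).
Proof. exact: measurableT_comp measurable_fst xi_rv. Qed.

Lemma measurable_Im : measurable_fun setT (fun w => complex.Im (xi w)).
Proof. exact: measurableT_comp measurable_snd xi_rv. Qed.

Lemma measurable_cabs2 (z : R[i]) : measurable_fun setT (fun w => cabs (xi w - z) ^+ 2).
Proof.
under eq_fun do rewrite cabs2E ReD ImD ReN ImN.
apply: measurable_funD; apply: measurable_funX; apply: measurable_funB => //.
  exact: measurable_Re.
exact: measurable_Im.
Qed.

Lemma measurable_disc (z : R[i]) (r : R) : 0 <= r -> measurable [set w | cabs (xi w - z) <= r].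
Proof.
move=> r0; have -> : [set w | cabs (xi w - z) <= r] =
    (fun w => cabs (xi w - z) ^+ 2) @^-1` `]-oo, r ^+ 2].
  apply/seteqP; split => w /=; rewrite in_itv /= ler_sqr ?nnegrE ?cabs_ge0//.
by rewrite -[X in measurable X]setTI; apply: measurable_cabs2.
Qed.

Lemma measurable_tail (r : R) : 0 <= r -> measurable [set w | r < cabs (xi w)].
Proof.
move=> r0; rewrite (_ : [set w | _] = ~` [set w | cabs (xi w - 0) <= r]).
  by apply: measurableC; exact: measurable_disc.
by apply/seteqP; split=> w /=; rewrite subr0 ltNge => /negP.
Qed.

Hypothesis xi_mean : cexpectation P xi = 0.
Hypothesis xi_var : ('E_P[fun w => (cabs (xi w) ^+ 2)%R] = 1)%E.

Let cabs2_int : rintegrable (fun w => cabs (xi w) ^+ 2).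
Proof.
apply/integrableP; split.
  apply/measurable_EFinP; have := measurable_cabs2 0.
  by under eq_fun do rewrite subr0.
have := xi_var; rewrite unlock => E.
rewrite (_ : (\int[P]_w _)%E = 1%E) ?ltry// -E; apply: eq_integral => w _ /=.
by rewrite ger0_norm// sqr_ge0.
Qed.

Let mean_cabs2 : mean (fun w => cabs (xi w) ^+ 2) = 1.
Proof. by rewrite -fine_expectation xi_var. Qed.

Let Re_int : rintegrable (fun w => complex.Re (xi w)).
Proof.
apply: (rintegrable_le measurable_Re) (rintegrableD (rintegrable_cst 1) cabs2_int) => w.
apply: le_trans (Re_le_cabs _) _; have := sqr_ge0 (cabs (xi w) - 1); nra.
Qed.

Let Im_int : rintegrable (fun w => complex.Im (xi w)).
Proof.
apply: (rintegrable_le measurable_Im) (rintegrableD (rintegrable_cst 1) cabs2_int) => w.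
apply: le_trans (Im_le_cabs _) _; have := sqr_ge0 (cabs (xi w) - 1); nra.
Qed.

Let mean_Re : mean (fun w => complex.Re (xi w)) = 0.
Proof. by rewrite -fine_expectation; have := congr1 (@complex.Re R) xi_mean. Qed.

Let mean_Im : mean (fun w => complex.Im (xi w)) = 0.
Proof. by rewrite -fine_expectation; have := congr1 (@complex.Im R) xi_mean. Qed.

(** Chebyshev's inequality for the second moment. *)
Lemma atom_tail (N : R) : 0 < N -> (P [set w | (N < cabs (xi w))%R] <= (N ^- 2)%:E)%E.
Proof.
move=> N0; have mB := measurable_tail (ltW N0); set B := [set w | _] in mB *; rewrite -mean_indic// lee_fin.
rewrite -[leRHS]mulr1 -mean_cabs2 -meanZ; last exact: cabs2_int.
apply: mean_le (rintegrable_indic mB) (rintegrableZ _ cabs2_int) _ => w.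
have [wB|wB] := pselect (B w); last first.
  by rewrite indicE memNset// mulr_ge0 ?sqr_ge0// invr_ge0 sqr_ge0.
rewrite indicE mem_set// mulrC ler_pdivlMr ?exprn_gt0// mul1r.
by rewrite lerXn2r ?nnegrE ?cabs_ge0 ?ltW.
Qed.

(** An atom almost concentrated near a point far from 0 cannot have mean 0:
    compensating the mean on an event of small probability would cost more than
    the available second moment. *)
Lemma far_ball_mass (z : R[i]) (r : R) : 0 <= r -> 1 <= cabs z + r -> r <= 4^-1 ->
  (P [set w | (cabs (xi w - z) <= r)%R] <= (15 / 16)%:E)%E.
Proof.
move=> r0 zr r4; have mB := measurable_disc z r0; set B := [set w | _] in mB *.
rewrite -mean_indic// lee_fin leNgt; apply/negP => big.
pose c := cabs z; have c0 : 0 < c by rewrite /c; lra.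
pose a := complex.Re z; pose b := complex.Im z.
have ab : a ^+ 2 + b ^+ 2 = c ^+ 2 by rewrite /c cabs2E.
pose zeta w := a / c * complex.Re (xi w) + b / c * complex.Im (xi w).
have zeta_int : rintegrable zeta by apply: rintegrableD; apply: rintegrableZ; [exact: Re_int|exact: Im_int].
have mean_zeta : mean zeta = 0.
  rewrite /zeta meanD ?meanZ ?mean_Re ?mean_Im ?mulr0 ?addr0//;
    by apply: rintegrableZ; [exact: Re_int|exact: Im_int] || apply: rintegrableZ.
(* zeta is the component of the atom in the direction of z. On the ball it is
   at least 1/2, as c + r >= 1 and r <= 1/4; elsewhere it is bounded below by
   AM-GM. Taking means would give a positive mean to zeta. *)
have low w : - 8^-1 * cabs (xi w) ^+ 2 + (5 / 2 * \1_B w + (- 2)) <= zeta w.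
  have zeta2 : zeta w ^+ 2 <= cabs (xi w) ^+ 2.
    rewrite -subr_ge0 (_ : _ - _ = (a / c * complex.Im (xi w) - b / c * complex.Re (xi w)) ^+ 2).
      exact: sqr_ge0.
    have E1 : (a / c) ^+ 2 + (b / c) ^+ 2 = 1.
      by rewrite !expr_div_n -mulrDl ab mulfV// expf_neq0// gt_eqF.
    rewrite /zeta cabs2E -[X in X - _]mul1r -E1; ring.
  have [wB|wB] := pselect (B w); last first.
    have -> : \1_B w = 0 :> R by rewrite indicE memNset.
    have := sqr_ge0 (zeta w + 4); nra.
  have -> : \1_B w = 1 :> R by rewrite indicE mem_set.
  have zw : c - r <= zeta w.
    set e := xi w - z.
    have eE : xi w = z + e by rewrite /e addrC subrK.
    have -> : zeta w = c + (a / c * complex.Re e + b / c * complex.Im e).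
      rewrite /zeta eE ReD ImD -/a -/b.
      rewrite (_ : a / c * (a + complex.Re e) + b / c * (b + complex.Im e) =
        (a ^+ 2 + b ^+ 2) / c + (a / c * complex.Re e + b / c * complex.Im e)); last by ring.
      by rewrite ab expr2 mulfK ?gt_eqF.
    rewrite lerD2l.
    have : (a / c * complex.Re e + b / c * complex.Im e) ^+ 2 <= cabs e ^+ 2.
      rewrite -subr_ge0 (_ : _ - _ = (a / c * complex.Im e - b / c * complex.Re e) ^+ 2).
        exact: sqr_ge0.
      have E1 : (a / c) ^+ 2 + (b / c) ^+ 2 = 1.
        by rewrite !expr_div_n -mulrDl ab mulfV// expf_neq0// gt_eqF.
      rewrite cabs2E -[X in X - _]mul1r -E1; ring.
    rewrite -[X in X <= _]real_normK ?num_real// ler_sqr ?nnegrE ?cabs_ge0//.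
    by move=> /le_trans/(_ wB); rewrite ler_norml => /andP[].
  have : 0 <= cabs (xi w) ^+ 2 by apply: sqr_ge0.
  move: zr zw; rewrite /c; lra.
have Iint := rintegrable_indic mB.
have i1 := rintegrableZ (- 8^-1) cabs2_int.
have i2 := rintegrableZ (5 / 2) Iint.
have i3 := rintegrableD i2 (rintegrable_cst (- 2)).
have := mean_le (rintegrableD i1 i3) zeta_int low.
rewrite mean_zeta meanD// meanD// ?meanZ// ?mean_cst ?mean_cabs2; last exact: rintegrable_cst.
move: big; set q := mean _; lra.
Qed.

Variable kappa : R.
Hypothesis kappa_ge1 : 1 <= kappa.
Hypothesis xi_spread : spread P kappa xi.

Let eta := truncation P kappa xi.

Let etaE w : eta w = if cabs (xi w) <= kappa then xi w else 0.
Proof. by rewrite /eta /truncation xi_mean subr0. Qed.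

Let eta_le w : cabs (eta w) <= kappa.
Proof. rewrite etaE; case: ifP => // _; rewrite cabs0; have := kappa_ge1; lra. Qed.

Let D : set T := [set w | cabs (xi w) <= kappa].

Let mD : measurable D.
Proof.
have k0 : 0 <= kappa by rewrite (le_trans _ kappa_ge1).
have := measurable_disc 0 k0; rewrite /D.
by under eq_set do rewrite subr0.
Qed.

Let eta_indic w : (complex.Re (eta w) = complex.Re (xi w) * \1_D w) *
  (complex.Im (eta w) = complex.Im (xi w) * \1_D w).
Proof.
rewrite etaE indicE; have [wD|wD] := boolP (cabs (xi w) <= kappa).
  by rewrite mem_set// !mulr1.
by rewrite memNset ?mulr0//; apply/negP.
Qed.

Let Re_eta_int : rintegrable (fun w => complex.Re (eta w)).
Proof.
apply: (rintegrable_le _ _ (rintegrable_cst kappa)) => [|w]; last exact: le_trans (Re_le_cabs _) (eta_le w).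
under eq_fun do rewrite eta_indic.
by apply: measurable_funM; [exact: measurable_Re|exact: measurable_indic].
Qed.

Let Im_eta_int : rintegrable (fun w => complex.Im (eta w)).
Proof.
apply: (rintegrable_le _ _ (rintegrable_cst kappa)) => [|w]; last exact: le_trans (Im_le_cabs _) (eta_le w).
under eq_fun do rewrite eta_indic.
by apply: measurable_funM; [exact: measurable_Im|exact: measurable_indic].
Qed.

(** The variance minimises the mean square distance to a point. *)
Let truncated_variance (z : R[i]) :
  rintegrable (fun w => cabs (eta w - z) ^+ 2) /\ kappa^-1 <= mean (fun w => cabs (eta w - z) ^+ 2).
Proof.
have sq_int (y : R[i]) : rintegrable (fun w => cabs (eta w - y) ^+ 2).
  apply: (rintegrable_le _ _ (rintegrable_cst ((kappa + cabs y) ^+ 2))) => [|w].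
    under eq_fun do rewrite cabs2E ReD ImD ReN ImN.
    apply: measurable_funD; apply: measurable_funX; apply: measurable_funB => //.
      by apply/measurable_EFinP; apply: measurable_int Re_eta_int.
    by apply/measurable_EFinP; apply: measurable_int Im_eta_int.
  rewrite ger0_norm ?sqr_ge0// lerXn2r ?nnegrE ?cabs_ge0//.
    by rewrite addr_ge0 ?cabs_ge0// (le_trans _ kappa_ge1).
  by apply: le_trans (cabsD _ _) _; rewrite cabsN lerD2r eta_le.
split=> //; pose m := cexpectation P eta.
have mE : (mean (fun w => complex.Re (eta w)) = complex.Re m) *
  (mean (fun w => complex.Im (eta w)) = complex.Im m).
  by rewrite -!fine_expectation.
have var : kappa^-1 <= mean (fun w => cabs (eta w - m) ^+ 2).
  have := xi_spread; rewrite /spread /cvariance -/eta -/m -lee_fin -fine_expectation.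
  rewrite fineK// unlock; apply: integrable_fin_num => //; exact: sq_int.
apply: le_trans var _.
pose k1 := 2 * (complex.Re z - complex.Re m); pose k2 := 2 * (complex.Im z - complex.Im m).
pose k3 := cabs z ^+ 2 - cabs m ^+ 2.
have expand w : cabs (eta w - m) ^+ 2 = cabs (eta w - z) ^+ 2 +
    (k1 * complex.Re (eta w) + (k2 * complex.Im (eta w) + - k3)).
  by rewrite /k1 /k2 /k3 !cabs2E !ReD !ImD !ReN !ImN; ring.
rewrite (funext expand).
have i1 := rintegrableZ k1 Re_eta_int; have i2 := rintegrableZ k2 Im_eta_int.
have i3 := rintegrableD i2 (rintegrable_cst (- k3)).
rewrite meanD//; last exact: rintegrableD i1 i3.
rewrite gerDl meanD// meanD//; last exact: rintegrable_cst.
rewrite !meanZ// mean_cst !mE /k1 /k2 /k3 !cabs2E.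
have := sqr_ge0 (complex.Re z - complex.Re m); have := sqr_ge0 (complex.Im z - complex.Im m).
nra.
Qed.

(** If the disc is far from 0 the previous bound applies. If it is near 0, the
    truncated atom is at distance at most 2 kappa from z, and its mean square
    distance to z is at least 1 / kappa, so it cannot stay within 1 / (4 kappa)
    of z with probability close to 1. *)
Lemma spread_small_ball (z : R[i]) :
  (P [set w | (cabs (xi w - z) <= (4 * kappa)^-1)%R] <= (1 - (16 * kappa ^+ 3)^-1)%:E)%E.
Proof.
have k0 : 0 < kappa by apply: lt_le_trans kappa_ge1.
set r := (4 * kappa)^-1; set p := (16 * kappa ^+ 3)^-1.
have r0 : 0 < r by rewrite invr_gt0 mulr_gt0.
have r4 : r <= 4^-1 by rewrite lef_pV2 ?posrE ?mulr_gt0// ler_peMr.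
have p16 : p <= 16^-1.
  by rewrite lef_pV2 ?posrE ?mulr_gt0 ?exprn_gt0// ler_peMr// exprn_ege1.
have [far|near] := leP kappa (cabs z + r).
  apply: le_trans (far_ball_mass (ltW r0) (le_trans kappa_ge1 far) r4) _.
  by rewrite lee_fin; lra.
have mB := measurable_disc z (ltW r0); set B := [set w | _] in mB *.
rewrite -mean_indic// lee_fin leNgt; apply/negP => big.
have [eta_int var] := truncated_variance z.
have bound w : cabs (eta w - z) ^+ 2 <= - (4 * kappa ^+ 2) * \1_B w + (r ^+ 2 + 4 * kappa ^+ 2).
  have [wB|wB] := pselect (B w).
    have -> : \1_B w = 1 :> R by rewrite indicE mem_set.
    have -> : eta w = xi w.
      rewrite etaE ifT//; have := cabsD (xi w - z) z; rewrite subrK => /le_trans; apply.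
      by apply: le_trans (ltW near); rewrite addrC lerD2l; exact: wB.
    have -> : - (4 * kappa ^+ 2) * 1 + (r ^+ 2 + 4 * kappa ^+ 2) = r ^+ 2 by ring.
    by rewrite lerXn2r ?nnegrE ?cabs_ge0 ?(ltW r0).
  have -> : \1_B w = 0 :> R by rewrite indicE memNset.
  have : cabs (eta w - z) <= 2 * kappa.
    by apply: le_trans (cabsD _ _) _; rewrite cabsN; have := eta_le w; lra.
  have := cabs_ge0 (eta w - z); have := sqr_ge0 r; nra.
have Iint := rintegrable_indic mB.
have := mean_le eta_int (rintegrableD (rintegrableZ _ Iint) (rintegrable_cst _)) bound.
rewrite meanD ?meanZ ?mean_cst//; [|exact: rintegrableZ|exact: rintegrable_cst].
move=> /(le_trans var); set q := mean _ in big *; move=> H.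
have {}H : kappa^-1 <= r ^+ 2 + 4 * kappa ^+ 2 * (1 - q) by lra.
have : 4 * kappa ^+ 2 * (1 - q) <= 4 * kappa ^+ 2 * p.
  by rewrite ler_wpM2l ?mulr_ge0 ?sqr_ge0//; lra.
have -> : 4 * kappa ^+ 2 * p = kappa^-1 / 4 by rewrite /p; field; rewrite gt_eqF.
have : r ^+ 2 <= kappa^-1 / 16.
  rewrite (_ : r ^+ 2 = kappa^-1 / 16 * kappa^-1); last by rewrite /r; field; rewrite gt_eqF.
  by rewrite ler_piMr ?invf_le1// divr_ge0// invr_ge0 ltW.
have : 0 < kappa^-1 by rewrite invr_gt0.
lra.
Qed.

End Atom.

(** * Extreme singular values *)

Section SingularValues.
Variables (R : realType) (n : nat).
Implicit Types (M : 'M[R[i]]_n) (u v : 'I_n -> R[i]).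

Definition nrm u : R := Num.sqrt (sqnorm u).

Lemma nrm_ge0 u : 0 <= nrm u.
Proof. exact: sqrtr_ge0. Qed.

Lemma nrm2 u : nrm u ^+ 2 = sqnorm u.
Proof. by rewrite sqr_sqrtr// sqnorm_ge0. Qed.

Lemma nrmD u v : nrm (fun j => u j + v j) <= nrm u + nrm v.
Proof.
rewrite -ler_sqr ?nnegrE ?addr_ge0 ?nrm_ge0// sqrrD !nrm2.
pose au j : R[i] := (cabs (u j))%:C%C; pose av j : R[i] := (cabs (v j))%:C%C.
have auE : sqnorm au = sqnorm u.
  by apply: eq_bigr => j _; rewrite cabs_real ger0_norm// cabs_ge0.
have avE : sqnorm av = sqnorm v.
  by apply: eq_bigr => j _; rewrite cabs_real ger0_norm// cabs_ge0.
pose S := \sum_j cabs (u j) * cabs (v j).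
have S0 : 0 <= S by apply: sumr_ge0 => j _; rewrite mulr_ge0// cabs_ge0.
have CS : S <= nrm u * nrm v.
  rewrite -ler_sqr ?nnegrE ?mulr_ge0 ?nrm_ge0// exprMn !nrm2 -auE -avE.
  apply: le_trans (cauchy_schwarz au av).
  rewrite (_ : \sum_i _ = (S%:C)%C); last first.
    by rewrite rmorph_sum; apply: eq_bigr => j _; rewrite -rmorphM.
  by rewrite cabs_real real_normK ?num_real.
apply: (@le_trans _ _ (sqnorm u + 2 * S + sqnorm v)); last first.
  by rewrite lerD2r lerD2l -[leRHS]mulr_natl ler_pM2l.
rewrite /S mulr_sumr /sqnorm -!big_split; apply: ler_sum => j _ /=.
apply: (@le_trans _ _ ((cabs (u j) + cabs (v j)) ^+ 2)).
  by rewrite lerXn2r ?nnegrE ?cabs_ge0 ?addr_ge0 ?cabs_ge0// cabsD.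
by rewrite sqrrD mulr_natl.
Qed.

Lemma nrm_opbound (m : 'I_n -> 'I_n -> R[i]) (k : R) : 0 <= k ->
  opbound m (k ^+ 2) <-> forall u, nrm (mulv m u) <= k * nrm u.
Proof.
move=> k0; split=> H u; have := H u.
  by move=> Hu; rewrite -ler_sqr ?nnegrE ?mulr_ge0 ?nrm_ge0// exprMn !nrm2.
by move=> Hu; rewrite -!nrm2 -exprMn lerXn2r ?nnegrE ?mulr_ge0 ?nrm_ge0.
Qed.

Lemma mulv_col M u i : (M *m (\col_j u j)) i 0 = mulv M u i.
Proof. by rewrite mxE; apply: eq_bigr => j _; rewrite mxE. Qed.

Lemma l2norm_col (v : 'cV[R[i]]_n) : l2norm v = nrm (fun i => v i 0).
Proof. by []. Qed.

Lemma conj_col (v : 'cV[R[i]]_n) i :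
  (v^t*) 0 i * v i 0 = (cabs (v i 0) ^+ 2)%:C%C.
Proof. by rewrite [(_ ^t*) _ _]mxE [(_^T) _ _]mxE conj_mul. Qed.

(** In the eigenbasis of the Gram matrix, the square norm of the image is the
    sum of the eigenvalues weighted by the squared coordinates. *)
Lemma gram_eigenbasis M : exists (P : 'M[R[i]]_n) (lam : 'I_n -> R),
  [/\ P \is unitarymx, forall i, 0 <= lam i,
      forall i, spectral_diag (M^t* *m M) 0 i = (lam i)%:C%C
    & forall u, sqnorm (mulv M u) = \sum_i lam i * cabs (mulv P u i) ^+ 2].
Proof.
pose A := M^t* *m M; pose P := spectralmx A.
have PU : P \is unitarymx := spectral_unitarymx A.
have herm : A \is hermsymmx.
  apply/is_hermitianmxP; rewrite expr0 scale1r /A trmx_mul map_mxM; congr (_ *m _).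
  by rewrite trmxCK.
have spec : A = invmx P *m diag_mx (spectral_diag A) *m P.
  exact/orthomx_spectralP/hermitian_normalmx.
have sq u : ((sqnorm (mulv M u))%:C)%C =
    \sum_i spectral_diag A 0 i * ((cabs (mulv P u i) ^+ 2)%:C)%C.
  pose c : 'cV[R[i]]_n := \col_j u j.
  transitivity ((c^t* *m A *m c) 0 0).
    rewrite /A !mulmxA -mulmxA -[c^t* *m M^t*](_ : (M *m c)^t* = _); last first.
      by rewrite trmx_mul map_mxM.
    rewrite mxE rmorph_sum; apply: eq_bigr => i _ /=.
    by rewrite conj_col mulv_col.
  rewrite [in LHS]spec invmx_unitary// !mulmxA -[c^t* *m P^t*](_ : (P *m c)^t* = _); last first.
    by rewrite trmx_mul map_mxM.
  rewrite -[_ *m P *m c]mulmxA mxE; apply: eq_bigr => i _.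
  rewrite mul_mx_diag [(\matrix_(_, _) _) _ _]mxE mulrAC mulrC.
  by rewrite conj_col mulv_col.
have eig i : exists l : R, 0 <= l /\ spectral_diag A 0 i = l%:C%C.
  pose e j : R[i] := (P^t*) j i.
  have Pe i' : mulv P e i' = (i' == i)%:R.
    have /unitarymxP/matrixP/(_ i' i) := PU; rewrite !mxE => <-.
    by [].
  exists (sqnorm (mulv M e)); split; first exact: sqnorm_ge0.
  rewrite sq (bigD1 i)//= big1 ?addr0.
    by rewrite Pe eqxx -[1]/((1 : R)%:C)%C cabs_real normr1 expr1n mulr1.
  by move=> i' ii'; rewrite Pe (negbTE ii') cabs0 expr0n mulr0.
have [lam hlam] := choice eig.
exists P, lam; split=> //; try by move=> i; have [] := hlam i.
move=> u; apply: complexI; rewrite sq rmorph_sum; apply: eq_bigr => i _.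
by have [_ ->] := hlam i; rewrite -rmorphM.
Qed.

Lemma unitary_sqnorm (P : 'M[R[i]]_n) u : P \is unitarymx -> sqnorm (mulv P u) = sqnorm u.
Proof.
move=> /unitarymxP/mulmx1C PP; pose c : 'cV[R[i]]_n := \col_j u j.
have dotE (v : 'cV[R[i]]_n) : (v^t* *m v) 0 0 = (sqnorm (fun i => v i 0))%:C%C.
  by rewrite mxE rmorph_sum; apply: eq_bigr => i _; rewrite conj_col.
apply: complexI; transitivity (((P *m c)^t* *m (P *m c)) 0 0).
  by rewrite dotE; congr (_%:C)%C; apply: eq_bigr => i _; rewrite mulv_col.
rewrite trmx_mul map_mxM mulmxA -(mulmxA (c^t*)) PP mulmx1 dotE.
by congr (_%:C)%C; apply: eq_bigr => i _; rewrite mxE.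
Qed.

(** The list of square roots is nonincreasing, so its last entry is the square
    root of the least eigenvalue; it is attained at the corresponding column of
    the adjoint of the diagonalising unitary matrix. *)
Lemma last_singular_value M (s := singular_value M n) : (0 < n)%N ->
  [/\ 0 <= s, forall u, s * nrm u <= nrm (mulv M u)
    & exists u, sqnorm u = 1 /\ nrm (mulv M u) = s].
Proof.
move=> n0; have [P [lam [PU lam0 lamE sqE]]] := gram_eigenbasis M.
pose l := [seq Num.sqrt (lam i) | i <- enum 'I_n].
have sizel : size l = n by rewrite size_map size_enum_ord.
have sE : s = nth 0 (sort >=%R l) n.-1.
  rewrite /s /singular_value /singular_values; congr (nth 0 (sort _ _) _).
  by apply: eq_map => i; rewrite lamE.
have /mapP[i _ si] : s \in l.
  by rewrite -(mem_sort >=%R) sE mem_nth// size_sort sizel prednK.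
have smin j : s <= Num.sqrt (lam j).
  have : Num.sqrt (lam j) \in sort >=%R l.
    by rewrite mem_sort; apply/mapP; exists j; rewrite ?mem_enum.
  move=> /(nthP 0)[k]; rewrite size_sort sizel => kn <-; rewrite sE.
  apply: (@sorted_leq_nth _ >=%R); rewrite ?inE ?size_sort ?sizel ?prednK//.
  - by move=> a b c ab bc; exact: le_trans bc ab.
  - exact: lexx.
  - by apply: sort_sorted => a b; exact: le_total.
  - by rewrite -ltnS prednK.
have s0 : 0 <= s by rewrite si sqrtr_ge0.
have s2 : s ^+ 2 = lam i by rewrite si sqr_sqrtr.
split=> //.
  move=> u; rewrite -ler_sqr ?nnegrE ?mulr_ge0 ?nrm_ge0// exprMn !nrm2 sqE.
  rewrite -(unitary_sqnorm u PU) /sqnorm mulr_sumr; apply: ler_sum => j _.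
  rewrite ler_wpM2r ?sqr_ge0// -(sqr_sqrtr (lam0 j)).
  by rewrite lerXn2r ?nnegrE ?sqrtr_ge0.
pose e j : R[i] := (P^t*) j i.
have Pe i' : mulv P e i' = (i' == i)%:R.
  have /unitarymxP/matrixP/(_ i' i) := PU; rewrite !mxE => <-.
  by [].
have diag f : \sum_j f j * cabs (mulv P e j) ^+ 2 = f i.
  rewrite (bigD1 i)//= big1 ?addr0.
    by rewrite Pe eqxx -[1]/((1 : R)%:C)%C cabs_real normr1 expr1n mulr1.
  by move=> i' ii'; rewrite Pe (negbTE ii') cabs0 expr0n mulr0.
exists e; split.
  by rewrite -(unitary_sqnorm e PU) -(diag (fun=> 1)); apply: eq_bigr => j _; rewrite mul1r.
by rewrite /nrm sqE diag -s2 sqrtr_sqr ger0_norm.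
Qed.

Lemma mulv_entry_bound (m : 'I_n -> 'I_n -> R[i]) (eta : R) u :
  (forall i j, cabs (m i j) <= eta) -> nrm (mulv m u) <= n%:R * eta * nrm u.
Proof.
move=> h; have [n0|n0] := posnP n.
  by rewrite /nrm /sqnorm !big1 ?sqrtr0 ?mulr0// => i; have := ltn_ord i; rewrite {2}n0.
have eta0 : 0 <= eta := le_trans (cabs_ge0 _) (h (Ordinal n0) (Ordinal n0)).
move: u; apply/nrm_opbound; first by rewrite mulr_ge0.
move=> u; apply: (@le_trans _ _ (\sum_(i < n) (n%:R * eta ^+ 2 * sqnorm u))).
  apply: ler_sum => i _; apply: le_trans (cauchy_schwarz _ _) _.
  rewrite ler_wpM2r ?sqnorm_ge0//.
  apply: (@le_trans _ _ (\sum_(j < n) eta ^+ 2)).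
    by apply: ler_sum => j _; rewrite lerXn2r ?nnegrE ?cabs_ge0.
  by rewrite sumr_const card_ord mulr_natl.
by rewrite sumr_const card_ord -[leLHS]mulr_natl le_eqVlt; apply/orP; left; apply/eqP; ring.
Qed.

Lemma opnorm_bound M u : nrm (mulv M u) <= opnorm M * nrm u.
Proof.
pose S := [set l2norm (M *m v) | v in [set v : 'cV[R[i]]_n | l2norm v <= 1]].
pose eta : R := \sum_i \sum_j cabs (M i j).
have Meta i j : cabs (M i j) <= eta.
  rewrite /eta (bigD1 i)//= (bigD1 j)//= -addrA lerDl addr_ge0//.
    by apply: sumr_ge0 => *; exact: cabs_ge0.
  by apply: sumr_ge0 => *; apply: sumr_ge0 => *; exact: cabs_ge0.
have eta0 : 0 <= eta by apply: sumr_ge0 => *; apply: sumr_ge0 => *; exact: cabs_ge0.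
have Sub : has_ubound S.
  exists (n%:R * eta) => _ [v] /= v1 <-.
  have -> : M *m v = M *m \col_j v j 0.
    by congr (_ *m _); apply/matrixP => i j; rewrite mxE ord1.
  rewrite l2norm_col; under [X in nrm X]funext do rewrite mulv_col.
  apply: le_trans (mulv_entry_bound (fun j => v j 0) Meta) _.
  by rewrite ler_piMr ?mulr_ge0.
have [u0|u0] := eqVneq (nrm u) 0.
  apply: le_trans (mulv_entry_bound u Meta) _.
  by rewrite u0 !mulr0.
have up : 0 < nrm u by rewrite lt_def u0 nrm_ge0.
have homog v (c : R) : 0 <= c -> nrm (fun j => c%:C%C * v j) = c * nrm v.
  by move=> c0; rewrite /nrm sqnorm_scale sqrtrM ?sqr_ge0// sqrtr_sqr ger0_norm.
rewrite -ler_pdivrMr//; apply: ub_le_sup => //=.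
exists (\col_j (((nrm u)^-1)%:C%C * u j)) => /=.
  rewrite l2norm_col; under [X in nrm X]funext do rewrite mxE.
  by rewrite homog ?invr_ge0 ?nrm_ge0// mulVf.
rewrite l2norm_col; under [X in nrm X]funext do rewrite mulv_col.
rewrite mulrC -homog ?invr_ge0 ?nrm_ge0//; congr nrm; apply/funext => i.
by rewrite /mulv mulr_sumr; apply: eq_bigr => j _; ring.
Qed.

Lemma opnorm_le M (k : R) : (forall u, nrm (mulv M u) <= k * nrm u) -> 0 <= k -> opnorm M <= k.
Proof.
move=> h k0; apply: ge_sup.
  exists (l2norm (M *m 0)), 0 => //=.
  rewrite /l2norm big1 ?sqrtr0// => i _.
  by rewrite mxE cabs0 expr0n.
move=> _ [v] /= v1 <-.
have -> : M *m v = M *m \col_j v j 0.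
  by congr (_ *m _); apply/matrixP => i j; rewrite mxE ord1.
rewrite l2norm_col; under [X in nrm X]funext do rewrite mulv_col.
by apply: le_trans (h _) _; rewrite ler_piMr.
Qed.

Lemma opnorm_ge0 M : 0 <= opnorm M.
Proof.
have [n0|n0] := posnP n.
  rewrite /opnorm (_ : [set _ | _ in _] = [set 0]) ?sup1//.
  apply/seteqP; split=> [_ [v _ <-]|_ ->] /=.
    by rewrite /l2norm big1 ?sqrtr0// => i; have := ltn_ord i; rewrite {2}n0.
  exists 0 => /=; rewrite /l2norm big1 ?sqrtr0// => i; have := ltn_ord i; rewrite {2}n0//.
pose e (j : 'I_n) : R[i] := (j == Ordinal n0)%:R.
have e1 : nrm e = 1.
  rewrite /nrm /sqnorm (bigD1 (Ordinal n0))//= big1 ?addr0.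
    by rewrite expr1n expr0n addr0 sqrtr1 expr1n sqrtr1.
  by move=> i ii; rewrite /e (negbTE ii) cabs0 expr0n.
by have := opnorm_bound M e; rewrite e1 mulr1; apply: le_trans; exact: nrm_ge0.
Qed.

Lemma nrm_perturb M M' (eta : R) u : (forall i j, cabs (M i j - M' i j) <= eta) ->
  nrm (mulv M u) <= nrm (mulv M' u) + n%:R * eta * nrm u.
Proof.
move=> h; have -> : mulv M u = fun i => mulv M' u i + mulv (fun i j => M i j - M' i j) u i.
  by apply/funext => i; rewrite /mulv -big_split/=; apply: eq_bigr => j _; ring.
by apply: le_trans (nrmD _ _) _; rewrite lerD2l; exact: mulv_entry_bound.
Qed.

Lemma opnorm_perturb M M' (eta : R) : 0 <= eta -> (forall i j, cabs (M i j - M' i j) <= eta) ->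
  opnorm M <= opnorm M' + n%:R * eta.
Proof.
move=> eta0 h; apply: opnorm_le => [u|]; last by rewrite addr_ge0 ?opnorm_ge0 ?mulr_ge0.
by apply: le_trans (nrm_perturb u h) _; rewrite mulrDl lerD2r opnorm_bound.
Qed.

Lemma singular_value_perturb M M' (eta : R) : (0 < n)%N ->
  (forall i j, cabs (M i j - M' i j) <= eta) ->
  singular_value M n <= singular_value M' n + n%:R * eta.
Proof.
move=> n0 h; have [_ low _] := last_singular_value M n0.
have [_ _ [u [u1 <-]]] := last_singular_value M' n0.
have nu : nrm u = 1 by rewrite /nrm u1 sqrtr1.
by have := nrm_perturb u h; have := low u; rewrite nu !mulr1; exact: le_trans.
Qed.

End SingularValues.

(** * Discretisation *)

Section FiniteValued.
Context {d : measure_display} {T : measurableType d} {R : realType}.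
Variables (P : probability T R) (F : finType) (Y : T -> F).
Hypothesis mY : forall a, measurable (Y @^-1` [set a]).

Lemma measurable_finite (S : F -> Prop) : measurable [set w | S (Y w)].
Proof.
have -> : [set w | S (Y w)] = \bigcup_(a in [set a | S a]) Y @^-1` [set a].
  by apply/seteqP; split=> [w Sw|w [a Sa /= Ya]]; [exists (Y w)|rewrite /= Ya].
by apply: fin_bigcup_measurable => [|a _]; [exact: finite_finset|exact: mY].
Qed.

Lemma measurable_fun_finite (g : F -> R) : measurable_fun setT (fun w => g (Y w)).
Proof. by move=> _ S mS; rewrite setTI; exact: (measurable_finite (fun a => S (g a))). Qed.

Lemma law_finite (S : F -> Prop) :
  P [set w | S (Y w)] = (\sum_a fine (P (Y @^-1` [set a])) * (`[< S a >])%:R)%:E.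
Proof.
pose G a := Y @^-1` [set a] `&` [set w | S a].
have mG a : measurable (G a).
  by apply: measurableI => //; rewrite /=; exact: (measurable_finite (fun=> S a)).
have -> : [set w | S (Y w)] = \bigcup_(a in [set` index_enum F]) G a.
  apply/seteqP; split=> [w Sw|w [a _ [/= Ya Sa]]]; last by rewrite /= Ya.
  by exists (Y w) => //=; rewrite mem_index_enum.
rewrite measure_fin_bigcup//; last first.
  by move=> a b _ _ [w [[/= <- _] [/= <- _]]].
rewrite -fsbig_seq ?index_enum_uniq// -sumEFin; apply: eq_bigr => a _.
rewrite /G; case: asboolP => Sa.
  rewrite (_ : [set _ | S a] = setT) ?setIT ?mulr1 ?fineK ?fin_num_measure//.
  by apply/seteqP; split.
rewrite (_ : [set _ | S a] = set0) ?setI0 ?measure0 ?mulr0//.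
by apply/seteqP; split.
Qed.

End FiniteValued.

Section QuantisedAtom.
Context {d0 : measure_display} {T0 : measurableType d0} {R : realType}.
Variables (P0 : probability T0 R) (xi : T0 -> R[i]).
Hypothesis xi_rv : complex_rv xi.
Variables (Om : finType) (phi : R * R -> Om).
Hypothesis mphi : forall a, measurable (phi @^-1` [set a]).

Lemma measurable_quantised d (T : measurableType d) (Z : T -> R[i]) a :
  complex_rv Z -> measurable [set w | phi (reim (Z w)) = a].
Proof. by move=> mZ; have := mZ measurableT _ (mphi a); rewrite setTI. Qed.

Let mass a := fine (P0 [set w | phi (reim (xi w)) = a]).

Let mass_ge0 a : 0 <= mass a.
Proof. by rewrite fine_ge0. Qed.

Let law S : P0 [set w | S (phi (reim (xi w)))] = (\sum_a mass a * (`[< S a >])%:R)%:E.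
Proof. by apply: law_finite => a; exact: measurable_quantised. Qed.

Let mass_sum1 : \sum_a mass a = 1.
Proof.
apply: EFin_inj; rewrite -(probability_setT P0) -(_ : [set w | True] = setT).
  by rewrite (law (fun=> True)); congr (_%:E); apply: eq_bigr => a _; rewrite asboolT// mulr1.
by apply/seteqP; split.
Qed.

Definition quantised_law : finpmf R Om := FinPmf mass_ge0 mass_sum1.

Lemma quantised_lawE a : P0 [set w | phi (reim (xi w)) = a] = (quantised_law a)%:E.
Proof. by rewrite /= fineK ?fin_num_measure//; exact: measurable_quantised. Qed.

Lemma quantised_law_event (S : pred Om) :
  P0 [set w | S (phi (reim (xi w)))] = (\sum_(a | S a) quantised_law a)%:E.
Proof.
rewrite (law S) [in RHS]big_mkcond; congr (_%:E); apply: eq_bigr => a _.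
by case: ifPn => Sa; [rewrite asboolT// mulr1|rewrite asboolF ?mulr0//; exact/negP].
Qed.

Context {d : measure_display} {T : measurableType d}.
Variables (P : probability T R) (I : finType) (Z : I -> T -> R[i]).
Hypotheses (Z_rv : forall i, complex_rv (Z i)) (Z_law : forall i, same_law P P0 (Z i) xi).
Hypothesis Z_indep : mutually_independent P Z.

Definition quantised (w : T) : {ffun I -> Om} := [ffun i => phi (reim (Z i w))].

Let quantisedE f : quantised @^-1` [set f] =
  [set w | forall i, i \in [set: I]%SET -> (phi @^-1` [set f i]) (reim (Z i w))].
Proof.
apply/seteqP; split=> w /=; first by move=> <- i _; rewrite ffunE.
by move=> h; apply/ffunP => i; rewrite ffunE h// inE.
Qed.

Lemma measurable_quantised_family f : measurable (quantised @^-1` [set f]).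
Proof.
rewrite quantisedE (_ : [set w | _] =
    \bigcap_(i in [set: I]) [set w | phi (reim (Z i w)) = f i]).
  apply: fin_bigcap_measurable => [|i _]; first exact: finite_finset.
  exact: measurable_quantised.
by apply/seteqP; split=> w /= h i; [move=> _; apply: h; rewrite inE|move=> _; exact: h].
Qed.

(** Independence turns the law of the discretised family into the product law,
    which makes the finite estimates available. *)
Lemma quantised_product_law (S : {ffun I -> Om} -> Prop) :
  P [set w | S (quantised w)] = (pr quantised_law S)%:E.
Proof.
rewrite (law_finite P measurable_quantised_family); congr (_%:E).
apply: eq_bigr => f _; congr (_ * _).
rewrite quantisedE (Z_indep [set: I]%SET (fun i => mphi (f i))).
rewrite (eq_bigl xpredT); last by move=> i; rewrite inE.
under eq_bigr => i _ do rewrite (Z_law i (mphi (f i))) /= quantised_lawE.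
by rewrite prodEFin.
Qed.

End QuantisedAtom.

Section Quantiser.
Variables (R : realType) (N : nat).
Hypothesis N_gt0 : (0 < N)%N.

(** A grid of mesh 1 / N on [-N, N]. Only the points of this interval are
    close to the value of their level. *)
Definition level (x : R) : 'I_(2 * N * N).+1 := inord (Num.truncn ((x + N%:R) * N%:R)).

Definition level_value (k : 'I_(2 * N * N).+1) : R := k%:R / N%:R - N%:R.

Lemma level_close x : `|x| <= N%:R -> `|x - level_value (level x)| <= N%:R^-1.
Proof.
have Np : 0 < N%:R :> R by rewrite ltr0n.
rewrite ler_norml => /andP[x1 x2]; set y := (x + N%:R) * N%:R.
have y0 : 0 <= y by rewrite mulr_ge0// -lerBlDr sub0r.
have yN : y <= (2 * N * N)%:R.
  by rewrite !natrM ler_wpM2r// [2 * _]mulr_natl mulr2n lerD2r.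
have /andP[t1 t2] := truncn_itv y0.
rewrite /level_value /level inordK; last by rewrite ltnS -(ler_nat R) (le_trans t1).
rewrite -/y; set k := Num.truncn y in t1 t2 *.
have -> : x - (k%:R / N%:R - N%:R) = (y - k%:R) / N%:R.
  by rewrite /y; field; rewrite gt_eqF.
rewrite ger0_norm ?divr_ge0 ?subr_ge0//.
by rewrite -[leRHS]mul1r ler_wpM2r ?invr_ge0// lerBlDr addrC natr1 ltW.
Qed.

Lemma measurable_level k : measurable (level @^-1` [set k]).
Proof.
pose y (x : R) := (x + N%:R) * N%:R.
have my : measurable_fun setT y.
  by apply: measurable_funM => //; apply: measurable_funD.
have mle j : measurable [set x | (Num.truncn (y x) <= j)%N].
  rewrite (_ : [set x | _] = y @^-1` `]-oo, j.+1%:R[).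
    by rewrite -[X in measurable X]setTI; apply: my.
  by apply/seteqP; split=> x /=; rewrite in_itv /= truncn_le_nat.
have meq j : measurable [set x | Num.truncn (y x) = j].
  case: j => [|j].
    rewrite (_ : [set x | _] = [set x | (Num.truncn (y x) <= 0)%N])//.
    by apply/seteqP; split=> x /=; [move=> ->|rewrite leqn0 => /eqP].
  rewrite (_ : [set x | _] = [set x | (Num.truncn (y x) <= j.+1)%N] `\`
      [set x | (Num.truncn (y x) <= j)%N]); first exact: measurableD.
  apply/seteqP; split=> x /=; first by move=> ->; rewrite leqnn ltnn.
  by move=> [h1 /negP]; rewrite -ltnNge => h2; apply/eqP; rewrite eqn_leq h1.
rewrite (_ : level @^-1` [set k] = \bigcup_(j in [set j | inord j = k])
    [set x | Num.truncn (y x) = j]).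
  by apply: bigcup_measurable.
apply/seteqP; split=> [x /= h|x [j /= h1 h2]]; first by exists (Num.truncn (y x)).
by rewrite /level -/(y x) h2.
Qed.

Definition cell := ('I_(2 * N * N).+1 * 'I_(2 * N * N).+1)%type.

Definition quantise (z : R * R) : cell := (level z.1, level z.2).

Definition cell_value (a : cell) : R[i] := (level_value a.1 +i* level_value a.2)%C.

Lemma measurable_quantise a : measurable (quantise @^-1` [set a]).
Proof.
have -> : quantise @^-1` [set a] =
    (level @^-1` [set a.1]) `*` (level @^-1` [set a.2]).
  apply/seteqP; split=> [[x y] /= <-//|[x y] /= [h1 h2]].
  by case: a h1 h2 => a1 a2 /= <- <-.
by apply: measurableX; exact: measurable_level.
Qed.

Lemma quantise_close (z : R[i]) : cabs z <= N%:R ->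
  cabs (z - cell_value (quantise (reim z))) <= 2 / N%:R.
Proof.
move=> zN; rewrite -ler_sqr ?nnegrE ?cabs_ge0 ?divr_ge0// cabs2E ReD ImD ReN ImN /=.
have h1 := level_close (le_trans (Re_le_cabs z) zN).
have h2 := level_close (le_trans (Im_le_cabs z) zN).
rewrite -(real_normK (num_real (complex.Re z - _))) -(real_normK (num_real (complex.Im z - _))).
have := normr_ge0 (complex.Re z - level_value (level (complex.Re z))).
have := normr_ge0 (complex.Im z - level_value (level (complex.Im z))).
move: h1 h2; rewrite /level_value /=.
set a := `|_ - _|; set b := `|_ - _|; nra.
Qed.

End Quantiser.

(** * The structured matrix *)

Section Blocks.
Variables (n L : nat).
Hypothesis nL : (L < n)%N.

Definition block (i : 'I_n) : 'I_L.+1 := inord ((i * L.+1) %/ n)%N.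

Lemma blockE i : block i = ((i * L.+1) %/ n)%N :> nat.
Proof. by rewrite inordK// ltn_divLR ?(leq_ltn_trans _ nL)// mulnC ltn_pmul2l. Qed.

(** The indices i with i (L + 1) in [l n, (l + 1) n) are consecutive, starting from
    the ceiling of l n / (L + 1). *)
Lemma block_size l : (n %/ L.+1 <= #|[pred i | block i == l]|)%N.
Proof.
have n0 : (0 < n)%N by apply: leq_ltn_trans nL.
set q := (n %/ L.+1)%N; pose start := ((l * n + L) %/ L.+1)%N.
have qL : (q * L.+1 <= n)%N by exact: leq_trunc_div.
have start1 : (start * L.+1 <= l * n + L)%N by exact: leq_trunc_div.
have start2 : (l * n <= start * L.+1)%N.
  by have := ltn_ceil (l * n + L) (ltn0Sn L); rewrite -/start mulSn; lia.
have cell_lt (a : 'I_q) : ((start + a) * L.+1 < l.+1 * n)%N.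
  have : (a.+1 * L.+1 <= q * L.+1)%N by rewrite leq_mul2r ltn_ord orbT.
  by rewrite !mulSn mulnDl; lia.
have cell_n (a : 'I_q) : (start + a < n)%N.
  rewrite -(ltn_pmul2r (ltn0Sn L)); apply: leq_trans (cell_lt a) _.
  by rewrite [(n * _)%N]mulnC leq_mul2r (ltn_ord l) orbT.
rewrite -[q]card_ord -(card_imset _ (_ : injective (fun a : 'I_q => Ordinal (cell_n a)))).
  apply/subset_leq_card/fintype.subsetP => _ /imsetP[a _ ->]; rewrite inE.
  rewrite -val_eqE [val _]blockE /= eqn_leq -ltnS ltn_divLR// cell_lt leq_divRL//.
  by apply: leq_trans start2 _; rewrite leq_mul2r leq_addr orbT.
by move=> a b [] /addnI h; exact: val_inj.
Qed.

Lemma adjacent_blocks i j : (block i <= (block j).+1)%N -> (block j <= (block i).+1)%N ->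
  (cyclic_dist i j * L.+1 < 2 * n)%N.
Proof.
have n0 : (0 < n)%N by apply: leq_ltn_trans nL.
rewrite !blockE.
have := leq_trunc_div (i * L.+1) n; have := ltn_ceil (i * L.+1) n0.
have := leq_trunc_div (j * L.+1) n; have := ltn_ceil (j * L.+1) n0.
set bi := (i * _ %/ n)%N; set bj := (j * _ %/ n)%N => h1 h2 h3 h4 h5 h6.
have h5' : (bi * n <= bj.+1 * n)%N by rewrite leq_mul2r h5 orbT.
have h6' : (bj * n <= bi.+1 * n)%N by rewrite leq_mul2r h6 orbT.
apply: (@leq_ltn_trans (`|(i : nat) - (j : nat)|%N * L.+1)%N).
  by rewrite leq_mul2r geq_minl orbT.
rewrite mulSn in h1 h3 h5' h6'; rewrite mulSn in h6'.
have [ij|ij] := leqP i j.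
  by rewrite distnEr// mulnBl; lia.
by rewrite distnEl ?(ltnW ij)// mulnBl; lia.
Qed.

End Blocks.

Section Quantisation.
Variables (R : realType) (n : nat) (A : 'M[R]_n) (B : 'M[R[i]]_n).
Hypothesis hA : forall i j, 0 <= A i j <= 1.

Lemma profile_of_band (L : nat) (sigma eps : R) : (L < n)%N -> 2 / eps < L.+1%:R -> 0 < eps ->
  (forall i j : 'I_n, (cyclic_dist i j)%:R <= eps * n%:R -> sigma <= A i j) ->
  profile A (@block n L) sigma (2 * L.+1%:R)^-1.
Proof.
move=> nL Leps e0 band; split=> //.
  move=> l; apply: le_trans (_ : (n %/ L.+1)%:R <= _); last by rewrite ler_nat block_size.
  rewrite mulrC ler_pdivrMr ?mulr_gt0// -natrM -natrM ler_nat.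
  have h1 := ltn_ceil n (ltn0Sn L).
  have h2 : (0 < n %/ L.+1)%N by rewrite divn_gt0.
  set q := (n %/ L.+1)%N in h1 h2 *.
  have : (q.+1 * L.+1 <= 2 * q * L.+1)%N by rewrite leq_mul2r; lia.
  by rewrite mulnCA mulnA => /(leq_trans (ltnW h1)).
move=> i j h1 h2; apply: band.
have h := adjacent_blocks nL h1 h2; rewrite -(ltr_nat R) !natrM in h.
have n0 : 0 < n%:R :> R by rewrite ltr0n (leq_ltn_trans _ nL).
rewrite -(ler_pM2r (_ : 0 < L.+1%:R)) ?ltr0n//; apply: le_trans (ltW h) _.
rewrite mulrAC ler_pM2r//; move: Leps; rewrite ltr_pdivrMr// mulrC => /ltW; rewrite [eps * _]mulrC.
by rewrite mulrC.
Qed.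

Lemma structured_close (Y Y' : 'M[R[i]]_n) (eta : R) i j : cabs (Y i j - Y' i j) <= eta ->
  cabs (structured_matrix A Y B i j - structured_matrix A Y' B i j) <= eta.
Proof.
have /andP[a0 a1] := hA i j; rewrite !mxE.
rewrite [X in _ -> cabs X <= _](_ : _ = (A i j)%:C%C * (Y i j - Y' i j)); last by ring.
rewrite cabsM cabs_real ger0_norm//; apply: le_trans.
by rewrite ler_piMl ?cabs_ge0.
Qed.

Context {d : measure_display} {T : measurableType d}.
Variable X : T -> 'M[R[i]]_n.
Hypothesis X_rv : forall i j, complex_rv (fun w => X w i j).

Definition quantised_matrix (N : nat) (w : T) : 'M[R[i]]_n :=
  \matrix_(i, j) cell_value R (quantise N (reim (X w i j))).

(** A Lipschitz statistic of the matrix is the pointwise limit of the same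
    statistic of the discretised matrices, which takes finitely many values.
    This gives the measurability of the extreme singular values without any
    continuity argument on the spectrum. *)
Lemma measurable_lipschitz_statistic (F : 'M[R[i]]_n -> R) :
  (forall (M M' : 'M[R[i]]_n) (eta : R), 0 <= eta -> (forall i j, cabs (M i j - M' i j) <= eta) ->
     F M <= F M' + n%:R * eta) ->
  measurable_fun setT (fun w => F (structured_matrix A (X w) B)).
Proof.
move=> hF; pose h N w := F (structured_matrix A (quantised_matrix N.+1 w) B).
apply: (@measurable_fun_cvg _ _ _ _ h) => [N|w _].
  pose Z (p : 'I_n * 'I_n) w := X w p.1 p.2.
  pose g (f : {ffun 'I_n * 'I_n -> cell N.+1}) :=
    F (structured_matrix A (\matrix_(i, j) cell_value R (f (i, j))) B).
  have -> : h N = fun w => g (quantised (quantise N.+1) Z w).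
    apply/funext => w; rewrite /h /g; congr (F (structured_matrix _ _ _)).
    by apply/matrixP => i j; rewrite !mxE ffunE.
  apply: measurable_fun_finite => f; apply: measurable_quantised_family.
    exact: measurable_quantise.
  by move=> p; exact: X_rv.
apply/cvgrPdist_le => e e0.
pose b := \sum_i \sum_j cabs (X w i j).
have Xb i j : cabs (X w i j) <= b.
  rewrite /b (bigD1 i)//= (bigD1 j)//= -addrA lerDl addr_ge0//.
    by apply: sumr_ge0 => *; exact: cabs_ge0.
  by apply: sumr_ge0 => *; apply: sumr_ge0 => *; exact: cabs_ge0.
exists (Num.truncn (b + 2 * n%:R / e)) => //= N bN.
have Np : 0 < N.+1%:R :> R by [].
have big : b + 2 * n%:R / e <= N.+1%:R.
  by apply: ltW; apply: lt_le_trans (truncnS_gt _) _; rewrite ler_nat ltnS.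
have b0 : 0 <= b by apply: sumr_ge0 => *; apply: sumr_ge0 => *; exact: cabs_ge0.
have ne0 : 0 <= 2 * n%:R / e by rewrite divr_ge0 ?mulr_ge0// ltW.
have close i j : cabs (X w i j - quantised_matrix N.+1 w i j) <= 2 / N.+1%:R.
  by rewrite mxE; apply: quantise_close => //; apply: le_trans (Xb i j) _; lra.
have small : n%:R * (2 / N.+1%:R) <= e.
  rewrite mulrA ler_pdivrMr// -ler_pdivrMl// mulrC [n%:R * 2]mulrC; lra.
have eta0 : 0 <= 2 / N.+1%:R :> R by rewrite divr_ge0.
rewrite ler_norml /h; apply/andP; split.
  rewrite lerBrDl lerBlDr; apply: le_trans (hF _ (structured_matrix A (X w) B) _ eta0 _) _.
    by move=> i j; rewrite -cabsN opprB; exact: structured_close.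
  by rewrite lerD2l.
rewrite lerBlDl; apply: le_trans (hF _ (structured_matrix A (quantised_matrix N.+1 w) B) _ eta0 _) _.
  by move=> i j; exact: structured_close.
by rewrite lerD2l.
Qed.

End Quantisation.

(** A perturbation of operator norm at most 1 / n costs a factor 2 in K, since
    K sqrt n >= 1 / n, and 1 / sqrt n in t. *)
Lemma perturbed_event (R : realType) (n : nat) (M M' : 'M[R[i]]_n) (K t eta : R) :
  (0 < n)%N -> 1 <= K -> 0 <= t -> n%:R * eta <= n%:R^-1 ->
  (forall i j, cabs (M' i j - M i j) <= eta) ->
  singular_value M n <= t / Num.sqrt n%:R -> opnorm M <= K * Num.sqrt n%:R ->
  opbound M' ((2 * K) ^+ 2 * n%:R) /\
  exists u, sqnorm u = 1 /\ sqnorm (mulv M' u) <= (t + (Num.sqrt n%:R)^-1) ^+ 2 / n%:R.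
Proof.
move=> n0 K1 t0 eta_small close small bounded; set s := Num.sqrt n%:R in small bounded *.
have s2 : s ^+ 2 = n%:R by rewrite sqr_sqrtr.
have s1 : 1 <= s by rewrite -[1]sqrtr1 ler_sqrt// ler1n.
have sp : 0 < s by apply: lt_le_trans s1.
have etas : n%:R * eta <= s^-1 ^+ 2 by rewrite exprVn s2.
have is1 : s^-1 <= 1 by rewrite invf_le1.
have is0 : 0 < s^-1 by rewrite invr_gt0.
split.
  rewrite -s2 -exprMn; apply/nrm_opbound => [|u]; first by rewrite !mulr_ge0// ltW// (lt_le_trans _ K1).
  apply: le_trans (nrm_perturb u close) _.
  apply: (@le_trans _ _ ((K * s + n%:R * eta) * nrm u)).
    rewrite mulrDl lerD2r; apply: le_trans (opnorm_bound M u) _.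
    by rewrite ler_wpM2r ?nrm_ge0.
  rewrite ler_wpM2r ?nrm_ge0//; nra.
have [_ _ [u [u1 us]]] := last_singular_value M n0.
exists u; split=> //; rewrite -nrm2 -s2 -expr_div_n.
rewrite lerXn2r ?nnegrE ?nrm_ge0 ?divr_ge0 ?addr_ge0 ?(ltW is0) ?(ltW sp)//.
apply: le_trans (nrm_perturb u close) _.
have -> : nrm u = 1 by rewrite /nrm u1 sqrtr1.
by rewrite us mulr1 mulrDl; apply: lerD => //; rewrite -expr2.
Qed.

Section Interface.
Context {R : realType} {d0 : measure_display} {T0 : measurableType d0}.
Variables (P0 : probability T0 R) (xi : T0 -> R[i]).
Hypotheses (xi_rv : complex_rv xi) (xi_var : ('E_P0[fun w => (cabs (xi w) ^+ 2)%R] = 1)%E).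

(** The grid is fine compared with the radius, and the atom rarely leaves it. *)
Lemma quantised_anticonc (kappa : R) (N : nat) : 1 <= kappa -> cexpectation P0 xi = 0 ->
  spread P0 kappa xi -> 32 * kappa ^+ 3 <= N%:R ->
  anticonc (quantised_law P0 xi_rv (@measurable_quantise R N)) (@cell_value R N)
    (8 * kappa)^-1 (32 * kappa ^+ 3)^-1.
Proof.
move=> k1 mean0 spr kN z.
have kk : kappa <= kappa ^+ 3 by apply: ler_eXnr.
have Np : 0 < N%:R :> R by lra.
have N1 : 1 <= N%:R :> R by lra.
have N0 : (0 < N)%N by rewrite -(ltr_nat R).
have small := spread_small_ball xi_rv mean0 xi_var k1 spr z.
have tail := atom_tail xi_rv xi_var Np.
set r := (4 * kappa)^-1 in small; set p := (16 * kappa ^+ 3)^-1 in small.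
have rE : (8 * kappa)^-1 = r / 2 by rewrite /r; field; rewrite gt_eqF//; lra.
have pE : (32 * kappa ^+ 3)^-1 = p / 2 by rewrite /p; field; rewrite gt_eqF//; lra.
have mball : measurable [set w | cabs (xi w - z) <= r].
  have r0 : 0 <= r by rewrite invr_ge0 mulr_ge0//; lra.
  apply (measurable_disc xi_rv z r0).
have mtail := measurable_tail xi_rv (ltW Np).
rewrite -lee_fin -(quantised_law_event P0 xi_rv _ (fun a => cabs (cell_value R a - z) <= _)).
apply: (@le_trans _ _ (P0 ([set w | cabs (xi w - z) <= r] `|` [set w | N%:R < cabs (xi w)]))).
  apply: le_measure; rewrite ?inE.
  - have mY a : measurable ((fun w => quantise N (reim (xi w))) @^-1` [set a]).
      exact (measurable_quantised (@measurable_quantise R N) a xi_rv).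
    exact (measurable_finite mY (fun a => cabs (cell_value R a - z) <= (8 * kappa)^-1)).
  - exact: measurableU.
  move=> w /= h; have [le|] := leP (cabs (xi w)) N%:R; [left|by right].
  have := cabsD (xi w - cell_value R (quantise N (reim (xi w))))
    (cell_value R (quantise N (reim (xi w))) - z).
  rewrite addrA subrK => /le_trans; apply; move: h; rewrite rE => h.
  have := quantise_close N0 le.
  have : 2 / N%:R <= r / 2.
    by rewrite -rE ler_pdivrMr// [leRHS]mulrC ler_pdivlMr; lra.
  lra.
apply: le_trans (measureU2 _ mball mtail) _; apply: le_trans (leeD small tail) _.
rewrite -EFinD lee_fin pE.
have : N%:R ^- 2 <= p / 2.
  rewrite -pE; apply: (@le_trans _ _ N%:R^-1).
    by rewrite lef_pV2 ?posrE ?exprn_gt0// ler_eXnr.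
  by rewrite lef_pV2 ?posrE//; lra.
lra.
Qed.

Context {d : measure_display} {T : measurableType d}.
Variables (P : probability T R) (n : nat) (X : T -> 'M[R[i]]_n).
Hypotheses (X_rv : forall i j, complex_rv (fun w => X w i j))
  (X_law : forall i j, same_law P P0 (fun w => X w i j) xi).

Definition overflow (N : R) : set T := [set w | exists i j, N < cabs (X w i j)].

(** A union bound over the n ^ 2 entries, each transferred to the atom by the
    equality of laws. *)
Lemma overflow_small (N : R) : 0 < N ->
  measurable (overflow N) /\ (P (overflow N) <= ((n%:R / N) ^+ 2)%:E)%E.
Proof.
move=> N0; pose D := [set z : R * R | N < cabs (z.1 +i* z.2)%C].
have mD : measurable D.
  have rv : complex_rv (fun z : R * R => (z.1 +i* z.2)%C).
    rewrite /complex_rv (_ : (fun z => _) = id)//.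
    by apply/funext => -[].
  exact (measurable_tail rv (ltW N0)).
have DE (z : R[i]) : D (reim z) = (N < cabs z) by case: z.
have mE i j : measurable [set w | D (reim (X w i j))].
  by have := X_rv i j measurableT mD; rewrite setTI.
have PE i j : (P [set w | D (reim (X w i j))] <= (N ^- 2)%:E)%E.
  rewrite X_law//; apply: le_trans (atom_tail xi_rv xi_var N0).
  by under eq_set do rewrite DE.
have -> : overflow N =
    \big[setU/set0]_(p : 'I_n * 'I_n) [set w | D (reim (X w p.1 p.2))].
  rewrite -bigcup_seq; apply/seteqP; split=> [w [i [j h]]|w [[i j] _]] /=; last by rewrite DE => h; exists i, j.
  by exists (i, j); rewrite /= ?mem_index_enum// DE.
have -> : (n%:R / N) ^+ 2 = \sum_(p : 'I_n * 'I_n) N ^- 2.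
  by rewrite sumr_const card_prod card_ord -[RHS]mulr_natl natrM expr_div_n expr2.
elim/big_ind2: _ => [|a x b y [ma Pa] [mb Pb]|p _]; last by split.
  by split; rewrite ?measure0.
split; first exact: measurableU.
by apply: le_trans (measureU2 _ ma mb) _; rewrite EFinD; exact: leeD.
Qed.

End Interface.

(** * The smallest singular value *)

Theorem corollary1p16 (R : realType) (K sigma0 eps kappa0 : R)
  (hK : 1 <= K)
  (hsigma0 : 0 < sigma0 < 1)
  (heps : 0 < eps < 1)
  (hkappa0 : 1 <= kappa0) :
  exists C : R,
    forall (n : nat) (hn : (1 <= n)%N)
      (A : 'M[R]_n) (B : 'M[R[i]]_n)
      (hA : forall i j, 0 <= A i j <= 1)
      (d0 : measure_display) (T0 : measurableType d0) (P0 : probability T0 R)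
      (xi : T0 -> R[i])
      (xi_rv : complex_rv xi)
      (xi_mean : cexpectation P0 xi = 0)
      (xi_var : ('E_P0[fun w => (cabs (xi w) ^+ 2)%R] = 1)%E)
      (xi_spread : spread P0 kappa0 xi)
      (d : measure_display) (T : measurableType d) (P : probability T R)
      (X : T -> 'M[R[i]]_n)
      (X_rv : forall i j, complex_rv (fun w => X w i j))
      (X_law : forall i j, same_law P P0 (fun w => X w i j) xi)
      (X_indep : mutually_independent P
                   (fun (p : 'I_n * 'I_n) w => X w p.1 p.2))
      (hband : forall i j : 'I_n,
         (cyclic_dist i j)%:R <= eps * n%:R -> sigma0 <= A i j)
      (t : R) (ht : 0 <= t),
    let M := fun w => structured_matrix A (X w) B in
    (P [set w | (singular_value (M w) n <= t / Num.sqrt n%:R)%R /\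
                (opnorm (M w) <= K * Num.sqrt n%:R)%R]
     <= (C * (t + 1 / Num.sqrt n%:R))%:E)%E.
Proof.
case/andP: heps => eps0 eps1; case/andP: hsigma0 => sigma00 _.
have k0 : 0 < kappa0 by apply: lt_le_trans hkappa0.
pose L := Num.truncn (2 / eps).
have Leps : 2 / eps < L.+1%:R by exact: truncnS_gt.
have L1 : (1 < L.+1)%N.
  rewrite ltnS truncn_gt0 ler_pdivlMr//; lra.
have kk : kappa0 <= kappa0 ^+ 3 by apply: ler_eXnr.
have [C C0 small] := @smallest_singular_value_fin R (2 * K) sigma0 (8 * kappa0)^-1
  (32 * kappa0 ^+ 3)^-1 (2 * L.+1%:R)^-1 L.+1 ltac:(lra) sigma00
  ltac:(rewrite invr_gt0; lra) ltac:(rewrite invr_gt0; lra)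
  ltac:(rewrite invf_le1; lra) ltac:(by rewrite invr_gt0 mulr_gt0) L1.
exists (L.+1%:R + 1 + 2 * C) => n n0 A B hA d0 T0 P0 xi xi_rv xi_mean xi_var xi_spread
  d T P X X_rv X_law X_indep band t t0; lazy beta zeta.
set s := Num.sqrt n%:R; set E := [set w | _].
pose M w := structured_matrix A (X w) B.
have mE : measurable E.
  have mstat := @measurable_lipschitz_statistic _ _ A B hA _ _ X X_rv.
  rewrite (_ : E = (fun w => singular_value (M w) n) @^-1` `]-oo, t / s] `&`
      (fun w => opnorm (M w)) @^-1` `]-oo, K * s]); last first.
    by apply/seteqP; split=> w /=; rewrite !in_itv.
  apply: measurableI; rewrite -[X in measurable X]setTI.
    apply: (mstat (fun M' => singular_value M' n)) => // M1 M2 eta _.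
    exact: singular_value_perturb.
  by apply: (mstat (@opnorm R n)) => // M1 M2 eta; exact: opnorm_perturb.
have s2 : s ^+ 2 = n%:R by rewrite sqr_sqrtr.
have s1 : 1 <= s by rewrite -[1]sqrtr1 ler_sqrt// ler1n.
have sp : 0 < s by apply: lt_le_trans s1.
have is0 : 0 < s^-1 by rewrite invr_gt0.
(* For n <= L some blocks are empty, but then the right-hand side is at
   least 1. *)
rewrite div1r; have [nL|nL] := leqP n L.
  apply: le_trans (probability_le1 _ mE) _.
  rewrite lee_fin; apply: (@le_trans _ _ (L.+1%:R * s^-1)).
    rewrite ler_pdivlMr// mul1r; apply: (@le_trans _ _ (s ^+ 2)).
      by rewrite ler_eXnr.
    by rewrite s2 ler_nat ltnW.
  by apply: ler_pM; rewrite ?(ltW is0)//; lra.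
have n1 : 1 <= n%:R :> R by rewrite ler1n.
(* N >= 2 n ^ 2 makes n * (2 / N), the operator norm of the rounding error, at
   most 1 / n; N >= 32 kappa0 ^ 3 keeps the rounded atom anticoncentrated. *)
pose N := maxn (2 * n * n) (Num.truncn (32 * kappa0 ^+ 3)).+1.
have Nn : 2 * n%:R * n%:R <= N%:R :> R by rewrite -!natrM ler_nat leq_maxl.
have Nk : 32 * kappa0 ^+ 3 <= N%:R.
  by apply: ltW; apply: lt_le_trans (truncnS_gt _) _; rewrite ler_nat leq_maxr.
have Np : 0 < N%:R :> R by lra.
have N0 : (0 < N)%N by rewrite -(ltr_nat R).
have small_grid : n%:R * (2 / N%:R) <= n%:R^-1 :> R.
  rewrite mulrA ler_pdivrMr// ler_pdivlMl; last lra.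
  lra.
pose Z (p : 'I_n * 'I_n) w := X w p.1 p.2.
pose val := @cell_value R N.
pose Y w := quantised (quantise N) Z w.
have YE w i j : entry val A B (Y w) i j =
    structured_matrix A (\matrix_(i, j) cell_value R (quantise N (reim (X w i j)))) B i j.
  by rewrite /entry !mxE ffunE.
have Z_rv p : complex_rv (Z p) by exact: X_rv.
have Z_law p : same_law P P0 (Z p) xi by exact: X_law.
pose G x := opbound (entry val A B x) ((2 * K) ^+ 2 * n%:R) /\ exists u : 'I_n -> R[i],
  sqnorm u = 1 /\ sqnorm (mulv (entry val A B x) u) <= (t + s^-1) ^+ 2 / n%:R.
have mG : measurable [set w | G (Y w)].
  exact: (measurable_finite (measurable_quantised_family (@measurable_quantise R N) Z_rv)).
have PG : (P [set w | G (Y w)] <= (C * (t + s^-1 + s^-1))%:E)%E.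
  rewrite (quantised_product_law xi_rv (@measurable_quantise R N) Z_rv Z_law X_indep G).
  rewrite lee_fin; apply: small => //.
  - exact: quantised_anticonc.
  - exact: profile_of_band band.
  - by rewrite addr_ge0// ltW.
have [mO PO] := overflow_small xi_rv xi_var X_rv X_law Np.
have cover : E `<=` [set w | G (Y w)] `|` overflow X N%:R.
  move=> w [h1 h2]; have [ov|ov] := pselect (overflow X N%:R w); [by right|left].
  have close i j : cabs (entry val A B (Y w) i j - M w i j) <= 2 / N%:R.
    rewrite YE -cabsN opprB; apply: structured_close => //; rewrite mxE.
    apply: quantise_close => //; rewrite leNgt; apply/negP => h.
    by apply: ov; exists i, j.
  have := @perturbed_event R n (M w) (\matrix_(i, j) entry val A B (Y w) i j)
    K t _ n0 hK t0 small_grid.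
  have -> : fun_of_matrix (\matrix_(i, j) entry val A B (Y w) i j) = entry val A B (Y w).
    by apply/funext => i; apply/funext => j; rewrite mxE.
  by move=> /(_ close h1 h2).
apply: le_trans (le_measure _ _ _ cover) _; rewrite ?inE//; first exact: measurableU.
apply: le_trans (measureU2 _ mG mO) _; apply: le_trans (leeD PG PO) _.
rewrite -EFinD lee_fin.
have : (n%:R / N%:R) ^+ 2 <= s^-1 :> R.
  apply: (@le_trans _ _ (n%:R / N%:R)).
    rewrite expr2 ler_piMl ?divr_ge0 ?ler0n//  ler_pdivrMr// mul1r; nra.
  have sn : s <= n%:R by rewrite -s2 ler_eXnr.
  rewrite ler_pdivrMr// ler_pdivlMl//; nra.
have : 0 <= L.+1%:R * (t + s^-1) by rewrite mulr_ge0// addr_ge0// ltW.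
have : C * (t + s^-1 + s^-1) <= 2 * C * (t + s^-1).
  by rewrite [2 * C]mulrC -mulrA ler_pM2l//; lra.
rewrite !mulrDl mul1r; lra.
Qed.
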